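(* Let $g:\mathbb{N}\to\mathbb{N}$ be a super-polynomial time constructible function. Then ${\rm NEXP}\not\subseteq {\rm NP}_{\rm T}(\mathrm{Pad}({\rm NP}, g(n)))$.
   Context: ${\rm NEXP}=\bigcup_{c\ge 1}\mathrm{NTIME}(2^{n^c})$. A function $g$ is super-polynomial if for every constant $c>0$, $g(n)\ge n^c$ for all large $n$; it is time constructible if given $n$, $g(n)$ can be computed in $O(g(n))$ deterministic steps. For a language $A\subseteq\{0,1\}^*$, $\mathrm{pad}(A,g(n))=\{x10^{g(|x|)-|x|-1}: x\in A\}$, and $\mathrm{Pad}({\rm NP},g(n))$ is the class of all languages $\mathrm{pad}(A,g(n))$ with $A\in{\rm NP}$. For a class $C$ of languages, ${\rm NP}_{\rm T}(C)$ is the class of languages reducible to some language in $C$ via polynomial-time nondeterministic Turing reductions. *)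

(* Defs.v *)
From HB Require Import structures.
From mathcomp Require Import all_boot.
From mathcomp Require Import classical_sets.

Set Implicit Arguments.
Unset Strict Implicit.
Unset Printing Implicit Defensive.

Local Open Scope classical_set_scope.
Local Open Scope nat_scope.

Definition word := seq bool.
Definition language := set word.

Inductive move := MoveLeft | MoveRight | Stay.

Definition option_of_move (d : move) : option bool :=
  match d with MoveLeft => Some false | MoveRight => Some true | Stay => None end.
Definition move_of_option (o : option bool) : move :=
  match o with Some false => MoveLeft | Some true => MoveRight | None => Stay end.
Lemma option_of_moveK : cancel option_of_move move_of_option.
Proof. by case. Qed.
HB.instance Definition _ := Finite.copy move (can_type option_of_moveK).

(* Tape alphabet: None is the blank, Some (inl b) the input symbol b, and
   Some (inr x) an auxiliary symbol. *)
Definition symbol (X : finType) : finType := option (bool + X).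

(* Two-way infinite tape: [lhs] lists the cells left of the head, nearest
   first; [rhs] lists the cells from the scanned one rightwards.  All cells
   that are not listed are blank. *)
Record tape (X : finType) := Tape { lhs : seq (symbol X); rhs : seq (symbol X) }.

Definition blank_tape X : tape X := Tape [::] [::].
Definition input_tape X (w : word) : tape X :=
  Tape [::] [seq Some (inl b) | b <- w].
Definition scan X (t : tape X) : symbol X := head None (rhs t).
Definition write X (s : symbol X) (t : tape X) : tape X :=
  Tape (lhs t) (s :: behead (rhs t)).
Definition shift X (d : move) (t : tape X) : tape X :=
  match d with
  | MoveLeft => Tape (behead (lhs t)) (head None (lhs t) :: rhs t)
  | MoveRight => Tape (scan t :: lhs t) (behead (rhs t))
  | Stay => t
  end.

Fixpoint bits_prefix X (s : seq (symbol X)) : word :=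
  if s is Some (inl b) :: s' then b :: bits_prefix s' else [::].

(* The word on a tape: the bits from the head rightwards, up to the first cell
   that does not hold a bit. *)
Definition tape_word X (t : tape X) : word := bits_prefix (rhs t).

(* Nondeterministic Turing machine with [aux_tapes.+1] tapes.  Tape [ord0]
   holds the input; outputs and oracle queries are read off tape [ord_max]. *)
Record ntm := Ntm {
  state : finType;
  aux_symbol : finType;
  aux_tapes : nat;
  start : state;
  accept : {set state};
  trans : state -> {ffun 'I_aux_tapes.+1 -> symbol aux_symbol} ->
          {set state * {ffun 'I_aux_tapes.+1 -> symbol aux_symbol * move}}
}.

Definition deterministic (M : ntm) : Prop :=
  forall (q : state M) s, #|trans q s| <= 1.

Record config (M : ntm) := Config {
  cstate : state M;
  ctapes : {ffun 'I_(aux_tapes M).+1 -> tape (aux_symbol M)}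
}.

Definition init (M : ntm) (w : word) : config M :=
  Config (start M)
    [ffun i => if i == ord0 then input_tape (aux_symbol M) w
               else blank_tape (aux_symbol M)].

Definition last_word (M : ntm) (c : config M) : word :=
  tape_word (ctapes c ord_max).

Definition step (M : ntm) (c c' : config M) : Prop :=
  exists2 a, a \in trans (cstate c) [ffun i => scan (ctapes c i)] &
    c' = Config a.1 [ffun i => shift (a.2 i).2 (write (a.2 i).1 (ctapes c i))].

(* Oracle machine: entering [query] asks whether the word on the last tape is
   in the oracle; one step later the machine is in [yes] or [no], with its
   tapes unchanged.  The transitions of [omachine] out of [query] are unused. *)
Record ontm := Ontm {
  omachine : ntm;
  query : state omachine;
  yes : state omachine;
  no : state omachine
}.

Definition ostep (B : language) (M : ontm) (c c' : config (omachine M)) : Prop :=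
  if cstate c == query M then
    (B (last_word c) /\ c' = Config (yes M) (ctapes c)) \/
    (~ B (last_word c) /\ c' = Config (no M) (ctapes c))
  else step c c'.

Section Computations.
Variables (C : Type) (R : C -> C -> Prop).

Fixpoint reach (m : nat) (c d : C) : Prop :=
  if m is m'.+1 then exists2 e, R c e & reach m' e d else c = d.

Definition halted (c : C) : Prop := forall d, ~ R c d.

Definition halts_within (t : nat) (c : C) : Prop :=
  forall m d, reach m c d -> m <= t.

Definition accepts (acc : C -> Prop) (c : C) : Prop :=
  exists m d, [/\ reach m c d, halted d & acc d].

End Computations.

(* [M], with one-step relation [R], decides [L] in time [t]: on every input all
   computation paths respect the time bound, and the input is in [L] iff some
   path halts in an accepting state. *)
Definition decides_in (M : ntm) (R : config M -> config M -> Prop)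
    (L : language) (t : nat -> nat) : Prop :=
  forall w : word,
    halts_within R (t (size w)) (init M w) /\
    (L w <-> accepts R (fun c => cstate c \in accept M) (init M w)).

(* A bound O(t) is written [k * t n + k]; the additive constant only matters
   where [t n] is 0. *)
Definition NTIME (t : nat -> nat) : set language :=
  [set L | exists (M : ntm) (k : nat),
     decides_in (@step M) L (fun n => k * t n + k)].

Definition oracle_NTIME (B : language) (t : nat -> nat) : set language :=
  [set L | exists (M : ontm) (k : nat),
     decides_in (@ostep B M) L (fun n => k * t n + k)].

Definition NP : set language :=
  \bigcup_(c in [set c | 1 <= c]) NTIME (fun n => n ^ c).

Definition NEXP : set language :=
  \bigcup_(c in [set c | 1 <= c]) NTIME (fun n => 2 ^ (n ^ c)).

Definition NP_T (C : set language) : set language :=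
  \bigcup_(B in C) \bigcup_(c in [set c | 1 <= c])
    oracle_NTIME B (fun n => n ^ c).

(* The subtraction is truncated: no zeros are appended when
   [g (size x) <= size x + 1]. *)
Definition pad (g : nat -> nat) (A : language) : language :=
  [set x ++ true :: nseq (g (size x) - size x - 1) false | x in A].

Definition Pad (C : set language) (g : nat -> nat) : set language :=
  [set pad g A | A in C].

Definition super_polynomial (g : nat -> nat) : Prop :=
  forall c, 0 < c -> exists N, forall n, N <= n -> n ^ c <= g n.

(* Value of a binary numeral, most significant bit first. *)
Definition binary_value (w : word) : nat :=
  foldl (fun v (b : bool) => v.*2 + b) 0 w.

(* The argument is given in unary and the value produced in binary. *)
Definition time_constructible (g : nat -> nat) : Prop :=
  exists (M : ntm) (k : nat), deterministic M /\
    forall n, exists m d,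
      [/\ m <= k * g n + k,
          reach (@step M) m (init M (nseq n true)) d,
          halted (@step M) d &
          binary_value (last_word d) = g n].

(* Main.v *)
(** Lazy diagonalization.  Suppose that an oracle machine [M], running in polynomial
    time with oracle [pad g A], decides the language of the machine [U] below, where
    a machine [N] decides [A].  The input of [U] is the code [e] of a triple ([M],
    [N], the table of the values of [g] at the small arguments), padded to length
    [x ^ c] for a large [x], followed by a bit string [w] read as a nondeterministic
    path of [M] on [e].  If [M] halts on [e] along [w], then [U] accepts [e w] iff
    this run rejects; otherwise [U] accepts iff [M] accepts both [e w 0] and [e w 1],
    along guessed paths.  As [g] is super-polynomial, a query that [M] has the time
    to write is a padding of a word of length at most [x] only, so [U] answers it by
    a depth-first search of all the paths of [N], in time less than [2 ^ (x ^ c)].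
    By downward induction on [w], [e w] is accepted iff every extension of the path
    [w] fails to accept [e]; for [w] empty, [M] accepts [e] iff it does not. *)

(* NEXP is not known to be closed under complement, so [U] cannot simply accept [e] when [M] rejects
   it. Along a fixed path the run of [M] is deterministic, and its verdict can be negated; the chain
   of inputs [e w] then carries the negation back to [e] through conjunctions only, which a
   nondeterministic machine evaluates by guessing. A query may have the answer no, which no guessed
   path of [N] certifies; hence the exhaustive search, and the need for queries about short words
   only. [U] is a single machine: [M], [N] and the values of [g] are read from its input. Its input
   may encode nothing meaningful, so a clock of exponential length is built into it, and correctness
   is proved only for the inputs [e w] of the contradiction. If [N] runs in time of order n^d, the
   search costs 2 to the order of x^d, up to a factor polynomial in x; the choice c = d + 2 makes
   this less than 2 to the length of [e]. The length of [e], the running times of [M] and the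
   lengths of its queries remain polynomial in x, so that g(m) exceeds the latter for all m > x once
   x is large. *)
From HB Require Import structures.
Require Import Defs.
From mathcomp Require Import all_boot classical_sets boolp.
From mathcomp Require Import zify.

Set Implicit Arguments.
Unset Strict Implicit.
Unset Printing Implicit Defensive.

Local Open Scope nat_scope.

(** * Stack programs and their clocked machines *)

Section Reach.
Variables (C : Type) (R : C -> C -> Prop).

Lemma reach_cat m n c d e : reach R m c d -> reach R n d e -> reach R (m + n) c e.
Proof. by elim: m c => [|m IH] c /= => [->//|[x Rx /IH H] /H]; exists x. Qed.

Lemma reach1 c d : R c d -> reach R 1 c d.
Proof. by exists d. Qed.

End Reach.

Section Stacks.
Variable reg : finType.

(** Programs over finitely many stacks of bits. [Guess] is the only source of nondeterminism and
    [Reject] is stuck, so a program accepts by running to its end. *)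
Inductive cmd :=
| Skip | Reject
| Push of reg & bool
| Pop of reg
| Guess of reg
| Seq of cmd & cmd
| If of reg & cmd & cmd & cmd
| While of reg & (option bool -> bool) & cmd.

Inductive stack_op := Nop | GoRight of reg | GoLeft of reg | Write of reg & bool.

End Stacks.

(** [While] carries a function, so equality of commands is taken classically; it is what turns a
    finite list of continuations into a finite type of states. *)
HB.instance Definition _ (reg : finType) := gen_eqMixin (cmd reg).
HB.instance Definition _ (reg : finType) := gen_choiceMixin (cmd reg).
HB.instance Definition _ (reg : finType) := gen_eqMixin (stack_op reg).
Arguments Skip {reg}.
Arguments Reject {reg}.
Arguments Nop {reg}.

Section Semantics.
Variable reg : finType.
Local Notation cmd := (cmd reg).
Local Notation stack_op := (stack_op reg).

Definition store := reg -> word.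
Definition top (s : store) (r : reg) : option bool := ohead (s r).
Definition upd (s : store) r w : store := fun r' => if r' == r then w else s r'.

(* A pushed bit takes two machine steps; the first component holds the bit
   between the two. *)
Definition control := (option (reg * bool) * seq cmd)%type.

Definition instr (t : reg -> option bool) (x : control) : seq (stack_op * control) :=
  match x with
  | (Some (r, b), k) => [:: (Write r b, (None, k))]
  | (None, [::]) => [::]
  | (None, c :: k) =>
    match c with
    | Skip => [:: (Nop, (None, k))]
    | Reject => [::]
    | Push r b => [:: (GoRight r, (Some (r, b), k))]
    | Pop r => [:: (if t r is Some _ then GoLeft r else Nop, (None, k))]
    | Guess r => [:: (Nop, (None, k)); (GoRight r, (Some (r, false), c :: k));
                     (GoRight r, (Some (r, true), c :: k))]
    | Seq c1 c2 => [:: (Nop, (None, [:: c1, c2 & k]))]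
    | If r c0 c1 c2 => [:: (Nop, (None, match t r with
        None => c0 | Some false => c1 | Some true => c2 end :: k))]
    | While r f c1 => [:: (Nop, (None, if f (t r) then [:: c1, c & k] else k))]
    end
  end.

Definition effect (o : stack_op) (s : store) : store :=
  match o with
  | Nop | GoRight _ => s
  | GoLeft r => upd s r (behead (s r))
  | Write r b => upd s r (b :: s r)
  end.

Definition acfg := (control * store)%type.

Definition astep (x y : acfg) : Prop :=
  exists2 o, (o, y.1) \in instr (top x.2) x.1 & y.2 = effect o x.2.

(** A forced step: a single instruction applies, which is never the case at a [Guess]. *)
Definition dstep (x y : acfg) : Prop :=
  exists2 o, instr (top x.2) x.1 = [:: (o, y.1)] & y.2 = effect o x.2.

Lemma dstep_astep x y : dstep x y -> astep x y.
Proof. by case=> o e1 e2; exists o => //; rewrite e1 inE. Qed.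

Lemma dreach_areach m x y : reach dstep m x y -> reach astep m x y.
Proof.
elim: m x => //= m IH x [e /dstep_astep st /IH rc]; by exists e.
Qed.

Lemma dstep_det x y z : dstep x y -> astep x z -> z = y.
Proof.
case: y z => [y1 y2] [z1 z2] [o /= e1 ->] [o' /=].
by rewrite e1 inE => /eqP[-> ->] ->.
Qed.

(** A run that ends in a stuck configuration cannot end before [y], so it passes through [y]. This
    makes a specification by [runs] say something about every accepting run. *)
Lemma dreach_det m n x y z : reach dstep m x y -> reach astep n x z ->
  (forall u, ~ astep z u) -> exists n', reach astep n' y z.
Proof.
elim: m n x => [|m IH] n x /=; first by move=> -> h _; exists n.
move=> [e xe ey]; case: n => [|n] /=.
  by move=> ez hz; case: (hz e); rewrite -ez; apply: dstep_astep.
move=> [e' st h] hz; rewrite (dstep_det xe st) in h; exact: IH ey h hz.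
Qed.

(** The quantification over the rest [k] of the program lets specifications compose. *)
Definition runs (c : cmd) (s : store) (N : nat) (s' : store) : Prop :=
  forall k, exists2 m, m <= N & reach dstep m ((None, c :: k), s) ((None, k), s').

Lemma runs_le c s N N' s' : runs c s N s' -> N <= N' -> runs c s N' s'.
Proof. by move=> h le k; case: (h k) => m lem; exists m => //; apply: leq_trans le. Qed.

Lemma runs_skip s : runs Skip s 1 s.
Proof. by move=> k; exists 1 => //; apply: reach1; exists Nop. Qed.

Lemma runs_push r b s : runs (Push r b) s 2 (upd s r (b :: s r)).
Proof.
move=> k; exists 2 => //; exists ((Some (r, b), k), s); first by exists (GoRight r).
by apply: reach1; exists (Write r b).
Qed.

Lemma upd_id s r : upd s r (s r) = s.
Proof. by apply: funext => r'; rewrite /upd; case: eqP => // ->. Qed.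

Lemma runs_pop r s : runs (Pop r) s 1 (upd s r (behead (s r))).
Proof.
move=> k; exists 1 => //; apply: reach1; rewrite /dstep /= /top.
by case E: (s r) => [|b w]; [exists Nop|exists (GoLeft r)]; rewrite //= ?E // -E upd_id.
Qed.

Lemma runs_seq c1 c2 s N1 s1 N2 s2 :
  runs c1 s N1 s1 -> runs c2 s1 N2 s2 -> runs (Seq c1 c2) s (N1 + N2).+1 s2.
Proof.
move=> h1 h2 k; case: (h1 (c2 :: k)) => m1 le1 r1; case: (h2 k) => m2 le2 r2.
exists (m1 + m2).+1; first by rewrite ltnS leq_add.
exists ((None, [:: c1, c2 & k]), s); first by exists Nop.
exact: reach_cat r1 r2.
Qed.

Lemma runs_if r c0 c1 c2 s N s' :
  runs (match top s r with None => c0 | Some false => c1 | Some true => c2 end) s N s' ->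
  runs (If r c0 c1 c2) s N.+1 s'.
Proof.
move=> h k; case: (h k) => m le rc; exists m.+1 => //.
by eexists; last exact: rc; exists Nop.
Qed.

Lemma runs_while_end r (f : option bool -> bool) c s : ~~ f (top s r) -> runs (While r f c) s 1 s.
Proof.
move=> /negbTE h k; exists 1 => //; apply: reach1; exists Nop => //=.
by rewrite h.
Qed.

Lemma runs_while_step r (f : option bool -> bool) c s N1 s1 N2 s2 : f (top s r) -> runs c s N1 s1 ->
  runs (While r f c) s1 N2 s2 -> runs (While r f c) s (N1 + N2).+1 s2.
Proof.
move=> h h1 h2 k; case: (h1 (While r f c :: k)) => m1 le1 r1; case: (h2 k) => m2 le2 r2.
exists (m1 + m2).+1; first by rewrite ltnS leq_add.
exists ((None, [:: c, While r f c & k]), s); last exact: reach_cat r1 r2.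
by exists Nop => //=; rewrite h.
Qed.

(** The control of a program is the list of commands still to be run, taken from an infinite type.
    Only these lists, and [k] itself, occur in a run of [c] followed by [k], so that finitely many
    states suffice. *)
Fixpoint conts (c : cmd) (k : seq cmd) : seq (seq cmd) :=
  (c :: k) :: match c with
  | Seq c1 c2 => conts c1 (c2 :: k) ++ conts c2 k
  | If _ c0 c1 c2 => conts c0 k ++ conts c1 k ++ conts c2 k
  | While _ _ c1 => conts c1 (c :: k)
  | _ => [::]
  end.

Lemma conts_head (c : cmd) k : c :: k \in conts c k.
Proof. by case: c => *; rewrite in_cons eqxx. Qed.

Lemma conts_closed (c : cmd) k t p x o y : x \in conts c k ->
  (o, y) \in instr t (p, x) -> y.2 \in k :: conts c k.
Proof.
case: p => [[r b]|]; first by move=> xin; rewrite inE => /eqP[_ ->]; rewrite inE xin orbT.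
elim: c k x => [||r b|r|r|c1 IH1 c2 IH2|r c0 IH0 c1 IH1 c2 IH2|r f c IH] k x.
- by rewrite inE => /eqP -> /=; rewrite inE => /eqP[_ ->]; rewrite inE eqxx.
- by rewrite inE => /eqP -> /=.
- by rewrite inE => /eqP -> /=; rewrite inE => /eqP[_ ->]; rewrite inE eqxx.
- by rewrite inE => /eqP -> /=; rewrite inE => /eqP[_ ->]; rewrite inE eqxx.
- rewrite inE => /eqP -> /=; rewrite !inE => /or3P[]/eqP[_ ->] /=;
  by rewrite eqxx ?orbT.
- rewrite /= inE mem_cat => /or3P[/eqP->|/IH1 h|/IH2 h] /=.
  + by rewrite inE => /eqP[_ ->] /=; rewrite !inE mem_cat conts_head !orbT.
  + move/h; rewrite !inE mem_cat => /orP[/eqP->|->]; last by rewrite !orbT.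
    by rewrite conts_head !orbT.
  + by move/h; rewrite !inE mem_cat => /orP[->|->]; rewrite ?orbT.
- rewrite /= inE !mem_cat => /or4P[/eqP->|/IH0 h|/IH1 h|/IH2 h] /=.
  + rewrite inE => /eqP[_ ->] /=; rewrite !inE !mem_cat.
    by case: (t r) => [[]|]; rewrite conts_head !orbT.
  + by move/h; rewrite !inE !mem_cat => /orP[->|->]; rewrite ?orbT.
  + by move/h; rewrite !inE !mem_cat => /orP[->|->]; rewrite ?orbT.
  + by move/h; rewrite !inE !mem_cat => /orP[->|->]; rewrite ?orbT.
- rewrite /= inE => /orP[/eqP->|/IH h] /=.
  + rewrite inE => /eqP[_ ->] /=; case: ifP => _; rewrite !inE ?eqxx //.
    by rewrite conts_head !orbT.
  + by move/h; rewrite !inE => /orP[->|->]; rewrite ?orbT.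
Qed.

End Semantics.

(** * The clocked Turing machine of a stack program *)

Section Machine.
Variables (reg : finType) (inp : reg) (P : cmd reg).

Local Notation sym := (symbol void).
Arguments instr : simpl never.

Definition controls : seq (seq (cmd reg)) := [::] :: conts P [::].
Definition fin_control : finType := (option (reg * bool) * seq_sub controls)%type.

Definition ctl0 : seq_sub controls := SeqSub (mem_head [::] (conts P [::])).
Definition ctl (k : seq (cmd reg)) : seq_sub controls := insubd ctl0 k.

(* [inl false]: initial; [inl true]: loading the input onto stack [inp];
   [inr (ph, x)]: running, with the clock in phase [ph]. *)
Definition mstate : finType := (bool + bool * fin_control)%type.

Definition tp (r : reg) : 'I_#|reg|.+1 := lift ord0 (enum_rank r).
Definition mk_act (a0 : sym * move) (f : reg -> sym * move) :
    {ffun 'I_#|reg|.+1 -> sym * move} :=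
  [ffun i => if unlift ord0 i is Some j then f (enum_val j) else a0].

Lemma mk_act0 a0 f : mk_act a0 f ord0 = a0.
Proof. by rewrite ffunE unlift_none. Qed.

Lemma mk_actr a0 f r : mk_act a0 f (tp r) = f r.
Proof. by rewrite ffunE liftK enum_rankK. Qed.

Definition bit_of (x : sym) : option bool := if x is Some (inl b) then Some b else None.

Definition op_act (s : reg -> sym) (o : stack_op reg) (r : reg) : sym * move :=
  match o with
  | Nop => (s r, Stay)
  | GoRight r' => (s r, if r == r' then MoveRight else Stay)
  | GoLeft r' => (s r, if r == r' then MoveLeft else Stay)
  | Write r' b => (if r == r' then Some (inl b) else s r, Stay)
  end.

(* The clock traverses depth first the complete binary tree whose depth is the
   length of the input: in phase [false] it walks right marking cells [false];
   in phase [true] it walks back left until it can turn a [false] into [true]. *)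
Definition tick (ph : bool) (x : sym) : option (bool * (sym * move)) :=
  match ph, bit_of x with
  | false, None => Some (true, (None, MoveLeft))
  | false, Some _ => Some (false, (Some (inl false), MoveRight))
  | true, None => None
  | true, Some false => Some (false, (Some (inl true), MoveRight))
  | true, Some true => Some (true, (Some (inl true), MoveLeft))
  end.

(** The input tape becomes the clock. While the input is loaded, tape [ord0] is written and moved as
    in phase [false] of [tick], so loading is the first descent of the clock. *)
Definition mtrans (q : mstate) (s : {ffun 'I_#|reg|.+1 -> sym}) :
    {set mstate * {ffun 'I_#|reg|.+1 -> sym * move}} :=
  match q with
  | inl false => [set (inl true, mk_act (s ord0, Stay)
      (fun r => (s (tp r), if r == inp then MoveRight else Stay)))]
  | inl true =>
    match bit_of (s ord0) with
    | None => [set (inr (true, (None, ctl [:: P])), mk_act (None, MoveLeft)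
        (fun r => (s (tp r), if r == inp then MoveLeft else Stay)))]
    | Some b => [set (inl true, mk_act (Some (inl false), MoveRight)
        (fun r => if r == inp then (Some (inl b), MoveRight) else (s (tp r), Stay)))]
    end
  | inr (ph, (p, k)) =>
    if tick ph (s ord0) is Some (ph', a0) then
      [set y in [seq (inr (ph', (z.2.1, ctl z.2.2)),
                      mk_act a0 (op_act (fun r => s (tp r)) z.1))
                | z <- instr (fun r => bit_of (s (tp r))) (p, val k)]]
    else finset.set0
  end.

Definition machine : ntm :=
  @Ntm mstate void #|reg| (inl false)
    [set q : mstate | if q is inr (_, (None, k)) then val k == [::] else false] mtrans.

Definition mlang : language :=
  [set v | accepts (@step machine) (fun c => cstate c \in accept machine) (init machine v)]%classic.

Definition clock_of (c : config machine) : bool * tape void :=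
  (if cstate c is inr (ph, _) then ph else false, ctapes c ord0).

Definition ctick (x : bool * tape void) : option (bool * tape void) :=
  if tick x.1 (scan x.2) is Some (ph, a) then Some (ph, shift a.2 (write a.1 x.2)) else None.

Definition crun n x := iter n (obind ctick) (Some x).
Arguments crun : simpl never.

Lemma crunS n x : crun n.+1 x = if ctick x is Some y then crun n y else None.
Proof.
rewrite /crun iterSr /=; case: (ctick x) => //.
by elim: n => //= n ->.
Qed.

Lemma crunD m n x : crun (m + n) x = if crun m x is Some y then crun n y else None.
Proof.
elim: m x => [|m IH] x; first by [].
by rewrite addSn !crunS; case: (ctick x).
Qed.

Fixpoint ctime k := if k is k'.+1 then (ctime k').*2 + 3 else 1.

Lemma ctimeE k : ctime k + 3 = 4 * 2 ^ k.
Proof. by elim: k => //= k IH; rewrite expnS; lia. Qed.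

Definition bits (w : word) : seq sym := [seq Some (inl b) | b <- w].

(** Each cell accounts for two traversals of what lies beyond it and three moves: right with mark
    [false], right again with mark [true], and left at the end. Hence the recurrence of [ctime],
    with solution 4 * 2^k - 3; the base case is the turn at the first blank. *)
Lemma clock_down k w l e : size w = k -> head None e = None ->
  exists w' e', [/\ size w' = k, head None e' = None &
    crun (ctime k) (false, Tape l (bits w ++ e)) =
    Some (true, Tape (behead l) (head None l :: bits w' ++ e'))].
Proof.
elim: k w l e => [|k IH] [|b w] l e //=.
  move=> _ he; exists [::], (None :: behead e); split=> //.
  by rewrite crunS /ctick /= /scan /= he.
move=> [sw] he.
have [w1 [e1 [s1 h1 r1]]] := IH w (Some (inl false) :: l) e sw he.
have [w2 [e2 [s2 h2 r2]]] := IH w1 (Some (inl true) :: l) e1 s1 h1.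
exists (true :: w2), e2; rewrite /= s2; split => //.
have -> : (ctime k).*2 + 3 = (ctime k + (ctime k + 1).+1).+1 by lia.
by rewrite crunS /ctick /= crunD r1 crunS /ctick /= crunD r2.
Qed.

(** After the full traversal the clock scans the blank left of its tape in phase [true], where it is
    stuck. *)
Lemma crun_some k w e m : size w = k -> head None e = None ->
  isSome (crun m (false, Tape [::] (bits w ++ e))) = (m <= ctime k).
Proof.
move=> sw he; have [w' [e' [_ _ r]]] := clock_down [::] sw he.
case: leqP => h.
  by move: r; rewrite -(subnKC h) crunD; case: (crun m _).
by rewrite -(subnKC h) addSnnS crunD r crunS.
Qed.

Definition app_act (c : config machine)
    (a : state machine * {ffun 'I_(aux_tapes machine).+1 -> symbol (aux_symbol machine) * move}) :
    config machine :=
  Config a.1 [ffun i => shift (a.2 i).2 (write (a.2 i).1 (ctapes c i))].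

Lemma step1 (c c' : config machine) a :
  mtrans (cstate c) [ffun i => scan (ctapes c i)] = [set a] ->
  step c c' <-> c' = app_act c a.
Proof.
move=> h; split=> [[b]|->]; first by rewrite /= h inE => /eqP ->.
by exists a => //=; rewrite h inE.
Qed.

Lemma step_clock (c c' : config machine) : cstate c <> inl false -> step c c' ->
  ctick (clock_of c) = Some (clock_of c') /\ cstate c' <> inl false.
Proof.
case: c => q ts /= nq [a] /=; case: q nq => [[]//|[ph [p k]]] _ /=; rewrite ffunE.
  rewrite /ctick /clock_of /= /tick.
  by case: (bit_of _) => [b|]; rewrite inE => /eqP -> -> /=;
    rewrite ffunE mk_act0.
rewrite /ctick /clock_of /=.
case: tick => [[ph' a0]|]; last by rewrite inE.
by rewrite inE => /mapP[z _ ->] -> /=; rewrite ffunE mk_act0.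
Qed.

Lemma reach_clock m (c c' : config machine) : cstate c <> inl false ->
  reach (@step machine) m c c' -> crun m (clock_of c) = Some (clock_of c').
Proof.
elim: m c => [|m IH] c nq /=; first by move=> ->.
by move=> [d /(step_clock nq) [h1 h2] /(IH _ h2) h3]; rewrite crunS h1.
Qed.

Definition stk (w : word) : seq sym := bits w ++ [:: None].

(** The head of a stack scans its top, with the rest to the left and a blank at the bottom; the
    cells right of the head are arbitrary. Between the two halves of a push the head is one cell
    beyond the top. *)
Definition rep (x : control reg) (s : store reg) (ts : reg -> tape void) :=
  forall r, if omap fst x.1 == Some r then lhs (ts r) = stk (s r)
            else scan (ts r) :: lhs (ts r) = stk (s r).

Definition mrep (x : acfg reg) (c : config machine) : Prop :=
  [/\ exists ph, cstate c = inr (ph, (x.1.1, ctl x.1.2)), x.1.2 \in controls &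
      rep x.1 x.2 (fun r => ctapes c (tp r))].

Lemma ctlK k : k \in controls -> val (ctl k) = k.
Proof. by move=> h; rewrite val_insubd h. Qed.

Lemma controls_closed t p x o y : x \in controls ->
  (o, y) \in instr t (p, x) -> y.2 \in controls.
Proof.
rewrite inE => /orP[/eqP->|]; last exact: conts_closed.
by case: p => [[r b]|] //=; rewrite inE => /eqP[_ ->]; rewrite inE.
Qed.

Lemma top_stk x s ts : x.1 = None -> rep x s ts ->
  (fun r => bit_of (scan (ts r))) = top s.
Proof.
move=> hx hr; apply: funext => r; move: (hr r); rewrite hx /= /top /stk.
by case: (s r) => [|b w] [-> _].
Qed.

Lemma instr_top x s ts : rep x s ts ->
  instr (fun r => bit_of (scan (ts r))) x = instr (top s) x.
Proof.
by case: x => [[[r b]|] k] // hr; rewrite (top_stk _ hr).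
Qed.

Lemma rep_step x s ts o y : rep x s ts -> (o, y) \in instr (top s) x ->
  rep y (effect o s) (fun r =>
    let a := op_act (fun r => scan (ts r)) o r in shift a.2 (write a.1 (ts r))).
Proof.
case: x => [[[r b]|] k] hr; rewrite /instr.
  rewrite inE => /eqP[-> ->] /= r'; move: (hr r') => /=; rewrite /upd.
  have -> : (Some r == Some r') = (r == r') by [].
  rewrite (eq_sym r'); case: eqP => [<-|_] /= h; last exact: h.
  by rewrite /scan /= h.
have stay o' : (forall r', op_act (fun r => scan (ts r)) o' r' = (scan (ts r'), Stay)) ->
    effect o' s = s -> forall k', rep (None, k') (effect o' s) (fun r' =>
    let a := op_act (fun r => scan (ts r)) o' r' in shift a.2 (write a.1 (ts r'))).
  by move=> h1 h2 k' r; rewrite h1 h2 /=; apply: (hr r).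
have right r b k' : rep (Some (r, b), k') s (fun r' =>
    let a := op_act (fun r => scan (ts r)) (GoRight r) r' in shift a.2 (write a.1 (ts r'))).
  move=> r' /=; have -> : (Some r == Some r') = (r == r') by [].
  by rewrite (eq_sym r'); move: (hr r') => /= h; case: eqP => _ /=; rewrite -h.
case: k hr stay right => [|c k] hr stay right //; case: c hr stay right
  => [||r b|r|r|c1 c2|r c0 c1 c2|r f c] hr stay right //.
- by rewrite inE => /eqP[-> ->]; apply: (stay Nop).
- by rewrite inE => /eqP[-> ->]; apply: right.
- rewrite inE => /eqP[-> ->]; move: (hr r); rewrite /top /=.
  case E: (s r) => [|b w] /= h; first exact: (stay Nop).
  move=> r' /=; move: (hr r') => /=; rewrite /upd; case: eqP => [->|_] //=.
  rewrite E /stk => -[_ hl].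
  by case: (lhs (ts r)) hl => [|a l]; [case: (w)|].
- by rewrite !inE => /or3P[]/eqP[-> ->]; by [apply: (stay Nop)|apply: right].
- by rewrite inE => /eqP[-> ->]; apply: (stay Nop).
- by rewrite inE => /eqP[-> ->]; apply: (stay Nop).
- by rewrite inE => /eqP[-> ->]; apply: (stay Nop).
Qed.

Lemma mrep_sound x c c' : mrep x c -> step c c' -> exists2 y, astep x y & mrep y c'.
Proof.
case: x => x s; case: c => q ts [[ph /= ->] hx hr] [a] /=.
case: tick => [[ph' a0]|]; last by rewrite inE.
rewrite [X in instr X](_ : _ = (fun r => bit_of (scan (ts (tp r)))));
  last by apply: funext => r; rewrite ffunE.
rewrite ctlK // -surjective_pairing (instr_top hr) inE => /mapP[[o y] hz ->] -> /=.
exists (y, effect o s); first by exists o.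
split => /=; first by exists ph'.
  by rewrite (surjective_pairing x) in hz; apply: controls_closed hx hz.
move=> r; move: (rep_step hr hz r); rewrite /= ffunE mk_actr.
suff -> : (fun r => [ffun i => scan (ctapes (Config (inr (ph, (x.1, ctl x.2)) : state machine) ts) i)]
    (tp r)) = (fun r => scan (ts (tp r))) by [].
by apply: funext => r'; rewrite ffunE.
Qed.

Lemma mrep_reach m x c d : mrep x c -> reach (@step machine) m c d ->
  exists2 y, reach (@astep reg) m x y & mrep y d.
Proof.
elim: m c x => [|m IH] c x hm /=; first by move=> <-; exists x.
move=> [e /(mrep_sound hm) [y sy my] /(IH _ _ my) [z rz mz]].
by exists z => //; exists y.
Qed.

(** Only the clock can stop the machine before the program stops. *)
Lemma mrep_complete x y c : mrep x c -> astep x y -> ctick (clock_of c) <> None ->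
  exists2 c', step c c' & mrep y c'.
Proof.
case: x y => x s [y s']; case: c => q ts [[ph /= ->] hx hr] [o /= hz ->].
rewrite /ctick /clock_of /=; case E: (tick _ _) => [[ph' a0]|] // _.
set a := (inr (ph', (y.1, ctl y.2)), mk_act a0 (op_act (fun r => scan (ts (tp r))) o)) : mstate * _.
exists (app_act (@Config machine (inr (ph, (x.1, ctl x.2))) ts) a).
  exists a => //=; rewrite ffunE E inE; apply/mapP; exists (o, y) => /=.
    rewrite [X in instr X](_ : _ = (fun r => bit_of (scan (ts (tp r)))));
      last by apply: funext => r; rewrite ffunE.
    by rewrite ctlK // -surjective_pairing (instr_top hr).
  by congr (_, mk_act _ (op_act _ _)); apply: funext => r'; rewrite ffunE.
split => /=; first by exists ph'.
  by rewrite (surjective_pairing x) in hz; apply: controls_closed hx hz.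
by move=> r; move: (rep_step hr hz r); rewrite /= ffunE mk_actr.
Qed.

(** [u] is on stack [inp] and [w] is still to be read. The head of [inp] is one cell beyond the top,
    ready to write; the other stacks are empty. *)
Definition loading (u w : word) (c : config machine) : Prop :=
  [/\ cstate c = inl true,
      exists e, head None e = None /\ rhs (ctapes c ord0) = bits w ++ e,
      lhs (ctapes c (tp inp)) = stk (rev u) &
      forall r, r != inp -> scan (ctapes c (tp r)) :: lhs (ctapes c (tp r)) = [:: None]].

Definition store0 (v : word) : store reg := upd (fun=> [::]) inp (rev v).

Lemma load_step u b w c : loading u (b :: w) c ->
  exists c1, (forall c', step c c' <-> c' = c1) /\ loading (rcons u b) w c1.
Proof.
case: c => q ts [/= -> [e [he h0]] h1 h2].
eexists; split.
  by move=> c'; apply: step1; rewrite /= ffunE /scan h0 /=; reflexivity.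
split => //=.
- by exists e; rewrite ffunE mk_act0 /= h0.
- by rewrite ffunE mk_actr eqxx /= h1 rev_rcons.
- by move=> r nr; rewrite ffunE mk_actr (negbTE nr) /= ffunE; apply: h2.
Qed.

Lemma load_last u c : loading u [::] c ->
  exists c1, (forall c', step c c' <-> c' = c1) /\ mrep ((None, [:: P]), store0 u) c1.
Proof.
case: c => q ts [/= -> [e [he h0]] h1 h2].
eexists; split.
  by move=> c'; apply: step1; rewrite /= ffunE /scan h0 /= he /=; reflexivity.
split => /=; first by exists true.
  by rewrite inE conts_head orbT.
move=> r /=; rewrite ffunE mk_actr /store0 /upd ffunE; case: eqP => [->|/eqP nr] /=.
  by rewrite h1 /scan /= /stk; case: (rev u).
exact: h2.
Qed.

(** Loading is deterministic and no loading state accepts, so every accepting run goes through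
    [c1]. *)
Lemma load_run w u c : loading u w c -> exists c1,
  [/\ reach (@step machine) (size w).+1 c c1,
      mrep ((None, [:: P]), store0 (u ++ w)) c1 &
      forall m d, reach (@step machine) m c d -> d \notin [pred d | cstate d \in accept machine] \/
        exists m', reach (@step machine) m' c1 d].
Proof.
elim: w u c => [|b w IH] u c hl.
  have [c1 [h1 h2]] := load_last hl; exists c1; split.
  - by exists c1 => //; apply/h1.
  - by rewrite cats0.
  - case=> [|m] d /=; first by move=> <-; left; rewrite inE; case: hl => ->; rewrite inE.
    by move=> [e /h1 -> hr]; right; exists m.
have [c1 [h1 h2]] := load_step hl; have [c2 [h3 h4 h5]] := IH _ _ h2.
exists c2; split.
- by exists c1 => //; apply/h1.
- by rewrite cat_rcons in h4.
- case=> [|m] d /=; first by move=> <-; left; rewrite inE; case: hl => ->; rewrite inE.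
  by move=> [e /h1 -> /h5].
Qed.

Lemma init_step v : exists c1, [/\ (forall c', step (init machine v) c' <-> c' = c1),
   loading [::] v c1 & exists e, head None e = None /\ clock_of c1 = (false, Tape [::] (bits v ++ e))].
Proof.
eexists; split.
- by move=> c'; apply: step1; rewrite /=; reflexivity.
- split => //=.
  + rewrite ffunE mk_act0 /= !ffunE /=.
    by case: v => [|b v]; [exists [:: None]|exists [::]; rewrite cats0].
  + by rewrite ffunE mk_actr !ffunE eqxx /= /scan.
  + by move=> r nr; rewrite ffunE mk_actr !ffunE (negbTE nr) /= /scan.
- rewrite /clock_of /= ffunE mk_act0 /= !ffunE /=.
  by case: v => [|b v]; [exists [:: None]|exists [::]; rewrite cats0].
Qed.

(* The clock alone stops every run, whatever the stack program does. *)
Lemma mlang_halts v : halts_within (@step machine) (4 * 2 ^ size v + 4) (init machine v).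
Proof.
have [c1 [h1 hl [e [he hc]]]] := init_step v.
case=> [|m] d /=; first by lia.
move=> [c /h1 -> hr]; have := reach_clock _ hr.
have nq : cstate c1 <> inl false by case: hl => ->.
move/(_ nq); rewrite hc => E.
have := crun_some m (erefl (size v)) he; rewrite E /= => /esym.
by have := ctimeE (size v); lia.
Qed.

Lemma mlang_NEXP : NEXP mlang.
Proof.
exists 1 => //; exists machine, 4 => v; split=> //.
by rewrite expn1; apply: mlang_halts.
Qed.

Lemma mlang_sound v : mlang v -> exists m s',
  reach (@astep reg) m ((None, [:: P]), store0 v) ((None, [::]), s').
Proof.
move=> [m [d [hr hh ha]]]; have [c1 [h1 hl _]] := init_step v.
case: m hr => [|m] /=; first by move=> e; rewrite -e inE in ha.
move=> [c /h1 -> hr].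
have [c2 [_ hm h5]] := load_run hl; case: (h5 _ _ hr) => [|[m' hr']].
  by rewrite inE ha.
have [x rx mx] := mrep_reach hm hr'.
case: x rx mx => [[p k] s'] rx [[ph eq] /= kin _]; exists m', s'.
move: ha; rewrite inE eq /=; case: p rx {eq} => // rx.
by rewrite -[ssval _]/(val _) ctlK // => /eqP ek; rewrite ek in rx.
Qed.

Lemma mlang_complete v m s' : m < 2 ^ size v ->
  reach (@astep reg) m ((None, [:: P]), store0 v) ((None, [::]), s') -> mlang v.
Proof.
move=> le hr; have [c1 [h1 hl [e [he hc]]]] := init_step v.
have nq : cstate c1 <> inl false by case: hl => ->.
have [c2 [r2 hm _]] := load_run hl.
(* With n the length of [v], loading takes n + 1 <= 2^n steps and the program fewer than 2^n, while
   the clock allows 4 * 2^n - 3. *)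
have le' : (size v).+1 + m <= ctime (size v).
  have := ctimeE (size v); have := ltn_expl (size v) (isT : 1 < 2); lia.
have [d rd md] : exists2 d, reach (@step machine) ((size v).+1 + m) c1 d &
    mrep ((None, [::]), s') d.
  move: ((None, [:: P]), store0 v) hm hr r2 le' => x hm hr r2 {le}.
  elim: m (size v).+1 c2 x hm hr r2 => [|m IH] j c2 x hm /=.
    by move=> hx rc _; exists c2; rewrite ?addn0 -?hx.
  move=> [y xy ry] rc le.
  have [|c3 sc3 m3] := mrep_complete hm xy.
    move=> hn; have E : crun j.+1 (clock_of c1) = None.
      by rewrite -addn1 crunD (reach_clock nq rc) crunS hn.
    have := crun_some j.+1 (erefl (size v)) he; rewrite -hc E /=; lia.
  have [||d rd md] := IH j.+1 c3 y m3 ry; last by exists d; rewrite // -addSnnS.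
    by rewrite -addn1; apply: reach_cat rc (reach1 sc3).
  by lia.
exists ((size v).+1 + m).+1, d; split.
- by exists c1 => //; apply/h1.
- by move=> d' /(mrep_sound md) [y [o]].
- by case: md => [[ph ->] kin _]; rewrite inE /= -[ssval _]/(val _) ctlK.
Qed.

End Machine.

(** * Computation paths and encodings of machines *)

Inductive tree := Leaf | Node of tree & tree.

(** Preorder with one bit per node. The code is self-delimiting, so trees can follow one another on
    a stack without separators. *)
Fixpoint code (t : tree) : word :=
  if t is Node a b then true :: code a ++ code b else [:: false].

Section Paths.
Variables (M : ntm) (isq : pred (state M)) (qy qn : state M) (orac : word -> bool).

Definition action := (state M * {ffun 'I_(aux_tapes M).+1 -> symbol (aux_symbol M) * move})%type.

Definition scans (c : config M) : {ffun 'I_(aux_tapes M).+1 -> symbol (aux_symbol M)} :=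
  [ffun i => scan (ctapes c i)].
Definition acts (c : config M) : seq action := enum (trans (cstate c) (scans c)).
Definition act_on (c : config M) (a : action) : config M :=
  Config a.1 [ffun i => shift (a.2 i).2 (write (a.2 i).1 (ctapes c i))].
Definition answer (c : config M) : config M :=
  Config (if orac (last_word c) then qy else qn) (ctapes c).

(** A common form for the oracle machine and, with [isq] constantly false, for the ordinary machine
    [N]; the oracle is a boolean function, so that one oracle can be exchanged for another. *)
Definition qstep (c c' : config M) : Prop :=
  if isq (cstate c) then c' = answer c else step c c'.

Lemma stepP (c c' : config M) : step c c' <-> exists2 a, a \in acts c & c' = act_on c a.
Proof. by split=> -[a h ->]; exists a; rewrite // ?mem_enum // -mem_enum. Qed.

(* A path is a bit string: at each step the successive actions are refused by
   [true] until one is taken by [false]. *)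
Inductive choice := Taken of action & word | Refused of word | Exhausted.
Fixpoint choose_act (l : seq action) (p : word) : choice :=
  match l, p with
  | [::], _ => Refused p
  | _ :: _, [::] => Exhausted
  | a :: _, false :: p' => Taken a p'
  | _ :: l', true :: p' => choose_act l' p'
  end.

(* [Some b]: the run along the path ended with verdict [b], leaving the returned
   bits unread; [None]: the path is too short.  Running out of fuel [n] is not
   reported and never happens when [n] exceeds the running time. *)
Fixpoint follow (n : nat) (c : config M) (p : word) : option bool * word :=
  if n is n'.+1 then
    if isq (cstate c) then follow n' (answer c) p else
    match choose_act (acts c) p with
    | Taken a p' => follow n' (act_on c a) p'
    | Refused p' => (Some ((cstate c \in accept M) && nilp (acts c)), p')
    | Exhausted => (None, [::])
    end
  else (None, p).

Lemma halts_next n c c' : halts_within qstep n.+1 c -> qstep c c' -> halts_within qstep n c'.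
Proof. by move=> h st m d r; rewrite -ltnS; apply: (h m.+1 d); exists c'. Qed.

Lemma halts0 c : halts_within qstep 0 c -> isq (cstate c) = false /\ acts c = [::].
Proof.
move=> h; have no d : ~ qstep c d by move=> st; have := h 1 d (reach1 st).
case: (boolP (isq (cstate c))) => hq; first by case: (no (answer c)); rewrite /qstep hq.
split=> //; case E: (acts c) => [|a l] //; case: (no (act_on c a)).
by rewrite /qstep (negbTE hq); apply/stepP; exists a; rewrite // E inE eqxx.
Qed.

Lemma choose_taken l p a p' : choose_act l p = Taken a p' -> a \in l.
Proof.
elim: l p => [|b l IH] [|[] p] //=; last by case=> ->; rewrite inE eqxx.
by move/IH; rewrite inE orbC => ->.
Qed.

Lemma choose_nil p : choose_act [::] p = Refused p.
Proof. by case: p. Qed.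

Lemma choose_cat l p u : choose_act l p <> Exhausted ->
  choose_act l (p ++ u) = match choose_act l p with
    | Taken a p' => Taken a (p' ++ u) | Refused p' => Refused (p' ++ u) | Exhausted => Exhausted end.
Proof. by elim: l p => [|b l IH] [|[] p] //= /IH. Qed.

Lemma choose_mem l a : a \in l -> exists p, size p <= size l /\
  forall u, choose_act l (p ++ u) = Taken a u.
Proof.
elim: l => //= b l IH; rewrite inE => /orP[/eqP ->|/IH [p [le h]]].
  by exists [:: false].
by exists (true :: p).
Qed.

Lemma choose_exhausted l p : choose_act l p = Exhausted -> size p <= size l.
Proof. by elim: l p => [|b l IH] [|[] p] //= /IH. Qed.

Lemma choose_taken_size l p a p' : choose_act l p = Taken a p' -> size p <= size l + size p'.
Proof.
elim: l p => [|b l IH] [|[] p] //=; last by case=> _ ->; rewrite addnC addnS ltnS leq_addr.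
by move/IH; rewrite addSn ltnS.
Qed.

Definition verdict (d : config M) : bool := cstate d \in accept M.

(** A verdict thus depends on a prefix of the path only. This prunes the depth-first search and
    makes decided paths the leaves of the induction on [w]. *)
Lemma follow_cat n c p u b p' : follow n c p = (Some b, p') ->
  follow n c (p ++ u) = (Some b, p' ++ u).
Proof.
elim: n c p => [|n IH] c p //=; case: ifP => _; first exact: IH.
case E: (choose_act (acts c) p) => [a q|q|] //; rewrite choose_cat E //.
  exact: IH.
by case=> -> ->.
Qed.

Lemma follow_size n c p : size (follow n c p).2 <= size p.
Proof.
elim: n c p => //= n IH c p; case: ifP => _; first exact: IH.
have sz : forall l : seq action, match choose_act l p with
    Taken _ p' => size p' <= size p | Refused p' => size p' <= size p | Exhausted => true end.
  elim: (p) => [|b q IHq] [|a l] //=; case: b => //.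
  by have := IHq l; case: (choose_act l q) => *; lia.
have := sz (acts c); case: (choose_act _ _) => //= a q; exact: leq_trans (IH _ _).
Qed.

(** The verdict [true] asks that the configuration where all actions are refused have none, so the
    run has really halted. Fuel [n.+1] pays for [n] steps and for noticing the halt. *)
Lemma follow_sound n c p p' : halts_within qstep n c ->
  follow n.+1 c p = (Some true, p') -> accepts qstep verdict c.
Proof.
move: {2}n.+1 (leqnn n.+1) => k; elim: k n c p => // k IH n c p le hh.
rewrite /=; case: ifP => hq.
  case: n le hh => [|n] le hh; first by case: (halts0 hh); rewrite hq.
  have st : qstep c (answer c) by rewrite /qstep hq.
  move=> hf; case: (IH n _ _ _ (halts_next hh st) hf) => // m [d [r1 r2 r3]].
  by exists m.+1, d; split=> //; exists (answer c).
case E: (choose_act _ _) => [a q|q|] //.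
  have st : qstep c (act_on c a).
    by rewrite /qstep hq; apply/stepP; exists a => //; apply: choose_taken E.
  case: n le hh => [|n] le hh.
    by have [_ e] := halts0 hh; rewrite e choose_nil in E.
  move=> hf; case: (IH n _ _ _ (halts_next hh st) hf) => // m [d [r1 r2 r3]].
  by exists m.+1, d; split=> //; exists (act_on c a).
case=> /andP[ha /nilP hn] _; exists 0, c; split=> // d.
by rewrite /qstep hq => /stepP[a]; rewrite hn.
Qed.

(** Choosing among at most [A] actions costs at most [A] bits. The continuation [u] is left unread,
    so two accepting paths can be guessed as one string. *)
Lemma follow_complete n A c : halts_within qstep n c ->
  (forall q s, #|trans (n:=M) q s| <= A) -> accepts qstep verdict c ->
  exists p, size p <= n.+1 * A /\ forall u, follow n.+1 c (p ++ u) = (Some true, u).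
Proof.
move=> hh hA [m [d [hr hd hv]]]; elim: m n c hr hh => [|m IH] n c /=.
  move=> e _; exists [::]; split=> // u; rewrite -e in hd hv.
  case: ifP => hq; first by case: (hd (answer c)); rewrite /qstep hq.
  case E: (acts c) => [|a l]; first by rewrite choose_nil -/(verdict c) hv.
  by case: (hd (act_on c a)); rewrite /qstep hq; apply/stepP; exists a; rewrite // E inE eqxx.
move=> [c' st hr]; case: n => [|n] hh.
  by have := hh 1 c' (reach1 st).
have [p [le hp]] := IH n c' hr (halts_next hh st).
move: st; rewrite /qstep; case: ifP => hq st.
  by exists p; split; [rewrite mulSn; lia|rewrite -st].
have {st} [a ain ec] := (stepP _ _).1 st.
have [q [szq hq']] := choose_mem ain; exists (q ++ p); split.
  have := hA (cstate c) (scans c); rewrite cardE -/(acts c) size_cat mulSn => h; exact: leq_add (leq_trans szq h) le.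
by move=> u; rewrite -catA hq' -ec; apply: hp.
Qed.

(** This bounds both the depth of the search tree of [N] and the length of the paths [w] in the
    downward induction. *)
Lemma follow_exhausted n A c p p' : halts_within qstep n c ->
  (forall q s, #|trans (n:=M) q s| <= A) ->
  follow n.+1 c p = (None, p') -> size p <= n.+1 * A.
Proof.
move=> hh hA; move: {2}n.+1 (leqnn n.+1) => k; elim: k n c p hh => // k IH n c p hh le.
rewrite /=; case: ifP => hq.
  case: n hh le => [|n] hh le; first by case: (halts0 hh); rewrite hq.
  have st : qstep c (answer c) by rewrite /qstep hq.
  by move=> hf; have := IH n _ _ (halts_next hh st) le hf; rewrite [n.+2 * _]mulSn; lia.
case E: (choose_act _ _) => [a q|q|] //.
  have st : qstep c (act_on c a).
    by rewrite /qstep hq; apply/stepP; exists a => //; apply: choose_taken E.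
  case: n hh le => [|n] hh le.
    by have [_ e] := halts0 hh; rewrite e choose_nil in E.
  move=> hf; have h1 := IH n _ _ (halts_next hh st) le hf.
  have h2 := hA (cstate c) (scans c); rewrite cardE -/(acts c) in h2.
  apply: leq_trans (choose_taken_size E) _; rewrite mulSn; exact: leq_add h2 h1.
move=> _; apply: leq_trans (choose_exhausted E) _.
have h2 := hA (cstate c) (scans c); rewrite cardE -/(acts c) in h2.
by apply: leq_trans h2 _; rewrite mulSn leq_addr.
Qed.

End Paths.

(** * Trees encoding machines and tapes *)

Fixpoint num (n : nat) : tree := if n is n'.+1 then Node Leaf (num n') else Leaf.
Fixpoint lst (l : seq tree) : tree := if l is a :: l' then Node a (lst l') else Leaf.

Lemma size_num n : size (code (num n)) = n.*2.+1.
Proof. by elim: n => //= n ->; rewrite doubleS. Qed.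

Lemma size_lst l : size (code (lst l)) = (sumn [seq (size (code t)).+1 | t <- l]).+1.
Proof. by elim: l => //= a l; rewrite size_cat => ->; lia. Qed.

Section Encoding.
Variable X : finType.

(** Blank, [false] and [true] have the indices 0, 1, 2 in every alphabet, so the simulator can write
    inputs and read queries without knowing the alphabet. *)
Definition sym_idx (x : symbol X) : nat :=
  match x with
  | None => 0
  | Some (inl b) => (b : nat).+1
  | Some (inr y) => (index y (enum X)).+3
  end.
Definition idx_sym (n : nat) : symbol X :=
  match n with
  | 0 => None
  | 1 => Some (inl false)
  | 2 => Some (inl true)
  | n'.+3 => omap inr (ohead (drop n' (enum X)))
  end.
Definition num_syms : nat := #|X| + 3.

Lemma sym_idxK : cancel sym_idx idx_sym.
Proof.
case=> [[[]|y]|] //=.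
rewrite (drop_nth y) ?nth_index ?mem_enum //=.
by rewrite index_mem mem_enum.
Qed.

Lemma sym_idx_lt x : sym_idx x < num_syms.
Proof.
case: x => [[[]|y]|]; rewrite /num_syms addn3 //=.
by rewrite !ltnS cardE index_mem mem_enum.
Qed.

Definition sym_tree x := num (sym_idx x).
Definition cells (l : seq (symbol X)) : tree := lst [seq sym_tree x | x <- l].

Lemma size_cells l : size (code (cells l)) <= (size l) * (2 * num_syms) + 1.
Proof.
rewrite size_lst -map_comp addn1 ltnS.
elim: l => //= x l IH; rewrite mulSn size_num; have := sym_idx_lt x; lia.
Qed.

Definition move_idx (d : move) : nat :=
  match d with Stay => 0 | MoveLeft => 1 | MoveRight => 2 end.

Definition tape_code (t : tape X) : word := code (cells (lhs t)) ++ code (cells (rhs t)).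

(** Each tape is announced by [true]. The closing [false] is added by the users, so that appending
    lists of tapes is appending their codes. *)
Definition tapes_code (ts : seq (tape X)) : word :=
  flatten [seq true :: tape_code t | t <- ts].

End Encoding.

(** A table indexed by the tuple of scanned symbols, one list level per tape: looking up a
    transition is a descent. *)
Fixpoint trie (ns j : nat) (f : seq nat -> tree) : tree :=
  if j is j'.+1 then lst [seq trie ns j' (fun l => f (x :: l)) | x <- iota 0 ns] else f [::].

Section MachineCode.
Variables (M : ntm) (isq : pred (state M)) (qy qn : state M).

Local Notation K := (aux_tapes M).+1.
Local Notation sym := (symbol (aux_symbol M)).

Definition st_idx (q : state M) : nat := index q (enum (state M)).

Definition action_tree (a : action M) : tree :=
  Node (num (st_idx a.1))
    (lst [seq Node (sym_tree (a.2 i).1) (num (move_idx (a.2 i).2)) | i <- enum 'I_K]).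

Definition acts_tree (q : state M) (l : seq nat) : tree :=
  lst [seq action_tree a | a <- enum (trans q [ffun i : 'I_K => idx_sym (aux_symbol M) (nth 0 l i)])].

(** The first component is [num] of 0 for a query state, of 1 for a rejecting and of 2 for an
    accepting one. *)
Definition state_tree (q : state M) : tree :=
  if isq q then Node Leaf (Node (num (st_idx qy)) (num (st_idx qn)))
  else Node (num (q \in accept M).+1) (trie (num_syms (aux_symbol M)) K (acts_tree q)).

Definition table_tree : tree := lst [seq state_tree q | q <- enum (state M)].

Definition tapes (c : config M) : seq (tape (aux_symbol M)) := [seq ctapes c i | i <- enum 'I_K].

Lemma acts_treeE (c : config M) :
  acts_tree (cstate c) [seq sym_idx (scan t) | t <- tapes c] = lst [seq action_tree a | a <- acts c].
Proof.
rewrite /acts_tree /acts; congr lst; congr map; congr (enum (pred_of_set (trans _ _))).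
apply/ffunP => i; rewrite !ffunE -map_comp (nth_map i) ?size_enum_ord //=.
by rewrite nth_ord_enum sym_idxK.
Qed.

Lemma nth_state q : nth Leaf [seq state_tree q | q <- enum (state M)] (st_idx q) = state_tree q.
Proof.
by rewrite (nth_map q) ?nth_index ?index_mem ?mem_enum.
Qed.

Lemma tapes_init w : tapes (init M w) =
  input_tape (aux_symbol M) w :: nseq (aux_tapes M) (blank_tape (aux_symbol M)).
Proof.
rewrite /tapes enum_ordSl /= ffunE eqxx; congr cons.
rewrite -map_comp; apply: (@eq_from_nth _ (blank_tape _)).
  by rewrite size_map size_nseq size_enum_ord.
move=> i; rewrite size_map size_enum_ord => hi.
by rewrite (nth_map (Ordinal hi)) ?size_enum_ord //= ffunE /= nth_nseq hi.
Qed.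

End MachineCode.

(** * The simulation program *)

(* The registers taking a boolean exist in two copies, [true] for the oracle
   machine [M] and [false] for the machine [N] that the oracle answers are
   computed from.  [rT]: tapes, last one first; [rW]: part of the transition table
   being searched; [rP]: path still to be followed; [rC]: nonempty while the
   simulation runs; [rTab], [rS0], [rKN]: transition table, start state and number
   of auxiliary tapes; [rS]: current state; [rXI]: input of the simulation;
   [rRes]: its verdict; [rQ], [rZC], [rXQ]: query, its trailing zeros, and the word
   that was padded; [rGT]: table of pad sizes; [rYP], [rDF]: path and activity flag
   of the depth-first search; [rAns]: oracle answer; [rIn], [rE], [rV], [rG]: input,
   its advice and path parts, guessed path; [rAcc]: nonempty to accept.  The others
   are scratch stacks, empty between uses. *)
Inductive reg :=
| rT of bool | rW of bool | rP of bool | rC of bool | rTab of bool | rS0 of bool | rKN of bool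
| rZ | rD | rX | rL | rR | rK | rF | rA | rH | rT2 | rS | rRes
| rQ | rZC | rY | rB | rU | rU2 | rMM | rXQ | rYP | rDF | rAns | rXI
| rIn | rV | rE | rG | rGT | rAcc.

Definition reg_tag (r : reg) : nat :=
  match r with
  | rT _ => 0 | rW _ => 1 | rP _ => 2 | rC _ => 3 | rTab _ => 4 | rS0 _ => 5 | rKN _ => 6
  | rZ => 7 | rD => 8 | rX => 9 | rL => 10 | rR => 11 | rK => 12 | rF => 13
  | rA => 14 | rH => 15 | rT2 => 16 | rS => 17 | rRes => 18
  | rQ => 19 | rZC => 20 | rY => 21 | rB => 22 | rU => 23 | rU2 => 24 | rMM => 25
  | rXQ => 26 | rYP => 27 | rDF => 28 | rAns => 29 | rXI => 30
  | rIn => 31 | rV => 32 | rE => 33 | rG => 34 | rGT => 35 | rAcc => 36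
  end.
Definition reg_arg (r : reg) : bool :=
  match r with
  | rT m | rW m | rP m | rC m | rTab m | rS0 m | rKN m => m
  | _ => false
  end.
(* Structural, so that comparisons of named registers reduce. *)
Definition reg_eqb (r1 r2 : reg) := eqn (reg_tag r1) (reg_tag r2) && (reg_arg r1 == reg_arg r2).

Definition tag_reg (x : nat * bool) : reg :=
  if x.1 < 7 then nth rT [:: rT; rW; rP; rC; rTab; rS0; rKN] x.1 x.2
  else nth rZ [:: rZ; rD; rX; rL; rR; rK; rF; rA; rH; rT2; rS; rRes;
      rQ; rZC; rY; rB; rU; rU2; rMM; rXQ; rYP; rDF; rAns; rXI;
      rIn; rV; rE; rG; rGT; rAcc] (x.1 - 7).

Lemma tag_regK : cancel (fun r => (reg_tag r, reg_arg r)) tag_reg.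
Proof. by case. Qed.

Definition regs : seq reg :=
  [seq tag_reg x | x <- [seq (i, b) | i <- iota 0 7, b <- [:: false; true]] ++
                        [seq (i, false) | i <- iota 7 30]].

Lemma reg_eqP : Equality.axiom reg_eqb.
Proof.
move=> r1 r2; apply: (iffP andP) => [[/eqnP h1 /eqP h2]|->]; last by rewrite eqxx; split=> //; apply/eqnP.
by rewrite -[r1]tag_regK h1 h2 tag_regK.
Qed.

HB.instance Definition _ := hasDecEq.Build reg reg_eqP.
HB.instance Definition _ := CanIsCountable tag_regK.
Lemma regs_axiom : Finite.axiom regs.
Proof. by case=> // -[]. Qed.
HB.instance Definition _ := isFinite.Build reg regs_axiom.

Notation "c1 ;; c2" := (Seq c1 c2) (at level 61, right associativity).
Notation command := (cmd reg).

(** * Basic operations on stacks and encoded trees *)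

Section Macros.
Implicit Types (s : store reg) (r x y : reg) (w : word) (c : command).

Lemma upd_eq (s : store reg) r w : upd s r w r = w.
Proof. by rewrite /upd eqxx. Qed.

Lemma upd_ne (s : store reg) r w r' : r' != r -> upd s r w r' = s r'.
Proof. by rewrite /upd => /negbTE ->. Qed.

Lemma upd_upd (s : store reg) r w w' : upd (upd s r w) r w' = upd s r w'.
Proof. by apply: funext => r'; rewrite /upd; case: eqP. Qed.

Lemma runs_conv (c : cmd reg) s N N' s1 s2 :
  runs c s N s1 -> s1 = s2 -> N <= N' -> runs c s N' s2.
Proof. by move=> h <-; apply: runs_le. Qed.

Lemma runs_start (c : cmd reg) s s0 N s' : s = s0 -> runs c s0 N s' -> runs c s N s'.
Proof. by move=> ->. Qed.

Definition top_some (o : option bool) : bool := o.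

Lemma runs_pop_cons r b w s : s r = b :: w -> runs (Pop r) s 1 (upd s r w).
Proof. by move=> e; apply: runs_conv (runs_pop _ _) _ _; rewrite ?e. Qed.

Lemma runs_if_cons r c0 c1 c2 s b w N s' : s r = b :: w ->
  runs (if b then c2 else c1) s N s' -> runs (If r c0 c1 c2) s N.+1 s'.
Proof. by move=> e h; apply: runs_if; rewrite /top e; case: b h {e}. Qed.

Lemma runs_if_nil r c0 c1 c2 s N s' : s r = [::] ->
  runs c0 s N s' -> runs (If r c0 c1 c2) s N.+1 s'.
Proof. by move=> e h; apply: runs_if; rewrite /top e. Qed.

Definition Foreach (x : reg) (c0 c1 : command) : command :=
  While x top_some (If x Skip (Pop x ;; c0) (Pop x ;; c1)).

Lemma runs_foreach_nil x c0 c1 s : s x = [::] -> runs (Foreach x c0 c1) s 1 s.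
Proof. by move=> e; apply: runs_while_end; rewrite /top e. Qed.

Lemma runs_foreach_cons x c0 c1 s b w N1 s1 N2 s2 : s x = b :: w ->
  runs (if b then c1 else c0) (upd s x w) N1 s1 ->
  runs (Foreach x c0 c1) s1 N2 s2 -> runs (Foreach x c0 c1) s (N1 + N2 + 4) s2.
Proof.
move=> e h1 h2; have h : runs (If x Skip (Pop x ;; c0) (Pop x ;; c1)) s N1.+3 s1.
  apply: (runs_if_cons _ e); case: b e h1 => e h1;
  by apply: runs_conv (runs_seq (runs_pop_cons e) h1) _ _.
by apply: runs_conv (runs_while_step _ h h2) _ _; rewrite /top ?e //=; lia.
Qed.

Definition pour1 (x y : reg) : command := Foreach x (Push y false) (Push y true).

Lemma runs_pour1 x y s : x != y ->
  runs (pour1 x y) s (10 * size (s x) + 1) (upd (upd s y (rev (s x) ++ s y)) x [::]).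
Proof.
move=> ne; move e: (s x) => z; elim: z s e => [|b z IH] s e.
  by apply: runs_conv (runs_foreach_nil _ _ e) _ _; rewrite //= upd_id -e upd_id.
have h : runs (if b then Push y true else Push y false) (upd s x z) 2
    (upd (upd s x z) y (b :: s y)).
  by case: b {e}; apply: runs_conv (runs_push _ _ _) _ _; rewrite // upd_ne // eq_sym.
apply: runs_conv (runs_foreach_cons e h (IH _ _)) _ _; last by rewrite /=; lia.
  by rewrite upd_ne // upd_eq.
apply: funext => r; rewrite /upd eqxx; case: (eqVneq r x) => // _.
by case: (eqVneq r y) => // _; rewrite rev_cons cat_rcons.
Qed.

Definition pour2 (x y y' : reg) : command :=
  Foreach x (Push y false ;; Push y' false) (Push y true ;; Push y' true).

Lemma runs_pour2 x y y' s : uniq [:: x; y; y'] ->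
  runs (pour2 x y y') s (10 * size (s x) + 1)
    (upd (upd (upd s y (rev (s x) ++ s y)) y' (rev (s x) ++ s y')) x [::]).
Proof.
rewrite /= !inE negb_or andbT => /andP[/andP[nxy nxy'] nyy'].
move e: (s x) => z; elim: z s e => [|b z IH] s e.
  apply: runs_conv (runs_foreach_nil _ _ e) _ _ => //=.
  apply: funext => r; rewrite /upd; case: eqP => [->|_] //.
  by case: eqP => [->|_] //; case: eqP => [->|].
have h : runs (if b then Push y true ;; Push y' true else Push y false ;; Push y' false)
    (upd s x z) 5 (upd (upd (upd s x z) y (b :: s y)) y' (b :: s y')).
  have hb : (if b then Push y true ;; Push y' true else Push y false ;; Push y' false) =
      (Push y b ;; Push y' b) by case: (b).
  rewrite hb; apply: runs_conv (runs_seq (runs_push _ _ _) (runs_push _ _ _)) _ _ => //.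
  have n1 : y != x by rewrite eq_sym.
  have n2 : y' != x by rewrite eq_sym.
  have n3 : y' != y by rewrite eq_sym.
  by rewrite (upd_ne _ _ n3) (upd_ne _ _ n2) (upd_ne _ _ n1).
apply: runs_conv (runs_foreach_cons e h (IH _ _)) _ _; last by rewrite /=; lia.
  by rewrite /upd eqxx (negbTE nxy) (negbTE nxy').
apply: funext => r; rewrite /upd !eqxx (negbTE nyy'); case: (eqVneq r x) => // _.
case: (eqVneq r y') => [_|_]; first by rewrite rev_cons cat_rcons.
by case: (eqVneq r y) => // _; rewrite rev_cons cat_rcons.
Qed.

Definition clear (x : reg) : command := Foreach x Skip Skip.

Lemma runs_clear x s : runs (clear x) s (5 * size (s x) + 1) (upd s x [::]).
Proof.
move e: (s x) => z; elim: z s e => [|b z IH] s e.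
  by apply: runs_conv (runs_foreach_nil _ _ e) _ _; rewrite // -e upd_id.
have h : runs (if b then Skip else Skip) (upd s x z) 1 (upd s x z).
  by case: b {e}; apply: runs_skip.
apply: runs_conv (runs_foreach_cons e h (IH (upd s x z) _)) _ _.
- by rewrite upd_eq.
- by rewrite upd_upd.
- by rewrite /=; lia.
Qed.

(* Stack [rD] counts the subtrees that remain to be read. *)
Definition scan_tree (x : reg) (keep : bool) : command :=
  let out b := if keep then Push rZ b else Skip in
  Push rD true ;;
  While rD top_some (If x Reject
    (Pop x ;; Pop rD ;; out false) (Pop x ;; Push rD true ;; out true)).

Lemma runs_scan_tree x keep s t w : x \notin [:: rZ; rD] ->
  s x = code t ++ w -> s rD = [::] ->
  runs (scan_tree x keep) s (20 * size (code t))
    (upd (upd s x w) rZ ((if keep then rev (code t) else [::]) ++ s rZ)).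
Proof.
rewrite !inE negb_or => /andP[nz nd] ex ed.
have updE : ((x == rZ = false) * (rZ == x = false) * (x == rD = false) * (rD == x = false))%type.
  by rewrite ![_ == x]eq_sym (negbTE nz) (negbTE nd).
rewrite /scan_tree; set body := If x _ _ _.
(* The invariant is in continuation form: reading [t] reduces the loop to the loop that starts after
   [t]. At a node one pending subtree is replaced by two, so both induction hypotheses chain. *)
have loop : forall t s w d N s2, s x = code t ++ w -> s rD = true :: d ->
    runs (While rD top_some body) (upd (upd (upd s x w) rD d) rZ
      ((if keep then rev (code t) else [::]) ++ s rZ)) N s2 ->
    runs (While rD top_some body) s (12 * size (code t) + N) s2.
  have out b (s' : store reg) : runs (if keep then Push rZ b else Skip) s' 2
      (upd s' rZ ((if keep then [:: b] else [::]) ++ s' rZ)).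
    case: keep {body} => /=; first exact: runs_push.
    by rewrite upd_id; apply: runs_le (runs_skip _) _.
  elim=> [|a IHa b IHb] {}s {}w d N s2 {}ex {}ed h.
    apply: runs_conv (runs_while_step _ _ h) _ _ => //.
    - by rewrite /top ed.
    - apply: (runs_if_cons _ ex) => /=.
      apply: runs_conv (runs_seq (runs_pop_cons ex) (runs_seq (runs_pop_cons (w := d) _) (out _ _))) _ _.
      + rewrite /upd /= ?updE; exact: ed.
      + by rewrite /upd /= ?updE; case: (keep).
      + exact: leqnn.
    by rewrite /=; lia.
  rewrite /= -catA in ex.
  have hb := IHb (upd (upd (upd s x (code b ++ w)) rD (true :: d)) rZ
    ((if keep then rev (true :: code a) else [::]) ++ s rZ)) w d N s2.
  have ha := IHa (upd (upd (upd s x (code a ++ code b ++ w)) rD [:: true, true & d]) rZ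
    ((if keep then [:: true] else [::]) ++ s rZ)) (code b ++ w) (true :: d) (12 * size (code b) + N) s2.
  apply: runs_conv (runs_while_step (N1 := 11) _ _ (ha _ _ _)) (erefl _) _.
  - by rewrite /top ed.
  - apply: (runs_if_cons _ ex) => /=.
    apply: runs_conv (runs_seq (runs_pop_cons ex) (runs_seq (runs_push _ _ _) (out _ _))) _ _ => //.
    rewrite /upd /= ?updE ?ed.
    by apply: funext => r; rewrite /upd; case: (keep).
  - by rewrite /upd /= ?updE ?eqxx.
  - by rewrite /upd /= ?updE ?eqxx.
  - apply: runs_start (hb _ _ _).
    + apply: funext => r; rewrite /upd /= ?updE ?eqxx.
      case: (eqVneq r rZ) => _; last by case: (r == rD); case: (r == x).
      by case: (keep) => //=; rewrite rev_cons cat_rcons.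
    + by rewrite /upd /= ?updE ?eqxx.
    + by rewrite /upd /= ?updE ?eqxx.
    + apply: runs_start h.
      apply: funext => r; rewrite /upd /= ?updE ?eqxx.
      case: (eqVneq r rZ) => _; last by case: (r == rD); case: (r == x).
      by case: (keep) => //=; rewrite !rev_cons rev_cat -!cats1 -!catA.
  - by rewrite /= size_cat; lia.
have h0 := runs_push rD true s.
have h1 := loop t (upd s rD [:: true]) w [::] 1
  (upd (upd s x w) rZ ((if keep then rev (code t) else [::]) ++ s rZ)).
have szt : 0 < size (code t) by case: (t).
apply: runs_conv (runs_seq h0 (runs_start _ (h1 _ _ _))) (erefl _) _.
- by rewrite ed.
- by rewrite /upd /= ?updE.
- by rewrite /upd /= ?updE.
- apply: runs_conv (runs_while_end _ _) _ (leqnn _) => //.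
  apply: funext => r; rewrite /upd /= ?updE ?eqxx; case: (eqVneq r rZ) => // _.
  by case: (eqVneq r rD) => // ->; rewrite updE ed.
- by lia.
Qed.

Definition move_tree (x y : reg) : command := scan_tree x true ;; pour1 rZ y.
Definition copy_tree (x y : reg) : command := scan_tree x true ;; pour2 rZ x y.
Definition drop_tree (x : reg) : command := scan_tree x false.
Definition move_all (x y : reg) : command := pour1 x rZ ;; pour1 rZ y.
Definition copy_all (x y : reg) : command := pour1 x rZ ;; pour2 rZ x y.

Lemma runs_move_tree x y s t w : x \notin [:: rZ; rD] -> y != x -> y != rZ ->
  s x = code t ++ w -> s rZ = [::] -> s rD = [::] ->
  runs (move_tree x y) s (40 * size (code t)) (upd (upd s x w) y (code t ++ s y)).
Proof.
move=> nx nyx nyz ex ez ed; have szt : 0 < size (code t) by case: (t).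
have nzx : rZ != x by apply: contraNneq nx => <-; rewrite inE eqxx.
apply: runs_conv (runs_seq (runs_scan_tree true nx ex ed) (runs_pour1 _ _)) _ _.
- by rewrite eq_sym.
- rewrite upd_eq ez cats0 revK (upd_ne _ _ nyz) (upd_ne _ _ nyx).
  apply: funext => r; rewrite /upd; case: (eqVneq r rZ) => [->|] //.
  by rewrite eq_sym (negbTE nyz) (negbTE nzx) ez.
- by rewrite upd_eq ez cats0 size_rev; lia.
Qed.

Lemma runs_copy_tree x y s t w : x \notin [:: rZ; rD] -> y != x -> y != rZ ->
  s x = code t ++ w -> s rZ = [::] -> s rD = [::] ->
  runs (copy_tree x y) s (40 * size (code t)) (upd s y (code t ++ s y)).
Proof.
move=> nx nyx nyz ex ez ed; have szt : 0 < size (code t) by case: (t).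
have nzx : rZ != x by apply: contraNneq nx => <-; rewrite inE eqxx.
apply: runs_conv (runs_seq (runs_scan_tree true nx ex ed) (runs_pour2 _ _)) _ _.
- by rewrite /= !inE negb_or nzx [rZ == y]eq_sym [x == y]eq_sym nyx nyz.
- have nxz : x != rZ by rewrite eq_sym.
  rewrite upd_eq ez cats0 revK (upd_ne _ _ nyz) (upd_ne _ _ nyx) (upd_ne _ _ nxz) upd_eq -ex.
  apply: funext => r; rewrite /upd; case: (eqVneq r rZ) => [->|].
    by rewrite eq_sym (negbTE nyz) ez.
  by case: (eqVneq r y) => // _; case: (eqVneq r x) => [->|].
- by rewrite upd_eq ez cats0 size_rev; lia.
Qed.

Lemma runs_drop_tree x s t w : x \notin [:: rZ; rD] ->
  s x = code t ++ w -> s rD = [::] ->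
  runs (drop_tree x) s (20 * size (code t)) (upd s x w).
Proof.
move=> nx ex ed; apply: runs_conv (runs_scan_tree false nx ex ed) _ (leqnn _) => /=.
apply: funext => r; rewrite /upd; case: (eqVneq r rZ) => [->|] //.
by case: eqP nx => // <-; rewrite inE eqxx.
Qed.

Lemma runs_move_all x y s : x != rZ -> y != x -> y != rZ -> s rZ = [::] ->
  runs (move_all x y) s (20 * size (s x) + 3) (upd (upd s x [::]) y (s x ++ s y)).
Proof.
move=> nx nyx nyz ez.
apply: runs_conv (runs_seq (runs_pour1 _ nx) (runs_pour1 _ _)) _ _.
- by rewrite eq_sym.
- have nzx : rZ != x by rewrite eq_sym.
  rewrite (upd_ne _ _ nzx) upd_eq ez cats0 revK (upd_ne _ _ nyx) (upd_ne _ _ nyz).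
  apply: funext => r; rewrite /upd; case: (eqVneq r rZ) => [->|] //.
  by rewrite eq_sym (negbTE nyz) (negbTE nzx) ez.
- have nzx : rZ != x by rewrite eq_sym.
  by rewrite (upd_ne _ _ nzx) upd_eq ez cats0 size_rev; lia.
Qed.

Lemma runs_copy_all x y s : x != rZ -> y != x -> y != rZ -> s rZ = [::] ->
  runs (copy_all x y) s (20 * size (s x) + 3) (upd s y (s x ++ s y)).
Proof.
move=> nx nyx nyz ez.
have nzx : rZ != x by rewrite eq_sym.
apply: runs_conv (runs_seq (runs_pour1 _ nx) (runs_pour2 _ _)) _ _.
- by rewrite /= !inE negb_or nzx [rZ == y]eq_sym [x == y]eq_sym nyx nyz.
- rewrite (upd_ne _ _ nzx) !upd_eq ez !cats0 revK (upd_ne _ _ nyx) (upd_ne _ _ nyz).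
  apply: funext => r; rewrite /upd; case: (eqVneq r rZ) => [->|].
    by rewrite eq_sym (negbTE nyz) ez.
  by case: (eqVneq r y) => // _; case: (eqVneq r x) => [->|].
- by rewrite (upd_ne _ _ nzx) upd_eq ez cats0 size_rev; lia.
Qed.

Definition top_true (o : option bool) : bool := if o is Some b then b else false.
Definition top_false (o : option bool) : bool := if o is Some b then ~~ b else false.

Fixpoint empties (l : seq reg) (s : store reg) : Prop :=
  if l is r :: l' then s r = [::] /\ empties l' s else True.

Lemma empties_in l s r : empties l s -> r \in l -> s r = [::].
Proof.
elim: l => //= r' l IH [h1 h2]; rewrite inE => /orP[/eqP-> //|]; exact: IH.
Qed.

End Macros.

Section Programs.
Implicit Types (s : store reg) (m : bool).

Ltac rewrite_store :=
  repeat match goal with H : ?s ?r = _ |- context [?s ?r] => rewrite H end.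
Ltac wnorm := repeat progress (rewrite -?catA /=).
Ltac rdall := rewrite /upd /=; rewrite ?eqxx /= -?catA; rewrite_store; rewrite ?eqxx /=; wnorm.
Ltac rd := rdall; first [reflexivity | eassumption | by [] | (rewrite -[LHS]cats0; reflexivity) | by rewrite ?cats0].
Ltac split_bools := repeat match goal with m : bool |- _ => destruct m end.
Ltac store_eq :=
  apply: funext; let r := fresh "r" in intro r; destruct r; split_bools;
  rewrite /upd /=; rewrite_store; try by []; try by rewrite /= -?catA /= -?catA ?cats0.
Ltac empties_tac := repeat split; rdall; try by [].

(* The macro rules with every store access resolved to an explicit word, so
   that the stores met in a symbolic run stay linear in size. *)
Lemma runs_push_at r b s v : s r = v -> runs (Push r b) s 2 (upd s r (b :: v)).
Proof. by move=> <-; apply: runs_push. Qed.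

Lemma runs_move_tree_at x y s t w v : x \notin [:: rZ; rD] -> y != x -> y != rZ ->
  s x = code t ++ w -> s rZ = [::] -> s rD = [::] -> s y = v ->
  runs (move_tree x y) s (40 * size (code t)) (upd (upd s x w) y (code t ++ v)).
Proof. by move=> h1 h2 h3 h4 h5 h6 <-; apply: runs_move_tree. Qed.

Lemma runs_copy_tree_at x y s t w v : x \notin [:: rZ; rD] -> y != x -> y != rZ ->
  s x = code t ++ w -> s rZ = [::] -> s rD = [::] -> s y = v ->
  runs (copy_tree x y) s (40 * size (code t)) (upd s y (code t ++ v)).
Proof. by move=> h1 h2 h3 h4 h5 h6 <-; apply: (runs_copy_tree h1 h2 h3 h4). Qed.

Lemma runs_clear_at x s u : s x = u -> runs (clear x) s (5 * size u + 1) (upd s x [::]).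
Proof. by move=> <-; apply: runs_clear. Qed.

Lemma runs_pour1_at x y s u v : x != y -> s x = u -> s y = v ->
  runs (pour1 x y) s (10 * size u + 1) (upd (upd s y (rev u ++ v)) x [::]).
Proof. by move=> h <- <-; apply: runs_pour1. Qed.

Lemma runs_move_all_at x y s u v : x != rZ -> y != x -> y != rZ -> s rZ = [::] ->
  s x = u -> s y = v -> runs (move_all x y) s (20 * size u + 3) (upd (upd s x [::]) y (u ++ v)).
Proof. by move=> h1 h2 h3 h4 <- <-; apply: runs_move_all. Qed.

Lemma runs_copy_all_at x y s u v : x != rZ -> y != x -> y != rZ -> s rZ = [::] ->
  s x = u -> s y = v -> runs (copy_all x y) s (20 * size u + 3) (upd s y (u ++ v)).
Proof. by move=> h1 h2 h3 h4 <- <-; apply: runs_copy_all. Qed.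

Ltac rdv := rdall; reflexivity.
(** The leading tree of a stack is recovered from the shape of the word, so the symbolic runs need
    no annotations. *)
Ltac first_tree w k :=
  lazymatch w with
  | false :: ?w1 => k Leaf w1
  | true :: ?w1 => first_tree w1 ltac:(fun a w2 =>
      first_tree w2 ltac:(fun b w3 => k constr:(Node a b) w3))
  | code ?t ++ ?w1 => k t w1
  | code ?t => k t constr:(@nil bool)
  end.
Ltac read_tree s x k :=
  let H := fresh in
  eassert (H : s x = _) by rdv;
  lazymatch type of H with _ = ?w =>
    first_tree w ltac:(fun t w' => k t w' ltac:(by rewrite H /=; wnorm; rewrite ?cats0)); clear H
  end.
Ltac xmove s x :=
  read_tree s x ltac:(fun t u tac =>
    eapply (runs_move_tree_at (t := t) (w := u)); [done|done|done|tac|rd|rd|rdv]).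
Ltac xcopy s x :=
  read_tree s x ltac:(fun t u tac =>
    eapply (runs_copy_tree_at (t := t) (w := u)); [done|done|done|tac|rd|rd|rdv]).
Ltac xdrop s x :=
  read_tree s x ltac:(fun t u tac => eapply (runs_drop_tree (t := t) (w := u)); [done|tac|rd]).
Ltac xprim :=
  lazymatch goal with
  | |- runs (Push _ _) _ _ _ => eapply runs_push_at; rdv
  | |- runs Skip _ _ _ => eapply runs_skip
  | |- runs (Pop _) _ _ _ => eapply runs_pop_cons; rd
  | |- runs (move_tree ?x _) ?s _ _ => xmove s x
  | |- runs (copy_tree ?x _) ?s _ _ => xcopy s x
  | |- runs (drop_tree ?x) ?s _ _ => xdrop s x
  | |- runs (clear _) _ _ _ => eapply runs_clear_at; rdv
  | |- runs (pour1 _ _) _ _ _ => eapply runs_pour1_at; [done|rdv|rdv]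
  | |- runs (move_all _ _) _ _ _ => eapply runs_move_all_at; [done|done|done|rd|rdv|rdv]
  | |- runs (copy_all _ _) _ _ _ => eapply runs_copy_all_at; [done|done|done|rd|rdv|rdv]
  | |- runs (If _ _ _ _) _ _ _ =>
      first [eapply runs_if_nil; [rd|] | eapply runs_if_cons; [rd|]; cbv iota]
  end.
Ltac xstep :=
  lazymatch goal with
  | |- runs (Seq _ _) _ _ _ => eapply runs_seq; [xstep|]
  | |- _ => xprim
  end.
Ltac xrun := repeat xstep.

Lemma runs_while_true r c s w N1 s1 N2 s2 : s r = true :: w -> runs c s N1 s1 ->
  runs (While r top_true c) s1 N2 s2 -> runs (While r top_true c) s (N1 + N2).+1 s2.
Proof. by move=> e; apply: runs_while_step; rewrite /top e. Qed.

Lemma runs_while_false r c s w : s r = false :: w -> runs (While r top_true c) s 1 s.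
Proof. by move=> e; apply: runs_while_end; rewrite /top e. Qed.

(** * Simulation of one step *)

Lemma tapes_code_cons (X : finType) (t : tape X) ts w :
  tapes_code (t :: ts) ++ w =
  true :: code (cells (lhs t)) ++ code (cells (rhs t)) ++ tapes_code ts ++ w.
Proof. by rewrite /tapes_code /= /tape_code -!catA. Qed.

Lemma tapes_code_rcons (X : finType) (t : tape X) ts w :
  tapes_code (rcons ts t) ++ w = tapes_code ts ++ tapes_code [:: t] ++ w.
Proof. by rewrite -cats1 /tapes_code map_cat flatten_cat -catA. Qed.

(** Going from [rT] to [rT2] reverses the tapes, so the symbol of the first tape ends on top of
    [rK], in the order of the trie. An empty right part is a blank, of index 0, whose code is the
    single bit [false]. *)
Definition scan_loop m : command :=
  While (rT m) top_true (
    Pop (rT m) ;; move_tree (rT m) rL ;;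
    If (rT m) Reject (Push rK false) (Pop (rT m) ;; copy_tree (rT m) rK ;; Push (rT m) true) ;;
    move_tree (rT m) rT2 ;; move_tree rL rT2 ;; Push rT2 true).

Definition tapes_le (X : finType) B (ts : seq (tape X)) : Prop :=
  forall t, List.In t ts -> size (tape_code t) <= B.

Lemma runs_scan_loop m (X : finType) (ts : seq (tape X)) s B :
  s (rT m) = tapes_code ts ++ [:: false] -> empties [:: rL; rZ; rD] s -> tapes_le B ts ->
  runs (scan_loop m) s (size ts * (200 * B + 100) + 1)
   (upd (upd (upd s (rT m) [:: false]) rT2 (tapes_code (rev ts) ++ s rT2)) rK
     (flatten [seq code (sym_tree (scan t)) | t <- rev ts] ++ s rK)).
Proof.
elim: ts s => [|[l r] ts IH] s hT [hL [hZ [hD _]]] hB.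
  eapply runs_conv; [by eapply runs_while_false; rd| |by []].
  by store_eq.
rewrite tapes_code_cons /= in hT.
have hl := hB _ (or_introl erefl); rewrite /tape_code size_cat /= in hl.
have {}hB : tapes_le B ts by move=> t ht; apply: hB; right.
case: r hT hl => [|x r] hT hl.
- eapply runs_conv.
  + eapply runs_while_true; [rd|rewrite /=; xrun|eapply IH; [rd|empties_tac|exact: hB]].
  + rewrite rev_cons map_rcons flatten_rcons.
    by store_eq; rewrite ?tapes_code_rcons /= -?catA //= -?catA.
  + move: hl; rewrite /=; lia.
- eapply runs_conv.
  + eapply runs_while_true; [rd|rewrite /=; xrun|eapply IH; [rd|empties_tac|exact: hB]].
  + rewrite rev_cons map_rcons flatten_rcons.
    by store_eq; rewrite ?tapes_code_rcons /= -?catA //= -?catA.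
  + move: hl; rewrite /= size_cat; lia.
Qed.

Definition index_loop m : command :=
  While rK top_true (Pop rK ;; Pop rK ;; Pop (rW m) ;; drop_tree (rW m)).
Definition index1 m : command := index_loop m ;; Pop rK ;; Pop (rW m).

Lemma runs_index_loop m s j l k w :
  s rK = code (num j) ++ k -> s (rW m) = code (lst l) ++ w -> j < size l -> s rD = [::] ->
  runs (index_loop m) s (30 * size (code (lst (take j l))) + 1)
    (upd (upd s rK (false :: k)) (rW m) (code (lst (drop j l)) ++ w)).
Proof.
elim: j l s => [|j IH] [|a l] s //= hK hW lt hD.
  eapply runs_conv; [by eapply runs_while_false; rd| |by []].
  by store_eq.
eapply runs_conv.
- eapply runs_while_true; [rd|xrun|eapply (IH l); [rd|rd|done|rd]].
- by store_eq.
- by rewrite size_cat; lia.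
Qed.

Lemma runs_index1 m s j l k w :
  s rK = code (num j) ++ k -> s (rW m) = code (lst l) ++ w -> j < size l -> s rD = [::] ->
  runs (index1 m) s (30 * size (code (lst l)) + 10)
    (upd (upd s rK k) (rW m) (code (nth Leaf l j) ++ code (lst (drop j.+1 l)) ++ w)).
Proof.
move=> hK hW lt hD; have hl := runs_index_loop hK hW lt hD.
rewrite (drop_nth Leaf lt) /= in hl.
eapply runs_conv.
- by eapply runs_seq; [exact: hl|xrun].
- by store_eq; rewrite -catA.
- have : size (code (lst (take j l))) <= size (code (lst l)).
    rewrite -{2}(cat_take_drop j l); elim: (take j l) => [|a t IH] /=.
      by case: (drop _ _).
    by rewrite !size_cat; lia.
  by lia.
Qed.

Lemma runs_while_nonempty r c s b w N1 s1 N2 s2 : s r = b :: w -> runs c s N1 s1 ->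
  runs (While r top_some c) s1 N2 s2 -> runs (While r top_some c) s (N1 + N2).+1 s2.
Proof. by move=> e; apply: runs_while_step; rewrite /top e. Qed.

Lemma runs_while_empty r c s : s r = [::] -> runs (While r top_some c) s 1 s.
Proof. by move=> e; apply: runs_while_end; rewrite /top e. Qed.

(** The unread ends of the lists stay below the selected subtree. They are garbage, cleared later;
    only their size is tracked, by [w'] in the specification. *)
Definition index_all m : command := While rK top_some (index1 m).

Lemma runs_index_all m s ns js f w B :
  s rK = flatten [seq code (num j) | j <- js] ->
  s (rW m) = code (trie ns (size js) f) ++ w -> all (fun j => j < ns) js ->
  s rD = [::] -> size (s (rW m)) <= B ->
  exists2 w', size (code (f js) ++ w') <= B &
    runs (index_all m) s (size js * (30 * B + 20) + 1)
      (upd (upd s rK [::]) (rW m) (code (f js) ++ w')).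
Proof.
elim: js f s w => [|j js IH] f s w /= hK hW hjs hD hB.
  exists w; first by rewrite -hW.
  eapply runs_conv; [by eapply runs_while_empty; rd| |by []].
  by store_eq.
case/andP: hjs => lt hjs.
have [b [u hb]] : exists b u, code (num j) = b :: u by case: (j) => [|i] /=; eexists; eexists.
have lt' : j < size [seq trie ns (size js) (fun l => f (x :: l)) | x <- iota 0 ns].
  by rewrite size_map size_iota.
have h1 := runs_index1 hK hW lt' hD.
move: h1; rewrite (nth_map 0) ?size_iota // nth_iota // add0n => h1.
have hsz : size (code (trie ns (size js) (fun l => f (j :: l)))) +
   size (code (lst (drop j.+1 [seq trie ns (size js) (fun l => f (x :: l)) | x <- iota 0 ns]))) + size w <= B.
  apply: leq_trans hB; rewrite hW size_cat leq_add2r.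
  set L := [seq _ | x <- _] in lt' *.
  have -> : trie ns (size js) (fun l => f (j :: l)) = nth Leaf L j.
    by rewrite (nth_map 0) ?size_iota // nth_iota.
  rewrite -[in X in _ <= X](cat_take_drop j L) (drop_nth Leaf lt').
  elim: (take j L) => [|a t IHt] /=; rewrite !size_cat; lia.
have [|||||w' sz h2] := IH (fun l => f (j :: l)) (upd (upd s rK (flatten [seq code (num j) | j <- js]))
  (rW m) (code (trie ns (size js) (fun l => f (j :: l))) ++
    code (lst (drop j.+1 [seq trie ns (size js) (fun l => f (x :: l)) | x <- iota 0 ns])) ++ w))
    (code (lst (drop j.+1 [seq trie ns (size js) (fun l => f (x :: l)) | x <- iota 0 ns])) ++ w).
- by rd.
- by rd.
- by [].
- by rd.
- by rdall; rewrite !size_cat addnA.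
exists w' => //.
eapply runs_conv.
- eapply runs_while_nonempty; [rewrite hK hb //|exact: h1|exact: h2].
- by store_eq.
- by move: hB; rewrite hW size_cat /= mulSn; lia.
Qed.

(** The new symbol is put on the right part in place of the scanned one; then the unary index of the
    move is read: 0 stays, 1 goes left, 2 goes right. A left move from an empty left part brings in
    a blank. *)
Definition apply_step m : command :=
  Pop rT2 ;; move_tree rT2 rL ;; move_tree rT2 rR ;; Pop rA ;; Pop rA ;;
  If rR Reject Skip (Pop rR ;; drop_tree rR) ;;
  move_tree rA rR ;; Push rR true ;;
  If rA Reject (Pop rA)
    (Pop rA ;; Pop rA ;;
     If rA Reject
       (Pop rA ;; If rL Reject (Push rR false ;; Push rR true)
                    (Pop rL ;; move_tree rL rR ;; Push rR true))
       (Pop rA ;; Pop rA ;; Pop rA ;; Pop rR ;; move_tree rR rL ;; Push rL true)) ;;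
  move_tree rR (rT m) ;; move_tree rL (rT m) ;; Push (rT m) true.

Definition apply_loop m : command := While rT2 top_true (apply_step m).

Section Apply.
Variable X : finType.

Definition act_tree (a : symbol X * move) : tree := Node (sym_tree a.1) (num (move_idx a.2)).
Definition act_tape (a : symbol X * move) (t : tape X) := shift a.2 (write a.1 t).

Lemma runs_apply_step m s a (t : tape X) u v B :
  s rT2 = true :: code (cells (lhs t)) ++ code (cells (rhs t)) ++ u ->
  s rA = true :: code (act_tree a) ++ v ->
  empties [:: rL; rR; rZ; rD] s ->
  size (tape_code t) + size (code (sym_tree a.1)) <= B ->
  runs (apply_step m) s (300 * B + 200)
    (upd (upd (upd s rT2 u) rA v) (rT m) (true :: tape_code (act_tape a t) ++ s (rT m))).
Proof.
case: t => l r; case: a => x d /= hT2 hA [hL [hR [hZ [hD _]]]].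
rewrite /tape_code size_cat /= => hB.
rewrite -catA /= in hA.
case: d hA => hA; case: r hT2 hB => [|y r] hT2 hB; case: l hT2 hB => [|z l] hT2 hB;
(eapply runs_conv;
   [by rewrite /apply_step; xrun|by store_eq; rewrite /tape_code /cells /= -?catA /= -?catA /= -?catA
   |by move: hB; rewrite /cells /= ?size_cat /= ?size_cat /=; lia]).
Qed.

End Apply.

Lemma runs_apply_loop (X : finType) m s (l : seq ((symbol X * move) * tape X)) v B :
  s rT2 = tapes_code [seq x.2 | x <- l] ++ [:: false] ->
  s rA = code (lst [seq act_tree x.1 | x <- l]) ++ v ->
  empties [:: rL; rR; rZ; rD] s ->
  (forall x, List.In x l -> size (tape_code x.2) + size (code (sym_tree x.1.1)) <= B) ->
  runs (apply_loop m) s (size l * (300 * B + 201) + 1)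
    (upd (upd (upd s rT2 [:: false]) rA (false :: v)) (rT m)
      (tapes_code (rev [seq act_tape x.1 x.2 | x <- l]) ++ s (rT m))).
Proof.
elim: l s => [|[a t] l IH] s h2 hA hE hB.
  eapply runs_conv; [by eapply runs_while_false; rd| |by []].
  by store_eq.
rewrite [map _ _]/= tapes_code_cons in h2.
have hA' : s rA = true :: code (act_tree a) ++ code (lst [seq act_tree x.1 | x <- l]) ++ v.
  by rewrite hA /= -!catA.
have h1 := runs_apply_step m h2 hA' hE (hB (a, t) (or_introl erefl)).
have {}hB x : List.In x l -> size (tape_code x.2) + size (code (sym_tree x.1.1)) <= B.
  by move=> hx; apply: hB; right.
case: hE => [hL [hR [hZ [hD _]]]].
eapply runs_conv.
- eapply runs_while_true; [exact: h2|exact: h1|].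
  eapply IH; [rd|rd|empties_tac|exact: hB].
- rewrite map_cons rev_cons.
  by store_eq; rewrite ?tapes_code_rcons /= -?catA.
- by rewrite /= mulSn; lia.
Qed.

(** [rF] starts as the acceptance flag of the state and becomes [false] at the first refusal, as a
    configuration with an action has not halted: this is the conjunct [nilp] of [follow]. [rH] is
    nonempty while the choice is open. *)
Definition choose m : command :=
  If (rW m) Reject
    (move_all rF rRes ;; Pop (rC m) ;; Pop rH)
    (If (rP m)
      (Pop (rC m) ;; Pop rH)
      (Pop (rP m) ;; Pop (rW m) ;; move_tree (rW m) rA ;; clear (rW m) ;; clear rF ;; Pop rH)
      (Pop (rP m) ;; Pop (rW m) ;; drop_tree (rW m) ;; clear rF ;; Push rF false)).

Definition choose_loop m : command := While rH top_some (choose m).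

Lemma runs_choose_loop m s (M : ntm) (l : seq (action M)) p f w B :
  s (rW m) = code (lst [seq action_tree a | a <- l]) ++ w -> s (rP m) = p ->
  s rF = [:: f] -> s rH = [:: true] -> s (rC m) = [:: true] ->
  empties [:: rZ; rD; rA; rRes] s -> size (s (rW m)) <= B ->
  exists2 s', runs (choose_loop m) s (100 * B + 100) s' &
  match choose_act l p with
  | Taken a p' =>
      s' = upd (upd (upd (upd (upd s (rW m) [::]) (rP m) p') rF [::]) rH [::]) rA
              (code (action_tree a))
  | Refused p' => exists2 u, size u <= B &
      s' = upd (upd (upd (upd (upd (upd s (rW m) u) (rP m) p') rF [::]) rH [::]) (rC m) [::])
             rRes [:: f && nilp l]
  | Exhausted => exists u g, size u <= B /\
      s' = upd (upd (upd (upd (upd s (rW m) u) (rP m) [::]) rF [:: g]) rH [::]) (rC m) [::]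
  end.
Proof.
suff : forall s (l : seq (action M)) p f, s (rW m) = code (lst [seq action_tree a | a <- l]) ++ w -> s (rP m) = p ->
  s rF = [:: f] -> s rH = [:: true] -> s (rC m) = [:: true] ->
  empties [:: rZ; rD; rA; rRes] s -> size (s (rW m)) <= B ->
  exists2 s', runs (choose_loop m) s (60 * size (code (lst [seq action_tree a | a <- l])) + 5 * B + 50) s' &
  match choose_act l p with
  | Taken a p' =>
      s' = upd (upd (upd (upd (upd s (rW m) [::]) (rP m) p') rF [::]) rH [::]) rA
              (code (action_tree a))
  | Refused p' => exists2 u, size u <= B &
      s' = upd (upd (upd (upd (upd (upd s (rW m) u) (rP m) p') rF [::]) rH [::]) (rC m) [::])
             rRes [:: f && nilp l]
  | Exhausted => exists u g, size u <= B /\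
      s' = upd (upd (upd (upd (upd s (rW m) u) (rP m) [::]) rF [:: g]) rH [::]) (rC m) [::]
  end.
  move=> gen hW hP hF hH hC hE hB; have [s' h1 h2] := gen s l p f hW hP hF hH hC hE hB.
  exists s' => //; apply: runs_le h1 _; move: hB; rewrite hW size_cat; lia.
move=> {}s {}l {}p {}f; elim: l s p f => [|a l IH] s p f hW hP hF hH hC [hZ [hD [hA [hR _]]]] hB.
  rewrite choose_nil; eexists.
    eapply runs_le.
      by eapply runs_while_nonempty; [rd|rewrite /choose; xrun|apply: runs_while_empty; rd].
    by rewrite /=; lia.
  exists (s (rW m)) => //; rewrite /= andbT.
  by store_eq.
case: p hP => [|[] p] hP /=.
- eexists.
    eapply runs_le.
      by eapply runs_while_nonempty; [rd|rewrite /choose; xrun|apply: runs_while_empty; rd].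
    by rewrite /=; lia.
  by exists (s (rW m)), f; split=> //; store_eq.
- rewrite /= -catA in hW.
  have [|||||||s' h1 h2] := IH (upd (upd (upd s (rP m) p) (rW m)
    (code (lst [seq action_tree a | a <- l]) ++ w)) rF [:: false]) p false.
  + by rd.
  + by rd.
  + by rd.
  + by rd.
  + by rd.
  + by empties_tac.
  + by rdall; move: hB; rewrite hW /= !size_cat; lia.
  exists s'.
    eapply runs_conv.
    + eapply runs_while_nonempty; [rd|by rewrite /choose; xrun|].
      by apply: runs_start h1; store_eq.
    + by [].
    + by rewrite /= !size_cat; lia.
  case: (choose_act l p) h2 => [b p'|p'|].
  + by move=> ->; store_eq.
  + case=> u szu ->; exists u => //; rewrite /= andbF.
    by store_eq.
  + case=> u [g [szu ->]]; exists u, g; split => //.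
    by store_eq.
- rewrite /= -catA in hW; eexists.
    eapply runs_le.
      by eapply runs_while_nonempty; [rd|rewrite /choose; xrun|apply: runs_while_empty; rd].
    by move: hB; rewrite hW /= !size_cat; lia.
  by store_eq; rewrite /= ?cats0 -?catA /= ?cats0.
Qed.

Lemma tapes_le_rev (X : finType) B (ts : seq (tape X)) : tapes_le B ts -> tapes_le B (rev ts).
Proof.
suff gen t : List.In t (rev ts) -> List.In t ts by move=> h t /gen; apply: h.
elim: ts => // a ts IH; rewrite rev_cons -cats1 => h.
case: (List.in_app_or _ _ _ h) => [/IH|[->|[]]]; first by right.
by left.
Qed.

Lemma size_code_lst (T : eqType) (f : T -> tree) (l : seq T) a : a \in l ->
  size (code (f a)) <= size (code (lst [seq f x | x <- l])).
Proof.
elim: l => //= b l IH; rewrite inE size_cat => /orP[/eqP->|/IH].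
  by move: (size (code (f b))) => k; lia.
by move: (size (code (f b))) (size (code (f a))) => k k'; lia.
Qed.

Definition fetch m : command :=
  copy_tree (rTab m) (rW m) ;; move_tree rS rK ;; index1 m ;; Pop (rW m).
Definition apply_all m : command :=
  Push (rT m) false ;; apply_loop m ;; Pop rT2 ;; Pop rA.
Definition query_branch m (orc : command) : command :=
  Pop (rW m) ;; orc ;; Pop (rW m) ;;
  If rAns Reject (Pop rAns ;; drop_tree (rW m)) (Pop rAns) ;;
  move_tree (rW m) rS ;; clear (rW m).
Definition read_flag m : command :=
  Pop (rW m) ;; Pop (rW m) ;;
  If (rW m) Reject (Pop (rW m) ;; Push rF false)
    (Pop (rW m) ;; Pop (rW m) ;; Pop (rW m) ;; Push rF true).
Definition perform m : command := Pop rA ;; move_tree rA rS ;; apply_all m.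
Definition action_branch m : command :=
  read_flag m ;; Push rT2 false ;; scan_loop m ;; Pop (rT m) ;; index_all m ;;
  Push rH true ;; choose_loop m ;; If rA Skip (perform m) (perform m).
Definition step_cmd m orc : command :=
  fetch m ;; If (rW m) Reject (query_branch m orc) (action_branch m).

Section Step.
Variables (M : ntm) (isq : pred (state M)) (qy qn : state M) (orac : word -> bool).

Definition run_store m s (c : config M) (p : word) : store reg :=
  upd (upd (upd (upd s (rT m) (tapes_code (rev (tapes c)) ++ [:: false]))
    rS (code (num (st_idx (cstate c))))) (rP m) p) (rC m) [:: true].

Definition run_ready m s : Prop :=
  s (rTab m) = code (table_tree isq qy qn) /\
  empties [:: rZ; rD; rL; rR; rK; rF; rA; rH; rT2; rRes; rAns; rW m; rT m; rC m; rS] s.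

Lemma state_idx_lt (q : state M) : st_idx q < size [seq state_tree isq qy qn q | q <- enum (state M)].
Proof. by rewrite size_map index_mem mem_enum. Qed.

Lemma runs_fetch m s c p a b B : run_ready m s ->
  state_tree isq qy qn (cstate c) = Node a b ->
  size (code (table_tree isq qy qn)) + size (code (num (st_idx (cstate c)))) <= B ->
  exists2 w, size (code a ++ code b ++ w) <= B &
  runs (fetch m) (run_store m s c p) (200 * B + 50)
    (upd (upd (run_store m s c p) rS [::]) (rW m) (code a ++ code b ++ w)).
Proof.
rewrite /run_store.
move=> [hTab [hZ [hD [hL [hR [hK [hF [hA [hH [hT2 [hRes [hAns [hW [hT [hC [hS _]]]]]]]]]]]]]]]] hq hB.
have hn := nth_state isq qy qn (cstate c).
set l := [seq _ | q <- _] in hn; set j := st_idx _ in hB hn *.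
have lt : j < size l by apply: state_idx_lt.
have htab : table_tree isq qy qn = lst l by [].
exists (code (lst (drop j.+1 l)) ++ [::]).
  rewrite htab in hB; apply: leq_trans _ (leq_trans (leq_addr _ _) hB).
  rewrite -[l in X in _ <= X](cat_take_drop j) (drop_nth Leaf lt) hn hq.
  elim: (take j l) => [|x t IH] /=; rewrite !size_cat /= ?size_cat; [lia|move: IH; rewrite !size_cat; lia].
eapply runs_conv.
- eapply runs_seq; first by xstep.
  eapply runs_seq; first by xstep.
  eapply runs_seq.
    eapply runs_index1; [rd|rd|exact: lt|rd].
  rewrite hn hq; by xstep.
- by store_eq.
- by rewrite -htab; lia.
Qed.

(** The oracle subroutine enters through its specification only: it must leave its answer on [rAns]
    and restore all the other registers. *)
Lemma runs_query m orc s c p B CO : run_ready m s -> isq (cstate c) ->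
  size (code (table_tree isq qy qn)) + size (code (num (st_idx (cstate c)))) <= B ->
  (forall s', (forall r, r \notin [:: rT m; rW m; rP m; rC m; rS] -> s' r = s r) ->
    s' rS = [::] -> s' (rT m) = tapes_code (rev (tapes c)) ++ [:: false] ->
    runs orc s' CO (upd s' rAns [:: orac (last_word c)])) ->
  runs (step_cmd m orc) (run_store m s c p) (CO + 400 * B + 200)
    (run_store m s (answer qy qn orac c) p).
Proof.
move=> hr hq hB hO.
have hst : state_tree isq qy qn (cstate c) = Node Leaf (Node (num (st_idx qy)) (num (st_idx qn))).
  by rewrite /state_tree hq.
have [w szw h1] := runs_fetch p hr hst hB; rewrite /= -catA in szw h1.
move: h1; set s1 := upd _ (rW m) _ => h1.
case: (hr) => [hTab [hZ [hD [hL [hR [hK [hF [hA [hH [hT2 [hRes [hAns [hW [hT [hC [hS _]]]]]]]]]]]]]]]].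
move: (hO (upd s1 (rW m) (true :: code (num (st_idx qy)) ++ code (num (st_idx qn)) ++ w))).
rewrite /answer; case: (orac (last_word c)) => h2.
all: eapply runs_conv; [eapply runs_seq; [exact: h1|];
  eapply runs_if_cons; [by rewrite /s1 /run_store; rd|];
  eapply runs_seq; [by rewrite /s1 /run_store; xstep|];
  eapply runs_seq; [apply: runs_start (h2 _ _ _);
    [by rewrite /s1 /run_store; store_eq
    |move=> r; rewrite !inE !negb_or => /and5P[n1 n2 n3 n4 n5];
     by rewrite /s1 /run_store /upd (negbTE n1) (negbTE n2) (negbTE n3) (negbTE n4) (negbTE n5)
    |by rewrite /s1 /run_store; rd|by rewrite /s1 /run_store; rd]|];
  by rewrite /s1 /run_store; xrun
 |by rewrite /s1 /run_store /=; store_eq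
 |by move: szw; rewrite /= !size_cat; lia].
Qed.

Lemma runs_read_flag m s (b : bool) u : s (rW m) = code (num b.+1) ++ u -> s rF = [::] ->
  runs (read_flag m) s 30 (upd (upd s (rW m) u) rF [:: b]).
Proof.
by case: b => /= hW hF; (eapply runs_conv; [rewrite /read_flag; xrun|store_eq|]).
Qed.

Lemma runs_apply_all m s c (a : action M) B :
  s rT2 = tapes_code (tapes c) ++ [:: false] ->
  s rA = code (lst [seq act_tree (a.2 i) | i <- enum 'I_(aux_tapes M).+1]) ->
  s (rT m) = [::] -> empties [:: rL; rR; rZ; rD] s -> tapes_le B (tapes c) ->
  2 * num_syms (aux_symbol M) <= B ->
  runs (apply_all m) s (size (tapes c) * (600 * B + 201) + 20)
    (upd (upd (upd s rT2 [::]) rA [::]) (rT m) (tapes_code (rev (tapes (act_on c a))) ++ [:: false])).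
Proof.
move=> h2 hA hT [hL [hR [hZ [hD _]]]] hB hns.
pose l := [seq (a.2 i, ctapes c i) | i <- enum 'I_(aux_tapes M).+1].
have e2 : [seq x.2 | x <- l] = tapes c by rewrite -map_comp.
have e1 : [seq act_tree x.1 | x <- l] = [seq act_tree (a.2 i) | i <- enum 'I_(aux_tapes M).+1].
  by rewrite -map_comp.
have e3 : [seq act_tape x.1 x.2 | x <- l] = tapes (act_on c a).
  by rewrite -map_comp; apply: eq_map => i /=; rewrite ffunE.
have hl : forall x, List.In x l -> size (tape_code x.2) + size (code (sym_tree x.1.1)) <= 2 * B.
  move=> x hx; have : List.In x.2 (tapes c) by rewrite -e2; apply: List.in_map.
  move/hB; have := sym_idx_lt x.1.1; rewrite /sym_tree size_num; lia.
eapply runs_conv.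
- eapply runs_seq; first by xstep.
  eapply runs_seq.
    by eapply (@runs_apply_loop _ m _ l); [rewrite e2; rd|rewrite e1; rd|empties_tac|exact: hl].
  by xrun.
- by rewrite e3; store_eq.
- by rewrite -(size_map snd) e2; lia.
Qed.

Definition action_cost B (c : config M) := size (tapes c) * (1000 * B + 1000) + 1000 * B + 1000.

Lemma runs_action m orc s c p B : run_ready m s -> ~~ isq (cstate c) ->
  size (code (table_tree isq qy qn)) + size (code (num (st_idx (cstate c)))) <= B ->
  tapes_le B (tapes c) -> 2 * num_syms (aux_symbol M) <= B ->
  exists2 s', runs (step_cmd m orc) (run_store m s c p) (action_cost B c) s' &
  match choose_act (acts c) p with
  | Taken a p' => s' = run_store m s (act_on c a) p'
  | Refused p' => exists u, size u <= B /\
      s' = upd (upd (upd (upd s rT2 (tapes_code (tapes c) ++ [:: false])) (rW m) u) (rP m) p')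
           rRes [:: (cstate c \in accept M) && nilp (acts c)]
  | Exhausted => exists u g, size u <= B /\
      s' = upd (upd (upd (upd s rT2 (tapes_code (tapes c) ++ [:: false])) (rW m) u) (rP m) [::])
           rF [:: g]
  end.
Proof.
move=> hr hq hB ht hns.
have hst : state_tree isq qy qn (cstate c) = Node (num (cstate c \in accept M).+1)
    (trie (num_syms (aux_symbol M)) (aux_tapes M).+1 (acts_tree (cstate c))).
  by rewrite /state_tree (negbTE hq).
have [w szw h1] := runs_fetch p hr hst hB.
move: h1; set fl := cstate c \in accept M; set U := code (trie _ _ _) ++ w => h1.
case: (hr) => [hTab [hZ [hD [hL [hR [hK [hF [hA [hH [hT2 [hRes [hAns [hW [hT [hC [hS _]]]]]]]]]]]]]]]].
pose st W := upd (upd (upd (upd (upd (upd (upd s (rT m) [::]) rS [::]) (rP m) p) (rC m) [:: true])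
   rF [:: fl]) rT2 (tapes_code (tapes c) ++ [:: false])) (rW m) W.
pose js := [seq sym_idx (scan t) | t <- tapes c].
have szjs : size js = (aux_tapes M).+1 by rewrite size_map /tapes size_map size_enum_ord.
have hjs : all (fun j => j < num_syms (aux_symbol M)) js.
  by rewrite all_map (@eq_all _ _ predT) ?all_predT // => t; apply: sym_idx_lt.
have [|||||w' szw' h2] := @runs_index_all m (upd (st U) rK (flatten [seq code (num j) | j <- js]))
   (num_syms (aux_symbol M)) js (acts_tree (cstate c)) w B.
- by rd.
- by rewrite szjs /st /U; rdall.
- by [].
- by rewrite /st; rd.
- rewrite /st /upd /= ?eqxx; apply: leq_trans szw.
  by rewrite size_cat leq_addl.
rewrite acts_treeE in szw' h2.
set W' := code _ ++ w' in szw' h2.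
have [|||||||s' h3 h4] := @runs_choose_loop m (upd (st W') rH [:: true]) M (acts c) p fl w' B.
- by rewrite /st; rd.
- by rewrite /st; rd.
- by rewrite /st; rd.
- by rewrite /st; rd.
- by rewrite /st; rd.
- by rewrite /st; empties_tac.
- by rewrite /st /upd /= ?eqxx.
have hsc : forall s0 : store reg, s0 (rT m) = tapes_code (rev (tapes c)) ++ [:: false] ->
   empties [:: rL; rZ; rD] s0 ->
   runs (scan_loop m) s0 (size (tapes c) * (200 * B + 100) + 1)
   (upd (upd (upd s0 (rT m) [:: false]) rT2 (tapes_code (tapes c) ++ s0 rT2)) rK
     (flatten [seq code (num j) | j <- js] ++ s0 rK)).
  move=> s0 g1 g2; have := runs_scan_loop g1 g2 (B := B).
  rewrite revK size_rev /js -map_comp; apply.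
  exact: tapes_le_rev.
have h5 N s2 : runs (If rA Skip (perform m) (perform m)) s' N s2 ->
    runs (step_cmd m orc) (run_store m s c p)
      (size (tapes c) * (300 * B + 200) + 400 * B + 300 + N) s2.
  move=> h; eapply runs_conv.
  - eapply runs_seq; first exact: h1.
    eapply runs_if_cons; first by rd.
    eapply runs_seq; first by eapply runs_read_flag; rewrite /run_store; rd.
    eapply runs_seq; first by rewrite /run_store; xstep.
    eapply runs_seq; first by eapply hsc; rewrite /run_store; [rd|empties_tac].
    eapply runs_seq; first by rewrite /run_store; xstep.
    eapply runs_seq; first by apply: runs_start h2; rewrite /st /run_store; store_eq.
    eapply runs_seq; first by rewrite /st /run_store; xstep.
    eapply runs_seq; last exact: h.
    apply: runs_start h3; rewrite /st /run_store; store_eq.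
  - by [].
  - by rewrite /js size_map; lia.
case E: (choose_act (acts c) p) h4 => [a p'|p'|].
- move=> es'; exists (run_store m s (act_on c a) p') => //.
  have haA : s' rA = true :: code (num (st_idx a.1)) ++
      code (lst [seq act_tree (a.2 i) | i <- enum 'I_(aux_tapes M).+1]).
    by rewrite es' upd_eq.
  have hq' : size (code (num (st_idx a.1))) <= B.
    have : code (action_tree a) = true :: code (num (st_idx a.1)) ++
      code (lst [seq act_tree (a.2 i) | i <- enum 'I_(aux_tapes M).+1]) by [].
    have : size (code (action_tree a)) <= B.
      apply: leq_trans szw'; rewrite /W' size_cat; apply: leq_trans (leq_addr _ _).
      exact: size_code_lst (choose_taken E).
    by move=> h e; move: h; rewrite e /= size_cat; lia.
  have [hT2' hT' hP' hE'] : [/\ s' rT2 = tapes_code (tapes c) ++ [:: false], s' (rT m) = [::],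
     s' (rP m) = p' & empties [:: rL; rR; rZ; rD; rS] s'].
    by rewrite es' /st; split; [rd|rd|rd|empties_tac].
  case: hE' => gL [gR [gZ [gD [gS _]]]].
  eapply runs_conv.
  + eapply h5; eapply runs_if_cons; first exact: haA.
    eapply runs_seq; first by xstep.
    eapply runs_seq; first by xstep.
    by eapply (@runs_apply_all m _ c a B); [rd|rd|rd|empties_tac|exact: ht|exact: hns].
  + by rewrite es' /st /run_store; store_eq.
  + by rewrite /action_cost; move: hq'; move: (size (code (num _))) (size (tapes c)) => k K; lia.
- move=> [u szu es']; exists s'; last first.
    by exists u; split=> //; rewrite es' /st; store_eq.
  have hA' : s' rA = [::] by rewrite es' /st; rd.
  eapply runs_conv.
  + by eapply h5; eapply runs_if_nil; [exact: hA'|xstep].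
  + by [].
  + by rewrite /action_cost; lia.
- move=> [u [g [szu es']]]; exists s'; last first.
    by exists u, g; split=> //; rewrite es' /st; store_eq.
  have hA' : s' rA = [::] by rewrite es' /st; rd.
  eapply runs_conv.
  + by eapply h5; eapply runs_if_nil; [exact: hA'|xstep].
  + by [].
  + by rewrite /action_cost; lia.
Qed.

End Step.

(** * Simulation of a whole run *)

Definition run m orc : command :=
  Push (rC m) true ;; While (rC m) top_some (step_cmd m orc) ;;
  clear rT2 ;; clear (rW m) ;; clear rF.

Definition opt_word (o : option bool) : word := if o is Some b then [:: b] else [::].

Section Run.
Variables (M : ntm) (isq : pred (state M)) (qy qn : state M) (orac : word -> bool).
Local Notation qstep := (@qstep M isq qy qn orac).
Local Notation follow := (@follow M isq qy qn orac).

Definition start_store m s (c : config M) (p : word) : store reg :=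
  upd (upd (upd s (rT m) (tapes_code (rev (tapes c)) ++ [:: false]))
    rS (code (num (st_idx (cstate c))))) (rP m) p.

(* The cost bounds are generous: only their growth matters. *)
Definition step_cost B := B * (1000 * B + 1000) + 1000 * B + 1000.

Lemma tapes_code_le (X : finType) B (ts : seq (tape X)) :
  tapes_le B ts -> size (tapes_code ts) <= size ts * B.+1.
Proof.
elim: ts => // t ts IH h; rewrite -[tapes_code _]cats0 tapes_code_cons cats0.
have h1 : size (tape_code t) <= B by apply: h; left.
have h2 : size (tapes_code ts) <= size ts * B.+1 by apply: IH => t' ht; apply: h; right.
by move: h1; rewrite /tape_code /= !size_cat mulSn; lia.
Qed.

Lemma runs_run m orc s n c p B CO : run_ready isq qy qn m s -> halts_within qstep n c ->
  size (code (table_tree isq qy qn)) + (#|state M|).*2.+1 <= B ->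
  2 * num_syms (aux_symbol M) <= B -> (aux_tapes M).+1 <= B ->
  (forall j c', reach qstep j c c' -> tapes_le B (tapes c')) ->
  (forall j c', reach qstep j c c' -> isq (cstate c') ->
    forall s', (forall r, r \notin [:: rT m; rW m; rP m; rC m; rS] -> s' r = s r) ->
    s' rS = [::] -> s' (rT m) = tapes_code (rev (tapes c')) ++ [:: false] ->
    runs orc s' CO (upd s' rAns [:: orac (last_word c')])) ->
  runs (run m orc) (start_store m s c p) (n.+1 * (step_cost B + CO + 1) + 20 * B * B.+1 + 50)
    (upd (upd s (rP m) (follow n.+1 c p).2) rRes (opt_word (follow n.+1 c p).1)).
Proof.
move=> hr hh hB hns hK ht hO.
have szt (c' : config M) : size (tapes c') <= B by rewrite size_map size_enum_ord.
have hB' (c' : config M) : size (code (table_tree isq qy qn)) + size (code (num (st_idx (cstate c')))) <= B.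
  apply: leq_trans hB; rewrite leq_add2l size_num ltnS leq_double.
  by rewrite cardE; apply: index_size.
have hac (c' : config M) : action_cost B c' <= step_cost B.
  by rewrite /action_cost /step_cost !leq_add2r leq_mul2r szt orbT.
(* How the loop ends determines what is left on [rT2], [rW] and [rF]; bounds on these words suffice
   for the cost of the final clearing. *)
suff loop : exists u w f, [/\ size u <= B * B.+1 + 1, size w <= B, size f <= 1 &
  runs (While (rC m) top_some (step_cmd m orc)) (run_store m s c p) (n.+1 * (step_cost B + CO + 1) + 1)
    (upd (upd (upd (upd (upd s rT2 u) (rW m) w) rF f) (rP m) (follow n.+1 c p).2) rRes (opt_word (follow n.+1 c p).1))].
  have [u [w [f [szu szw szf h]]]] := loop.
  case: (hr) => [hTab [hZ [hD [hL [hR [hK' [hF [hA [hH [hT2 [hRes [hAns [hW [hT [hC [hS _]]]]]]]]]]]]]]]].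
  eapply runs_conv.
  - eapply runs_seq; first by rewrite /start_store; xstep.
    by eapply runs_seq; [exact: h|xrun].
  - by store_eq.
  - by lia.
elim: n c p hh ht hO => [|n IH] c p hh ht hO.
- have [hq hacts] := halts0 hh.
  have [s' h1 h2] := runs_action orc p hr (negbT hq) (hB' c) (ht 0 c erefl) hns.
  rewrite /= hq hacts choose_nil /= in h2 *.
  case: h2 => u [szu es']; exists (tapes_code (tapes c) ++ [:: false]), u, [::]; split=> //.
    rewrite size_cat leq_add2r; apply: leq_trans (tapes_code_le (ht 0 c erefl)) _.
    by rewrite leq_mul2r szt orbT.
  case: (hr) => [hTab [hZ [hD [hL [hR [hK' [hF [hA [hH [hT2 [hRes [hAns [hW [hT [hC [hS _]]]]]]]]]]]]]]]].
  eapply runs_conv.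
  + eapply runs_while_nonempty; [by rewrite /run_store; rd|exact: h1|].
    by apply: runs_while_empty; rewrite es'; rd.
  + by rewrite es'; store_eq.
  + by have := hac c; lia.
have hC1 (c' : config M) p' : run_store m s c' p' (rC m) = [:: true] by rewrite /run_store upd_eq.
have next c' p' N : qstep c c' -> follow n.+2 c p = follow n.+1 c' p' ->
    runs (step_cmd m orc) (run_store m s c p) N (run_store m s c' p') -> N <= step_cost B + CO ->
    exists u w f, [/\ size u <= B * B.+1 + 1, size w <= B, size f <= 1 &
    runs (While (rC m) top_some (step_cmd m orc)) (run_store m s c p)
      (n.+2 * (step_cost B + CO + 1) + 1)
      (upd (upd (upd (upd (upd s rT2 u) (rW m) w) rF f) (rP m) (follow n.+2 c p).2) rRes
        (opt_word (follow n.+2 c p).1))].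
  move=> st ef h1 hN; have [||u [w [f [szu szw szf h2]]]] := IH c' p' (halts_next hh st).
  - by move=> j d r; apply: (ht j.+1); exists c'.
  - by move=> j d r; apply: (hO j.+1); exists c'.
  exists u, w, f; split => //; rewrite ef; eapply runs_conv.
  + by eapply runs_while_nonempty; [exact: hC1|exact: h1|exact: h2].
  + by [].
  + by rewrite [n.+2 * _]mulSn; lia.
case: (boolP (isq (cstate c))) => hq.
  apply: (next (answer qy qn orac c) p (CO + 400 * B + 200)).
  - by rewrite /qstep hq.
  - by rewrite [LHS]/= hq.
  - by apply: (runs_query _ hr hq (hB' c)) => s'; apply: (hO 0 c erefl hq).
  - by rewrite /step_cost; lia.
have [s' h1 h2] := runs_action orc p hr hq (hB' c) (ht 0 c erefl) hns.
have stop u w f : size u <= B * B.+1 + 1 -> size w <= B -> size f <= 1 ->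
    s' = upd (upd (upd (upd (upd s rT2 u) (rW m) w) rF f) (rP m) (follow n.+2 c p).2) rRes
        (opt_word (follow n.+2 c p).1) ->
    exists u w f, [/\ size u <= B * B.+1 + 1, size w <= B, size f <= 1 &
    runs (While (rC m) top_some (step_cmd m orc)) (run_store m s c p)
      (n.+2 * (step_cost B + CO + 1) + 1)
      (upd (upd (upd (upd (upd s rT2 u) (rW m) w) rF f) (rP m) (follow n.+2 c p).2) rRes
        (opt_word (follow n.+2 c p).1))].
  move=> szu szw szf es'; exists u, w, f; split=> //.
  case: (hr) => [hTab [hZ [hD [hL [hR [hK' [hF [hA [hH [hT2 [hRes [hAns [hW [hT [hC [hS _]]]]]]]]]]]]]]]].
  eapply runs_conv.
  + eapply runs_while_nonempty; [exact: hC1|exact: h1|].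
    by apply: runs_while_empty; rewrite es'; rd.
  + by [].
  + by have := hac c; rewrite [n.+2 * _]mulSn; lia.
have szT2 : size (tapes_code (tapes c) ++ [:: false]) <= B * B.+1 + 1.
  rewrite size_cat leq_add2r; apply: leq_trans (tapes_code_le (ht 0 c erefl)) _.
  by rewrite leq_mul2r szt orbT.
case: (hr) => [hTab [hZ [hD [hL [hR [hK' [hF [hA [hH [hT2 [hRes [hAns [hW [hT [hC [hS _]]]]]]]]]]]]]]]].
case E: (choose_act (acts c) p) h2 => [a p'|p'|].
- move=> es'; rewrite es' in h1.
  apply: (next _ _ _ _ _ h1).
  + by rewrite /qstep (negbTE hq); apply/stepP; exists a => //; apply: choose_taken E.
  + by rewrite [LHS]/= (negbTE hq) E.
  + by have := hac c; lia.
- move=> [u [szu es']]; apply: (stop _ u [::] szT2 szu isT).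
  by rewrite es' /= (negbTE hq) E; store_eq.
- move=> [u [g [szu es']]]; apply: (stop _ u [:: g] szT2 szu isT).
  by rewrite es' /= (negbTE hq) E; store_eq.
Qed.

End Run.

(** Read backwards, the pushed bits are a list node followed by the code of [num 1] or [num 2], the
    index of the bit. *)
Definition load_bits m : command :=
  Foreach rZ
    (Push (rT m) false ;; Push (rT m) false ;; Push (rT m) true ;; Push (rT m) true)
    (Push (rT m) false ;; Push (rT m) false ;; Push (rT m) true ;;
     Push (rT m) false ;; Push (rT m) true ;; Push (rT m) true).

Lemma runs_load_bits (X : finType) m s w (l : seq (symbol X)) u :
  s rZ = w -> s (rT m) = code (cells l) ++ u ->
  runs (load_bits m) s (30 * size w + 1)
    (upd (upd s rZ [::]) (rT m) (code (cells ([seq Some (inl b) | b <- rev w] ++ l)) ++ u)).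
Proof.
elim: w l s => [|b w IH] l s hZ hT.
  eapply runs_conv; [by apply: runs_foreach_nil| |by []].
  by store_eq.
have hc : code (cells (Some (inl b) :: l)) ++ u =
    true :: code (num b.+1) ++ code (cells l) ++ u by rewrite /= -!catA.
have h1 : runs (if b then Push (rT m) false ;; Push (rT m) false ;; Push (rT m) true ;;
     Push (rT m) false ;; Push (rT m) true ;; Push (rT m) true
   else Push (rT m) false ;; Push (rT m) false ;; Push (rT m) true ;; Push (rT m) true)
   (upd s rZ w) 20 (upd (upd s rZ w) (rT m) (code (cells (Some (inl b) :: l)) ++ u)).
  rewrite hc; case: b {hZ hc} => /=; (eapply runs_conv; [xrun|store_eq|by []]).
eapply runs_conv.
- eapply runs_foreach_cons; [exact: hZ|exact: h1|].
  by eapply (IH (Some (inl b) :: l)); [rd|rewrite upd_eq].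
- rewrite rev_cons map_rcons cat_rcons; by store_eq.
- by rewrite /=; lia.
Qed.

Definition blank_loop m : command :=
  While rX top_true (Pop rX ;; Pop rX ;; Push (rT m) false ;; Push (rT m) false ;; Push (rT m) true).

Lemma runs_blank_loop (X : finType) m s j (ts : seq (tape X)) u :
  s rX = code (num j) -> s (rT m) = tapes_code ts ++ u ->
  runs (blank_loop m) s (20 * j + 1)
    (upd (upd s rX [:: false]) (rT m) (tapes_code (nseq j (blank_tape X) ++ ts) ++ u)).
Proof.
elim: j ts s => [|j IH] ts s hX hT.
  eapply runs_conv; [by eapply runs_while_false; rd| |by []].
  by store_eq.
eapply runs_conv.
- eapply runs_while_true; [rd|xrun|].
  by eapply (IH (blank_tape X :: ts)); [rd|rewrite tapes_code_cons /=; rd].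
- have -> : nseq j (blank_tape X) ++ blank_tape X :: ts = nseq j.+1 (blank_tape X) ++ ts.
    by elim: j {IH hX} => //= j ->.
  by store_eq.
- by lia.
Qed.

Definition init_cmd m : command :=
  pour1 rXI rZ ;; Push (rT m) false ;; Push (rT m) false ;; load_bits m ;;
  Push (rT m) false ;; Push (rT m) true ;; copy_tree (rKN m) rX ;; blank_loop m ;; Pop rX ;;
  copy_tree (rS0 m) rS.

Lemma runs_init_cmd m s (M : ntm) w : s rXI = w ->
  s (rKN m) = code (num (aux_tapes M)) -> s (rS0 m) = code (num (st_idx (start M))) ->
  empties [:: rT m; rZ; rX; rD; rS] s ->
  runs (init_cmd m) s (40 * size w + 100 * aux_tapes M + 40 * size (code (num (st_idx (start M)))) + 200)
    (upd (upd (upd s rXI [::]) (rT m) (tapes_code (rev (tapes (init M w))) ++ [:: false]))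
       rS (code (num (st_idx (start M))))).
Proof.
move=> hXI hKN hS0 [hT [hZ [hX [hD [hS _]]]]].
rewrite tapes_init rev_cons rev_nseq -cats1.
set inp := input_tape _ w.
have h1 := @runs_load_bits (aux_symbol M) m (upd (upd (upd s rXI [::]) rZ (rev w)) (rT m) [:: false; false])
   (rev w) [::] [:: false].
have h2 := @runs_blank_loop (aux_symbol M) m (upd (upd (upd s rXI [::]) (rT m)
   (tapes_code [:: inp] ++ [:: false])) rX (code (num (aux_tapes M)))) (aux_tapes M) [:: inp] [:: false].
rewrite tapes_code_cons /= cats0 revK in h1 h2 *.
eapply runs_conv.
- eapply runs_seq; first by xstep.
  eapply runs_seq; first by xstep.
  eapply runs_seq; first by xstep.
  eapply runs_seq; first by apply: runs_start (h1 _ _); [store_eq|rd|rd].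
  eapply runs_seq; first by xstep.
  eapply runs_seq; first by xstep.
  eapply runs_seq; first by xstep.
  eapply runs_seq; first by apply: runs_start (h2 _ _); [store_eq|rd|rd].
  by xrun.
- by store_eq.
- by rewrite size_rev !size_num; lia.
Qed.

(** The query arrives reversed on [rQ], with its trailing zeros on top, ready to be counted. *)
Definition extract : command :=
  While rX top_true (Pop rX ;; If rX Reject (clear rX) (Pop rX ;; Pop rX ;;
    If rX Reject (Pop rX ;; Push rQ false) (Pop rX ;; Pop rX ;;
      If rX Reject (Pop rX ;; Push rQ true) (clear rX)))).

Lemma runs_extract (X : finType) s (l : seq (symbol X)) v :
  s rX = code (cells l) -> s rQ = v ->
  exists2 e, size e <= 1 &
  runs extract s (30 * size (code (cells l)) + 1)
    (upd (upd s rX e) rQ (rev (bits_prefix l) ++ v)).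
Proof.
elim: l s v => [|x l IH] s v hX hQ.
  exists [:: false] => //.
  eapply runs_conv; [by eapply runs_while_false; rd| |by []].
  by store_eq.
rewrite /cells /= in hX; case: x hX => [[[]|y]|] /= hX.
- have [||e sze h] := IH (upd (upd s rX (code (cells l))) rQ (true :: v)) (true :: v).
  + by rd.
  + by rd.
  exists e => //; eapply runs_conv.
  + by eapply runs_while_true; [rd|xrun|apply: runs_start h; store_eq].
  + by rewrite rev_cons cat_rcons; store_eq.
  + by rewrite /cells /=; lia.
- have [||e sze h] := IH (upd (upd s rX (code (cells l))) rQ (false :: v)) (false :: v).
  + by rd.
  + by rd.
  exists e => //; eapply runs_conv.
  + by eapply runs_while_true; [rd|xrun|apply: runs_start h; store_eq].
  + by rewrite rev_cons cat_rcons; store_eq.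
  + by rewrite /cells /=; lia.
- exists [::] => //; eapply runs_conv.
  + by eapply runs_while_true; [rd|xrun|apply: runs_while_end; rewrite /top; rd].
  + by store_eq.
  + by rewrite /cells /= ?size_cat /= ?size_cat; lia.
- exists [::] => //; eapply runs_conv.
  + by eapply runs_while_true; [rd|xrun|apply: runs_while_end; rewrite /top; rd].
  + by store_eq.
  + by rewrite /cells /= ?size_cat /=; lia.
Qed.

(** * Answering oracle queries *)

Definition count_zeros : command := While rQ top_false (Pop rQ ;; Push rZC true).

Lemma runs_count_zeros s z w v : s rQ = nseq z false ++ w -> ~~ top_false (ohead w) -> s rZC = v ->
  runs count_zeros s (10 * z + 1) (upd (upd s rQ w) rZC (nseq z true ++ v)).
Proof.
elim: z s v => [|z IH] s v hQ hw hZ.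
  eapply runs_conv; [by apply: runs_while_end; rewrite /top hQ| |by []].
  by store_eq.
have hn : nseq z true ++ true :: v = nseq z.+1 true ++ v by elim: z {IH hQ} => //= z ->.
eapply runs_conv.
- eapply runs_while_step; [by rewrite /top hQ|xrun|].
  by eapply (IH _ (true :: v)); [rd|exact: hw|rd].
- by rewrite hn; store_eq.
- by lia.
Qed.

Definition drop_row : command := If rY Skip Skip (Pop rY ;; drop_tree rY).
(** One row is dropped per bit of the padded word, so the row on top is the one of its length;
    meanwhile the word, which was reversed, is put in order on [rXQ]. *)
Definition seek_row : command :=
  Foreach rQ (Push rXQ false ;; drop_row) (Push rXQ true ;; drop_row).

Lemma runs_seek_row s w l v :
  s rQ = w -> s rY = code (lst l) -> s rXQ = v -> s rD = [::] ->
  runs seek_row s (30 * size (code (lst l)) + 30 * size w + 1)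
    (upd (upd (upd s rQ [::]) rY (code (lst (drop (size w) l)))) rXQ (rev w ++ v)).
Proof.
elim: w s l v => [|b w IH] s l v hQ hY hX hD.
  eapply runs_conv; [by apply: runs_foreach_nil| |by lia].
  by rewrite drop0; store_eq.
have hb : (if b then Push rXQ true ;; drop_row else Push rXQ false ;; drop_row) =
    (Push rXQ b ;; drop_row) by case: (b).
case: l hY => [|t l] /= hY.
- eapply runs_conv.
  + eapply runs_foreach_cons; [exact: hQ|rewrite hb /drop_row; xrun|].
    by eapply (IH _ [::] (b :: v)); [rd|rd|rd|rd].
  + by rewrite rev_cons cat_rcons; store_eq.
  + by rewrite /=; lia.
- eapply runs_conv.
  + eapply runs_foreach_cons; [exact: hQ|rewrite hb /drop_row; xrun|].
    by eapply (IH _ l (b :: v)); [rd|rd|rd|rd].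
  + by rewrite rev_cons cat_rcons; store_eq.
  + by rewrite /= size_cat; lia.
Qed.

Definition double_cmd : command :=
  Foreach rU (Push rU2 true ;; Push rU2 true) (Push rU2 true ;; Push rU2 true) ;; pour1 rU2 rU.

Lemma runs_double s u : s rU = nseq u true -> s rU2 = [::] ->
  runs double_cmd s (40 * u + 10) (upd s rU (nseq u.*2 true)).
Proof.
move=> hU hU2.
have loop : forall u s v, s rU = nseq u true -> s rU2 = v ->
   runs (Foreach rU (Push rU2 true ;; Push rU2 true) (Push rU2 true ;; Push rU2 true)) s (10 * u + 1)
    (upd (upd s rU [::]) rU2 (nseq u.*2 true ++ v)).
  elim=> [|u' IH] {hU hU2} s' v hU hU2.
    eapply runs_conv; [by apply: runs_foreach_nil| |by []].
    by store_eq.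
  have hn : nseq u'.*2 true ++ [:: true, true & v] = nseq u'.+1.*2 true ++ v.
    rewrite -[[:: true, true & v]]/(nseq 2 true ++ v) catA -nseqD; congr (nseq _ _ ++ _); lia.
  eapply runs_conv.
  - eapply runs_foreach_cons; [exact: hU|rewrite /=; xrun|].
    by eapply (IH _ [:: true, true & v]); [rd|rd].
  - by rewrite hn; store_eq.
  - by lia.
have h1 := loop u s [::] hU hU2; rewrite cats0 in h1.
eapply runs_conv.
- by eapply runs_seq; [exact: h1|xrun].
- by rewrite rev_nseq; store_eq.
- by rewrite size_nseq; lia.
Qed.

(** Horner's rule in unary. This is affordable because the table entries are capped by a polynomial
    in the parameter. *)
Definition expand : command :=
  While rB top_true (Pop rB ;; double_cmd ;; If rB Reject (Pop rB) (Pop rB ;; Pop rB ;; Pop rB ;; Push rU true)) ;;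
  Pop rB.

Definition row_tree (bl : word) : tree := lst [seq num (b : bool) | b <- bl].

Definition value_from (u : nat) (bl : word) : nat := foldl (fun v (b : bool) => v.*2 + b) u bl.

Lemma value_from_ge u bl : u <= value_from u bl.
Proof. by elim: bl u => //= b l IH u; apply: leq_trans (IH _); lia. Qed.

Lemma runs_expand s u bl V : s rB = code (row_tree bl) -> s rU = nseq u true -> s rU2 = [::] ->
  value_from u bl <= V ->
  runs expand s (size bl * (40 * V + 50) + 5)
    (upd (upd s rB [::]) rU (nseq (value_from u bl) true)).
Proof.
move=> hB hU hU2 hV.
suff loop : runs (While rB top_true (Pop rB ;; double_cmd ;; If rB Reject (Pop rB) (Pop rB ;; Pop rB ;; Pop rB ;; Push rU true)))
    s (size bl * (40 * V + 50) + 1)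
    (upd (upd s rB [:: false]) rU (nseq (value_from u bl) true)).
  eapply runs_conv; [by eapply runs_seq; [exact: loop|xstep]|by store_eq|by lia].
elim: bl s u hB hU hU2 hV => [|b bl IH] s u hB hU hU2 hV.
  eapply runs_conv; [by eapply runs_while_false; rd| |by []].
  by store_eq.
have hu : u <= V by apply: leq_trans hV; apply: value_from_ge (b :: bl).
rewrite /row_tree /= in hB; case: b hB hV => /= hB hV.
- rewrite addn1 in hV *; eapply runs_conv.
  + eapply runs_while_true; [rd| |].
      eapply runs_seq; first by xstep.
      eapply runs_seq; first by eapply runs_double; rd.
      by xrun.
    by eapply (IH _ u.*2.+1); [rd|rd|rd|exact: hV].
  + by store_eq.
  + by rewrite mulSn; lia.
- rewrite addn0 in hV *; eapply runs_conv.
  + eapply runs_while_true; [rd| |].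
      eapply runs_seq; first by xstep.
      eapply runs_seq; first by eapply runs_double; rd.
      by xrun.
    by eapply (IH _ u.*2); [rd|rd|rd|exact: hV].
  + by store_eq.
  + by rewrite mulSn; lia.
Qed.

Definition cmp1 : command := If rZC (Push rMM true) (Pop rZC) (Pop rZC).
Definition compare : command :=
  Foreach rU cmp1 cmp1 ;; If rZC Skip Skip (clear rZC ;; Push rMM true).

Lemma runs_compare s u z : s rU = nseq u true -> s rZC = nseq z true -> s rMM = [::] ->
  exists2 k, (k == 0) = (u == z) & k <= u + z /\
  runs compare s (20 * u + 20 * z + 20) (upd (upd (upd s rU [::]) rZC [::]) rMM (nseq k true)).
Proof.
move=> hU hZ hM; exists (u - z + (u < z)); first by case: ltngtP; lia.
split; first by case: ltnP; lia.
have loop : forall u z s k, s rU = nseq u true -> s rZC = nseq z true -> s rMM = nseq k true ->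
  runs (Foreach rU cmp1 cmp1) s (10 * u + 1)
    (upd (upd (upd s rU [::]) rZC (nseq (z - u) true)) rMM (nseq (u - z + k) true)).
  elim=> [|u' IH] z' {hU hZ hM} s' k hU hZ hM.
    eapply runs_conv; [by apply: runs_foreach_nil| |by []].
    by rewrite subn0; store_eq.
  case: z' hZ => [|z'] hZ.
  - eapply runs_conv.
    + eapply runs_foreach_cons; [exact: hU|rewrite /= /cmp1; xrun|].
      by eapply (IH 0 _ k.+1); [rd|rd|rd].
    + by rewrite !subn0 !sub0n addnS; store_eq.
    + by lia.
  - eapply runs_conv.
    + eapply runs_foreach_cons; [exact: hU|rewrite /= /cmp1; xrun|].
      by eapply (IH z' _ k); [rd|rd|rd].
    + by rewrite !subSS; store_eq.
    + by lia.
have h1 := loop u z s 0 hU hZ hM; rewrite addn0 in h1.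
case: (ltnP u z) => lt.
- have [d ed] : exists d, z - u = d.+1 by exists (z - u).-1; lia.
  have e0 : u - z = 0 by lia.
  rewrite ed e0 in h1; rewrite e0.
  eapply runs_conv.
  + by eapply runs_seq; [exact: h1|xrun].
  + by store_eq.
  + by rewrite /= size_nseq; lia.
- have e0 : z - u = 0 by lia.
  rewrite e0 in h1; rewrite addn0.
  eapply runs_conv.
  + by eapply runs_seq; [exact: h1|xrun].
  + by store_eq.
  + by lia.
Qed.

(** * Depth-first search of the paths of [N] *)

Definition backtrack : command :=
  While rYP top_true (Pop rYP) ;;
  If rYP (Pop rDF ;; Push rAns false) (Pop rYP ;; Push rYP true) Skip.

Fixpoint drop_true (w : word) : word := if w is true :: w' then drop_true w' else w.

Lemma runs_drop_true s w : s rYP = w ->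
  runs (While rYP top_true (Pop rYP)) s (5 * size w + 1) (upd s rYP (drop_true w)).
Proof.
elim: w s => [|[] w IH] s h.
- by eapply runs_conv; [apply: runs_while_end; rewrite /top h|store_eq|].
- eapply runs_conv.
  + by eapply runs_while_true; [exact: h|xstep|eapply IH; rd].
  + by store_eq.
  + by rewrite /=; lia.
- by eapply runs_conv; [apply: runs_while_end; rewrite /top h|store_eq|].
Qed.

(* The store after all extensions of a string have been visited by the
   depth-first traversal of the tree of bit strings; [w] is the reversed string. *)
Definition dfs_next s (w : word) : store reg :=
  match drop_true w with
  | _ :: w' => upd (upd s rYP (true :: w')) rDF [:: true]
  | [::] => upd (upd s rYP [::]) rAns [:: false]
  end.

(** The path is kept last bit first: each [true] on top closes a right subtree, and the first
    [false] below becomes [true], the right sibling. If there is none, the whole tree has been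
    visited. *)
Lemma runs_backtrack s w : s rDF = [::] -> s rAns = [::] ->
  runs backtrack (upd (upd s rYP w) rDF [:: true]) (5 * size w + 20) (dfs_next s w).
Proof.
move=> hDF hA; rewrite /dfs_next /backtrack.
have h1 := runs_drop_true (erefl (upd (upd s rYP w) rDF [:: true] rYP)).
rewrite {1 2}/upd /= in h1; move: h1.
have : ~~ top_true (ohead (drop_true w)) by elim: w => [|[]].
case: (drop_true w) => [|[] w'] //= _ h1.
- eapply runs_conv; [by eapply runs_seq; [exact: h1|xrun]|by store_eq|by rewrite /upd /=; lia].
- eapply runs_conv; [by eapply runs_seq; [exact: h1|xrun]|by store_eq|by rewrite /upd /=; lia].
Qed.

Definition dfs_step : command :=
  copy_all rXQ rXI ;; copy_all rYP rX ;; pour1 rX (rP false) ;; init_cmd false ;;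
  run false Skip ;; clear (rP false) ;;
  If rRes (Push rYP false) (Pop rRes ;; backtrack) (Pop rRes ;; Pop rDF ;; Push rAns true).
Definition dfs_loop : command := While rDF top_some dfs_step.
Definition search : command := Push rDF true ;; dfs_loop ;; clear rXQ ;; clear rYP.

Section Search.
Variables (N : ntm) (q0 : state N) (orac : word -> bool).
Local Notation isq := (fun _ : state N => false).
Local Notation qstepN := (@qstep N isq q0 q0 orac).

Definition outcome n x y := (@follow N isq q0 q0 orac n.+1 (init N x) y).1.

Definition dfs_ready s : Prop :=
  [/\ s (rTab false) = code (table_tree isq q0 q0), s (rKN false) = code (num (aux_tapes N)),
      s (rS0 false) = code (num (st_idx (start N))) &
      empties [:: rZ; rD; rX; rL; rR; rK; rF; rA; rH; rT2; rS; rRes; rAns; rXI; rYP; rDF;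
               rW false; rT false; rC false; rP false] s].

Definition dfs_cost n B Y := n.+1 * (step_cost B + 1) + 20 * B * B.+1 + 400 * B + 200 * Y + 1000.

Lemma runs_dfs_step s n x y B Y : dfs_ready s -> s rXQ = x ->
  halts_within qstepN n (init N x) ->
  size (code (table_tree isq q0 q0)) + (#|state N|).*2.+1 <= B ->
  2 * num_syms (aux_symbol N) <= B -> (aux_tapes N).+1 <= B ->
  (forall j c', reach qstepN j (init N x) c' -> tapes_le B (tapes c')) ->
  size x <= B -> size y <= Y ->
  runs dfs_step (upd (upd s rYP (rev y)) rDF [:: true]) (dfs_cost n B Y)
   (match outcome n x y with
    | None => upd (upd s rYP (rev (rcons y false))) rDF [:: true]
    | Some true => upd (upd s rYP (rev y)) rAns [:: true]
    | Some false => dfs_next s (rev y)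
    end).
Proof.
move=> [hTab hKN hS0 hE] hXQ hh hB hns hK ht hx hy.
case: hE => [hZ [hD [hX [hL [hR [hKK [hF [hA [hH [hT2 [hS [hRes [hAns [hXI [hYP [hDF [hW [hT [hC [hP _]]]]]]]]]]]]]]]]]]]].
set s1 := upd (upd s rYP (rev y)) rDF [:: true].
have hr : run_ready isq q0 q0 false s1 by split; rewrite /s1; [rd|empties_tac].
have h1 := @runs_init_cmd false (upd (upd s1 rXI x) (rP false) y) N x.
have h2 := @runs_run N isq q0 q0 orac false Skip s1 n (init N x) y B 0 hr hh hB hns hK ht.
have {}h2 := h2 (fun j c' _ (h : false) => False_ind _ (Bool.diff_false_true h)).
rewrite /start_store [cstate _]/= in h2.
have szs : size (code (num (st_idx (start N)))) <= B.
  apply: leq_trans hB; rewrite size_num; apply: leq_trans (leq_addl _ _).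
  by rewrite ltnS leq_double cardE; apply: index_size.
have szp := follow_size isq q0 q0 orac n.+1 (init N x) y.
move: szp h2; rewrite /outcome; case: (follow _ _ _ _) => o p' /= szp h2.
(* The amount subtracted from the cost is kept for the final branch, backtracking included. *)
have h3 N' s' : runs (If rRes (Push rYP false) (Pop rRes ;; backtrack)
     (Pop rRes ;; Pop rDF ;; Push rAns true)) (upd s1 rRes (opt_word o)) N' s' ->
   runs dfs_step s1 (dfs_cost n B Y - 7 * Y - 100 + N') s'.
  move=> h; eapply runs_conv.
  - eapply runs_seq; first by rewrite /s1; xstep.
    eapply runs_seq; first by rewrite /s1; xstep.
    eapply runs_seq; first by rewrite /s1; xstep.
    eapply runs_seq.
      apply: runs_start (h1 _ _ _ _); rewrite /s1.
      + by rewrite !cats0 revK; store_eq.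
      + by rd.
      + by rd.
      + by rd.
      + by empties_tac.
    eapply runs_seq; first by apply: runs_start h2; rewrite /s1; store_eq.
    eapply runs_seq; first by rewrite /s1; xstep.
    by apply: runs_start h; rewrite /s1; store_eq.
  - by [].
  - have hp' := szp; rewrite /dfs_cost !cats0 !size_rev; lia.
case: o h3 {h2} => [[]|] h3.
- eapply runs_conv.
  + by eapply h3; rewrite /s1; xrun.
  + by rewrite /s1; store_eq.
  + by rewrite /dfs_cost; lia.
- eapply runs_conv.
  + eapply h3; eapply runs_if_cons; first by rewrite /s1; rd.
    eapply runs_seq; first by rewrite /s1; xstep.
    apply: runs_start (@runs_backtrack s (rev y) hDF hAns); rewrite /s1; store_eq.
  + by [].
  + by rewrite size_rev /dfs_cost; lia.
- eapply runs_conv.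
  + by eapply h3; rewrite /s1; xrun.
  + by rewrite rev_rcons /s1; store_eq.
  + by rewrite /dfs_cost; lia.
Qed.

End Search.

Section Oracle.
Variables (N : ntm) (q0 : state N) (orac0 : word -> bool).
Local Notation isq := (fun _ : state N => false).
Local Notation qstepN := (@qstep N isq q0 q0 orac0).
Local Notation outcomeN := (@outcome N q0 orac0).
Local Notation dfs_ready := (@dfs_ready N q0).

Lemma outcome_cat n x y u b : outcomeN n x y = Some b -> outcomeN n x (y ++ u) = Some b.
Proof.
rewrite /outcome; case F: (follow _ _ _ _) => [o p'] eo.
by rewrite (eo : o = Some b) in F; rewrite (follow_cat u F).
Qed.

Section Dfs.
Variables (n B A : nat).
Hypothesis hB : size (code (table_tree isq q0 q0)) + (#|state N|).*2.+1 <= B.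
Hypothesis hns : 2 * num_syms (aux_symbol N) <= B.
Hypothesis hK : (aux_tapes N).+1 <= B.
Hypothesis hA : forall q t, #|trans (n:=N) q t| <= A.

Local Notation Y := (n.+1 * A).+1.
Local Notation C := (dfs_cost n B Y).+1.

(** Induction on the height [h] of the subtree below [y], which has 2^(h+1) - 1 nodes, each paid
    [C]. Failure is stated in continuation form, reducing the loop to the node after the subtree, so
    that the left and right subtrees chain. *)
Lemma runs_dfs_tree s x : dfs_ready s -> s rXQ = x -> size x <= B ->
  halts_within qstepN n (init N x) ->
  (forall j c', reach qstepN j (init N x) c' -> tapes_le B (tapes c')) ->
  forall h y, size y + h = Y ->
  (exists2 y', (exists u, outcomeN n x (y ++ u) = Some true) /\ size y' <= Y &
     runs dfs_loop (upd (upd s rYP (rev y)) rDF [:: true]) ((2 ^ h.+1 - 1) * C + 1)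
       (upd (upd s rYP (rev y')) rAns [:: true])) \/
  ((forall u, outcomeN n x (y ++ u) <> Some true) /\
   forall M s2, runs dfs_loop (dfs_next s (rev y)) M s2 ->
     runs dfs_loop (upd (upd s rYP (rev y)) rDF [:: true]) ((2 ^ h.+1 - 1) * C + M) s2).
Proof.
move=> hr hXQ hx hh ht; elim=> [|h IH] y hy.
  have hyY : size y <= Y by lia.
  have := runs_dfs_step hr hXQ hh hB hns hK ht hx hyY.
  case E: (outcomeN n x y) => [[]|] h1.
  - left; exists y; first by split=> //; exists [::]; rewrite cats0.
    case: hr => [_ _ _ [hZ [hD [hX [hL [hR [hKK [hF [hAA [hH [hT2 [hS [hRes [hAns [hXI [hYP [hDF _]]]]]]]]]]]]]]]]].
    eapply runs_conv.
    + by eapply runs_while_nonempty; [rd|exact: h1|apply: runs_while_empty; rd].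
    + by [].
    + by rewrite expn1; lia.
  - right; split.
      by move=> u; rewrite (outcome_cat _ E).
    move=> M s2 h2; eapply runs_conv; [by eapply runs_while_nonempty; [rd|exact: h1|exact: h2]|by []|].
    by rewrite expn1; lia.
  (* A path of length [Y] is one bit too long to be undecided, so the search never goes deeper. *)
  - have : size y <= n.+1 * A.
      move: E; rewrite /outcome; case F: (follow _ _ _ _) => [o p'] /= eo.
      by rewrite eo in F; apply: (follow_exhausted hh hA F).
    by lia.
have hyY : size y <= Y by lia.
have e1 : (2 ^ h.+2 - 1) * C = C + 2 * ((2 ^ h.+1 - 1) * C).
  have -> : 2 ^ h.+2 - 1 = 1 + 2 * (2 ^ h.+1 - 1).
    by have := expn_gt0 2 h.+1; rewrite [2 ^ h.+2]expnS; lia.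
  by rewrite mulnDl mul1n mulnA.
rewrite e1; move: ((2 ^ h.+1 - 1) * C) IH {e1} => k IH.
have := runs_dfs_step hr hXQ hh hB hns hK ht hx hyY.
case E: (outcomeN n x y) => [[]|] h1.
- left; exists y; first by split=> //; exists [::]; rewrite cats0.
  case: hr => [_ _ _ [hZ [hD [hX [hL [hR [hKK [hF [hAA [hH [hT2 [hS [hRes [hAns [hXI [hYP [hDF _]]]]]]]]]]]]]]]]].
  eapply runs_conv.
  + by eapply runs_while_nonempty; [rd|exact: h1|apply: runs_while_empty; rd].
  + by [].
  + by lia.
- right; split.
    by move=> u; rewrite (outcome_cat _ E).
  move=> M s2 h2; eapply runs_conv; [by eapply runs_while_nonempty; [rd|exact: h1|exact: h2]|by []|].
  by lia.
case: (IH (rcons y false)); first by rewrite size_rcons; lia.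
  move=> [y' [[u hu] szy'] h2]; left; exists y'.
    by split=> //; exists (false :: u); rewrite -cat_rcons.
  eapply runs_conv; [by eapply runs_while_nonempty; [rd|exact: h1|exact: h2]|by []|by lia].
move=> [n0 c0]; case: (IH (rcons y true)); first by rewrite size_rcons; lia.
  move=> [y' [[u hu] szy'] h2]; left; exists y'.
    by split=> //; exists (true :: u); rewrite -cat_rcons.
  have {}c0 := c0 _ _ (runs_start _ h2).
  eapply runs_conv; [eapply runs_while_nonempty; [rd|exact: h1|apply: c0]|by []|by lia].
  by rewrite /dfs_next !rev_rcons.
move=> [n1 c1]; right; split.
  case=> [|[] u]; first by rewrite cats0 E.
    by rewrite -cat_rcons; apply: n1.
  by rewrite -cat_rcons; apply: n0.
move=> M s2 h2; have {}c1 := c1 M s2 _; have {}c0 := c0 _ _ (runs_start _ (c1 _)).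
eapply runs_conv; [eapply runs_while_nonempty; [rd|exact: h1|apply: c0]|by []|by lia].
  by rewrite /dfs_next !rev_rcons.
by move: h2; rewrite /dfs_next rev_rcons.
Qed.

Lemma runs_dfs s x : dfs_ready s -> s rXQ = x -> size x <= B ->
  halts_within qstepN n (init N x) ->
  (forall j c', reach qstepN j (init N x) c' -> tapes_le B (tapes c')) ->
  runs search s (2 ^ Y.+1 * C + 5 * B + 5 * Y + 20)
    (upd (upd s rXQ [::]) rAns [:: `[< accepts qstepN (@verdict N) (init N x) >]]).
Proof.
move=> hr hXQ hx hh ht.
case: (hr) => [_ _ _ [hZ [hD [hX [hL [hR [hKK [hF [hAA [hH [hT2 [hS [hRes [hAns [hXI [hYP [hDF _]]]]]]]]]]]]]]]]].
have hC : (2 ^ Y.+1 - 1) * C <= 2 ^ Y.+1 * C by rewrite leq_mul2r leq_subr orbT.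
case: (runs_dfs_tree hr hXQ hx hh ht (y := [::]) (h := Y) erefl).
- move=> [y' [[u hu] szy'] h1].
  have -> : `[< accepts qstepN (@verdict N) (init N x) >] = true.
    apply/asboolP; move: hu; rewrite /outcome; case F: (follow _ _ _ _) => [o p'] /= eo.
    by rewrite eo in F; apply: (follow_sound hh F).
  eapply runs_conv.
  + eapply runs_seq; first by xstep.
    eapply runs_seq; first by apply: runs_start h1; store_eq.
    by xrun.
  + by store_eq.
  + by rewrite size_rev; lia.
- move=> [hno c1].
  have -> : `[< accepts qstepN (@verdict N) (init N x) >] = false.
    apply/asboolP => /(follow_complete hh hA) [p [_ hp]].
    by apply: (hno p); rewrite /outcome; have := hp [::]; rewrite cats0 => ->.
  eapply runs_conv.
  + eapply runs_seq; first by xstep.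
    eapply runs_seq.
      apply: runs_start (c1 1 _ (runs_while_empty _ _)); first by store_eq.
      by rewrite /dfs_next /=; rd.
    by rewrite /dfs_next /=; xrun.
  + by store_eq.
  + by rewrite /=; lia.
Qed.

End Dfs.
End Oracle.

Definition lookup : command :=
  copy_tree rGT rY ;; seek_row ;;
  If rY Reject (Pop rY ;; clear rZC ;; clear rXQ ;; Push rAns false)
    (Pop rY ;; move_tree rY rB ;; clear rY ;; expand ;; compare ;;
     If rMM search Skip (clear rMM ;; clear rXQ ;; Push rAns false)).

Definition oracle : command :=
  Pop (rT true) ;; move_tree (rT true) rL ;; copy_tree (rT true) rX ;; move_tree rL (rT true) ;;
  Push (rT true) true ;; extract ;; clear rX ;; count_zeros ;;
  If rQ (clear rZC ;; Push rAns false) Reject (Pop rQ ;; lookup).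

Fixpoint strip (z : nat) (w : word) : option (word * nat) :=
  match w with
  | [::] => None
  | false :: w' => strip z.+1 w'
  | true :: w' => Some (rev w', z)
  end.
Definition unpad (q : word) : option (word * nat) := strip 0 (rev q).

Lemma strip_rev z w : match strip z w with
  | Some (x, z') => z <= z' /\ w = nseq (z' - z) false ++ true :: rev x
  | None => w = nseq (size w) false end.
Proof.
elim: w z => [|[] w IH] z //=; first by rewrite subnn revK.
have := IH z.+1; case: strip => [[x z'] [le ->]|{1}->] //.
split; first exact: ltnW.
by rewrite -(subnSK le).
Qed.

Section OracleSpec.
Variables (N : ntm) (q0 : state N) (orac0 : word -> bool) (tbl : seq word).
Local Notation isq := (fun _ : state N => false).
Local Notation qstepN := (@qstep N isq q0 q0 orac0).
Local Notation dfs_ready := (@dfs_ready N q0).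
Local Notation acc x := `[< accepts qstepN (@verdict N) (init N x) >].

(** The answer that the program computes. It agrees with membership in [pad g A] on the queries that
    [M] has the time to write, see [oracle_answerE]. *)
Definition oracle_answer (q : word) : bool :=
  if unpad q is Some (x, z)
  then [&& size x < size tbl, binary_value (nth [::] tbl (size x)) == z & acc x] else false.

Definition oracle_ready s : Prop :=
  [/\ dfs_ready s, s rGT = code (lst [seq row_tree bl | bl <- tbl]) &
      empties [:: rQ; rZC; rY; rB; rU; rU2; rMM; rXQ] s].

Variables (n B A G V : nat).
Hypothesis hB : size (code (table_tree isq q0 q0)) + (#|state N|).*2.+1 <= B.
Hypothesis hns : 2 * num_syms (aux_symbol N) <= B.
Hypothesis hK : (aux_tapes N).+1 <= B.
Hypothesis hA : forall q t, #|trans (n:=N) q t| <= A.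
Hypothesis hG : size (code (lst [seq row_tree bl | bl <- tbl])) <= G.
Hypothesis hV : forall i, i < size tbl -> binary_value (nth [::] tbl i) <= V.
Hypothesis hx : forall x, size x < size tbl -> [/\ size x <= B, halts_within qstepN n (init N x) &
  forall j c', reach qstepN j (init N x) c' -> tapes_le B (tapes c')].

Local Notation Y := (n.+1 * A).+1.
(** The power of 2 here is the only exponential term of all the costs. *)
Definition search_cost := 2 ^ Y.+1 * (dfs_cost n B Y).+1 + 5 * B + 5 * Y + 20.
Definition lookup_cost L := G * (40 * V + 50) + 200 * G + 100 * V + 100 * L + search_cost + 300.

Lemma size_row bl : size bl <= size (code (row_tree bl)).
Proof.
rewrite /row_tree; elim: bl => //= b bl IH; rewrite size_cat size_num.
by move: IH; lia.
Qed.

Lemma size_code_nth l i : i < size l -> size (code (nth Leaf l i)) <= size (code (lst l)).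
Proof.
elim: l i => // a l IH [|i] /=; rewrite size_cat; first by lia.
by rewrite ltnS => /IH; lia.
Qed.

Lemma size_code_drop l i : size (code (lst (drop i l))) <= size (code (lst l)).
Proof.
elim: l i => // a l IH [|i] //=; rewrite size_cat.
by have := IH i; lia.
Qed.

Lemma runs_lookup s x z : oracle_ready s ->
  runs lookup (upd (upd s rQ (rev x)) rZC (nseq z true)) (lookup_cost (size x + z))
    (upd s rAns [:: [&& size x < size tbl, binary_value (nth [::] tbl (size x)) == z & acc x]]).
Proof.
move=> [hr hGT [hQ [hZC [hY [hBB [hU [hU2 [hMM [hXQ _]]]]]]]]].
case: (hr) => [_ _ _ [hZ [hD [hX [hL [hR [hKK [hF [hAA [hH [hT2 [hS [hRes [hAns [hXI [hYP [hDF _]]]]]]]]]]]]]]]]].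
set rows := [seq row_tree bl | bl <- tbl] in hGT.
have hG' : size (code (lst rows)) <= G := hG.
have szr : size rows = size tbl by rewrite size_map.
case: (ltnP (size x) (size tbl)) => lt; last first.
  eapply runs_conv.
  - eapply runs_seq; first by xstep.
    eapply runs_seq.
      by eapply (@runs_seek_row _ (rev x) rows); rd.
    rewrite size_rev drop_oversize ?szr //; by xrun.
  - by store_eq.
  - by rewrite /lookup_cost /search_cost /= !size_rev size_nseq ?cats0 ?revK; move: hG'; lia.
have lt' : size x < size rows by rewrite szr.
have hn : nth Leaf rows (size x) = row_tree (nth [::] tbl (size x)).
  by rewrite (nth_map [::]).
set bl := nth [::] tbl (size x) in hn *.
have szb : size bl <= G.
  by apply: leq_trans (size_row _) _; rewrite -hn; apply: leq_trans (size_code_nth lt') _.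
have hval : value_from 0 bl <= V by apply: hV.
have szd := size_code_drop rows (size x).+1.
have szn := size_code_nth lt'.
rewrite hn in szn.
have pre s1 : s1 = upd (upd (upd s rXQ x) rU (nseq (binary_value bl) true)) rZC (nseq z true) ->
  forall N' s', runs (compare ;; If rMM search Skip (clear rMM ;; clear rXQ ;; Push rAns false)) s1 N' s' ->
  runs lookup (upd (upd s rQ (rev x)) rZC (nseq z true))
    (G * (40 * V + 50) + 150 * G + 30 * size x + 100 + N') s'.
  move=> -> N' s' h; eapply runs_conv.
  - eapply runs_seq; first by xstep.
    eapply runs_seq.
      by eapply (@runs_seek_row _ (rev x) rows); rd.
    rewrite size_rev (drop_nth Leaf lt') hn /=.
    eapply runs_if_cons; first by rd.
    eapply runs_seq; first by xstep.
    eapply runs_seq; first by xstep.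
    eapply runs_seq; first by xstep.
    eapply runs_seq.
      by eapply (@runs_expand _ 0 bl V); [rd|rd|rd|exact: hval].
    by apply: runs_start h; rewrite revK ?cats0; store_eq.
  - by [].
  - have hm : size bl * (40 * V + 50) <= G * (40 * V + 50) by rewrite leq_mul2r szb orbT.
    by rewrite /= ?size_rev; move: hG' szn szd; lia.
have [|||k hk [lek h1]] := @runs_compare (upd (upd (upd s rXQ x) rU (nseq (binary_value bl) true)) rZC (nseq z true))
   (binary_value bl) z.
- by rd.
- by rd.
- by rd.
rewrite -/(value_from 0 bl) in h1 hk lek *.
have [szx hh ht] := hx lt.
case: k hk lek h1 => [|k] /= hk lek h1.
- rewrite -hk /=; eapply runs_conv.
  + eapply pre; first by [].
    eapply runs_seq; first exact: h1.
    eapply runs_if_nil; first by rd.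
    apply: runs_start (@runs_dfs N q0 orac0 n B A hB hns hK hA (upd s rXQ x) x _ _ szx hh ht).
    + by store_eq.
    + case: (hr) => g1 g2 g3 _; split; [by rd|by rd|by rd|empties_tac].
      all: try by case: (hr) => _ _ _ hE; exact: (empties_in hE).
    + by rd.
  + by store_eq.
  + by rewrite /lookup_cost /search_cost; lia.
- rewrite -hk /=; eapply runs_conv.
  + eapply pre; first by [].
    by eapply runs_seq; [exact: h1|xrun].
  + by store_eq.
  + have hval' : binary_value bl <= V := hval; have lek' : k < binary_value bl + z := lek.
    by rewrite /lookup_cost /search_cost /= size_nseq; lia.
Qed.

End OracleSpec.

Lemma rev_tapes (M : ntm) (c : config M) :
  exists ts, rev (tapes c) = ctapes c ord_max :: ts.
Proof. by rewrite /tapes enum_ordSr map_rcons rev_rcons; eexists. Qed.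

Lemma size_bits_prefix (X : finType) (l : seq (symbol X)) : size (bits_prefix l) <= size (code (cells l)).
Proof.
elim: l => // x l IH; rewrite /cells /= size_cat.
by case: x => [[b|y]|] //=; move: IH; rewrite /cells /=; lia.
Qed.

Section Simulation.
Variables (M : ntm) (isqM : pred (state M)) (qy qn : state M).
Variables (N : ntm) (q0 : state N) (orac0 : word -> bool) (tbl : seq word).
Local Notation isq := (fun _ : state N => false).
Local Notation qstepN := (@qstep N isq q0 q0 orac0).
Local Notation orac := (@oracle_answer N q0 orac0 tbl).
Local Notation oracle_ready := (@oracle_ready N q0 tbl).
Local Notation qstepM := (@qstep M isqM qy qn orac).
Local Notation followM := (@follow M isqM qy qn orac).

Variables (n B A G V : nat).
Hypothesis hB : size (code (table_tree isq q0 q0)) + (#|state N|).*2.+1 <= B.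
Hypothesis hns : 2 * num_syms (aux_symbol N) <= B.
Hypothesis hK : (aux_tapes N).+1 <= B.
Hypothesis hA : forall q t, #|trans (n:=N) q t| <= A.
Hypothesis hG : size (code (lst [seq row_tree bl | bl <- tbl])) <= G.
Hypothesis hV : forall i, i < size tbl -> binary_value (nth [::] tbl i) <= V.
Hypothesis hx : forall x, size x < size tbl -> [/\ size x <= B, halts_within qstepN n (init N x) &
  forall j c', reach qstepN j (init N x) c' -> tapes_le B (tapes c')].

Local Notation lookup_costN L := (lookup_cost n B A G V L).
Definition oracle_cost L := lookup_costN L + 200 * L + 100.

Lemma lookup_cost_le L L' : L <= L' -> lookup_costN L <= lookup_costN L'.
Proof. by move=> le; rewrite /lookup_cost; move: (search_cost _ _ _) => k; lia. Qed.

Lemma runs_oracle s (c : config M) L : oracle_ready s ->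
  s (rT true) = tapes_code (rev (tapes c)) ++ [:: false] -> tapes_le L (tapes c) ->
  runs oracle s (oracle_cost L) (upd s rAns [:: orac (last_word c)]).
Proof.
move=> hr hT hL; case: (rev_tapes c) => ts ets.
have hl : size (tape_code (ctapes c ord_max)) <= L.
  apply: hL; apply: List.in_map.
  by elim: (enum _) (mem_enum 'I_(aux_tapes M).+1 ord_max) => //= a l IH; rewrite inE => /orP[/eqP->|/IH]; [left|right].
move: hl hT; rewrite ets tapes_code_cons /last_word /tape_word.
case: (ctapes c ord_max) => l r /=; rewrite /tape_code size_cat /= => hl hT.
case: (hr) => hd hGT [hQ [hZC [hY [hBB [hU [hU2 [hMM [hXQ _]]]]]]]].
case: (hd) => _ _ _ [hZ [hD [hX [hLL [hR [hKK [hF [hAA [hH [hT2 [hS [hRes [hAns [hXI [hYP [hDF _]]]]]]]]]]]]]]]].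
have szq := size_bits_prefix r; set q := bits_prefix r in szq *.
have [||e sze h1] := @runs_extract _ (upd s rX (code (cells r))) r [::].
- by rd.
- by rd.
rewrite cats0 -/q in h1.
have pre N' s' : runs (count_zeros ;; If rQ (clear rZC ;; Push rAns false) Reject (Pop rQ ;; lookup))
     (upd s rQ (rev q)) N' s' -> runs oracle s (140 * L + 50 + N') s'.
  move=> h; eapply runs_conv.
  - eapply runs_seq; first by xstep.
    eapply runs_seq; first by xstep.
    eapply runs_seq; first by xstep.
    eapply runs_seq; first by xstep.
    eapply runs_seq; first by xstep.
    eapply runs_seq; first by apply: runs_start h1; store_eq.
    eapply runs_seq; first by xstep.
    by apply: runs_start h; store_eq.
  - by [].
  - by move: hl sze; rewrite /=; lia.
have := strip_rev 0 (rev q); rewrite -/(unpad q) /oracle_answer.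
case: (unpad q) => [[x z] [_ eq]|eq].
- rewrite subn0 in eq.
  have szx : size x + z < L.
    have := congr1 size eq; rewrite size_cat size_nseq /= !size_rev; lia.
  have hz : runs count_zeros (upd s rQ (rev q)) (10 * z + 1)
      (upd (upd (upd s rQ (rev q)) rQ (true :: rev x)) rZC (nseq z true ++ [::])).
    by apply: runs_count_zeros; [rewrite upd_eq|by []|rewrite upd_ne].
  clear eq ets; eapply runs_conv.
  + eapply pre; eapply runs_seq; first exact: hz.
    eapply runs_if_cons; first by rd.
    eapply runs_seq; first by xstep.
    by apply: runs_start (runs_lookup hB hns hK hA hG hV hx x z hr); rewrite ?cats0; store_eq.
  + by [].
  + have := lookup_cost_le (ltnW szx); rewrite /oracle_cost; move: (lookup_costN _) (lookup_costN _) => k k'; lia.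
- have szz : size (rev q) <= L by rewrite size_rev; lia.
  have hz : runs count_zeros (upd s rQ (rev q)) (10 * size (rev q) + 1)
      (upd (upd (upd s rQ (rev q)) rQ [::]) rZC (nseq (size (rev q)) true ++ [::])).
    by apply: runs_count_zeros; [rewrite upd_eq cats0|by []|rewrite upd_ne].
  clear eq ets; eapply runs_conv.
  + eapply pre; eapply runs_seq; first exact: hz.
    by xrun.
  + by store_eq.
  + by rewrite /oracle_cost cats0 size_nseq; lia.
Qed.

Definition machine_ready s : Prop :=
  [/\ run_ready isqM qy qn true s, oracle_ready s, s (rKN true) = code (num (aux_tapes M)),
      s (rS0 true) = code (num (st_idx (start M))) & s (rP true) = [::]].

Definition simulate_cost t B' u :=
  t.+1 * (step_cost B' + oracle_cost B' + 1) + 20 * B' * B'.+1 + 40 * u + 200 * B' + 300.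

Lemma runs_simulate s u p t B' : machine_ready s ->
  halts_within qstepM t (init M u) ->
  size (code (table_tree isqM qy qn)) + (#|state M|).*2.+1 <= B' ->
  2 * num_syms (aux_symbol M) <= B' -> (aux_tapes M).+1 <= B' ->
  (forall j c', reach qstepM j (init M u) c' -> tapes_le B' (tapes c')) ->
  runs (init_cmd true ;; run true oracle) (upd (upd s rXI u) (rP true) p)
    (simulate_cost t B' (size u))
    (upd (upd s (rP true) (followM t.+1 (init M u) p).2) rRes (opt_word (followM t.+1 (init M u) p).1)).
Proof.
move=> [hr ho hKN hS0 hP] hh h1 h2 h3 ht.
have hXI : s rXI = [::] by case: ho => -[_ _ _ hE] _ _; apply: (empties_in hE).
case: (hr) => [hTab [hZ [hD [hL [hR [hKK [hF [hAA [hH [hT2 [hRes [hAns [hW [hT [hC [hS _]]]]]]]]]]]]]]]].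
have hX : s rX = [::] by case: ho => -[_ _ _ hE] _ _; apply: (empties_in hE).
have hi := @runs_init_cmd true (upd (upd s rXI u) (rP true) p) M u.
have hrun := @runs_run M isqM qy qn orac true oracle s t (init M u) p B' (oracle_cost B') hr hh h1 h2 h3 ht.
have szs : size (code (num (st_idx (start M)))) <= B'.
  apply: leq_trans h1; rewrite size_num; apply: leq_trans (leq_addl _ _).
  by rewrite ltnS leq_double cardE; apply: index_size.
eapply runs_conv.
- eapply runs_seq; first by apply: hi; [rd|rd|rd|empties_tac].
  apply: runs_start (hrun _); first by rewrite /start_store /=; store_eq.
  move=> j c' hreach _ s' hs' hS' hT'; apply: runs_oracle hT' (ht _ _ hreach).
  case: ho => -[g1 g2 g3 hE1] g4 hE2.
  split; [split|by rewrite hs'|].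
  + by rewrite hs'.
  + by rewrite hs'.
  + by rewrite hs'.
  + by rewrite /= hS' !hs' //; move: hE1 => /=; do !case=> ?; move=> *; do !split.
  + by rewrite /= !hs'.
- by [].
- by rewrite /simulate_cost; move: (oracle_cost _) => k; lia.
Qed.

End Simulation.

(** * The diagonal language *)

Definition unpack m : command :=
  Pop rX ;; move_tree rX (rKN m) ;; Pop rX ;; move_tree rX (rS0 m) ;; move_tree rX (rTab m).
(** The input was loaded reversed, and pouring it restores its order. Since [code] is
    self-delimiting, moving one tree splits it into the advice and the path. *)
Definition setup : command :=
  pour1 rIn rV ;; move_tree rV rE ;; copy_tree rE rX ;;
  Pop rX ;; unpack true ;; Pop rX ;; unpack false ;; Pop rX ;; move_tree rX rGT ;; clear rX.
Definition check : command :=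
  copy_all rE rXI ;; copy_all rV (rP true) ;; (init_cmd true ;; run true oracle) ;; clear (rP true).
Definition simulate (b : bool) : command :=
  Push rXI b ;; copy_all rV rXI ;; copy_all rE rXI ;; (init_cmd true ;; run true oracle).
(** One guessed string serves both simulations: the second starts where the first stopped reading,
    on what is left in [rP true]. *)
Definition main : command :=
  setup ;; check ;;
  If rRes
    (move_all rG (rP true) ;; simulate false ;;
     If rRes Skip Skip (Pop rRes ;; simulate true ;; If rRes Skip Skip (Push rAcc true)))
    (Pop rRes ;; Push rAcc true)
    Skip.
(** All guessing comes first, so that [main] is deterministic and specified by [runs]. *)
Definition program : command := Guess rG ;; main ;; If rAcc Reject Skip Skip.

Lemma guess_sound (r : reg) k s n z : reach (@astep reg) n ((None, Guess r :: k), s) ((None, [::]), z) ->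
  exists w n', reach (@astep reg) n' ((None, k), upd s r (w ++ s r)) ((None, [::]), z).
Proof.
elim/ltn_ind: n s => -[|n] IH s /=; first by case.
move=> [[y s1] [o /= hin es] h]; move: hin; rewrite /instr !inE.
case/or3P => /eqP[eo ey]; rewrite eo ey in es h.
- by exists [::], n; rewrite /= upd_id; rewrite es in h.
- case: n IH h => [|n] IH /=; first by case.
  move=> [[y1 s2] [o1 /= hin1 es1] h1]; move: hin1; rewrite /instr inE => /eqP[eo1 ey1].
  rewrite eo1 ey1 in es1 h1; have [|w [n' h2]] := IH n _ s2 h1; first exact: ltnW.
  exists (rcons w false), n'; rewrite cat_rcons.
  by move: h2; rewrite es1 /= es /= upd_upd upd_eq.
- case: n IH h => [|n] IH /=; first by case.
  move=> [[y1 s2] [o1 /= hin1 es1] h1]; move: hin1; rewrite /instr inE => /eqP[eo1 ey1].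
  rewrite eo1 ey1 in es1 h1; have [|w [n' h2]] := IH n _ s2 h1; first exact: ltnW.
  exists (rcons w true), n'; rewrite cat_rcons.
  by move: h2; rewrite es1 /= es /= upd_upd upd_eq.
Qed.

Lemma guess_complete (r : reg) k s w :
  reach (@astep reg) (2 * size w).+1 ((None, Guess r :: k), s) ((None, k), upd s r (w ++ s r)).
Proof.
elim/last_ind: w s => [|w b IH] s.
  exists ((None, k), s); last by rewrite /= upd_id.
  by exists Nop => //; rewrite /instr inE eqxx.
rewrite size_rcons mulnS; exists ((Some (r, b), Guess r :: k), s).
  by exists (GoRight r) => //; rewrite /instr !inE; case: b; rewrite eqxx ?orbT.
exists ((None, Guess r :: k), upd s r (b :: s r)).
  by exists (Write r b) => //; rewrite /instr inE eqxx.
have := IH (upd s r (b :: s r)); rewrite upd_upd upd_eq cat_rcons; exact.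
Qed.

Lemma final_halt s : forall u, ~ astep ((None, [::]), s) u.
Proof. by move=> [y s'] [o]. Qed.

Definition entry (v g : word) : store reg := upd (store0 rIn v) rG g.

(** Were [rAcc] empty after [main], the accepting run would be forced into [Reject], which is
    stuck. *)
Lemma program_sound v : mlang rIn program v ->
  exists g, forall n s', runs main (entry v g) n s' -> s' rAcc <> [::].
Proof.
move=> /mlang_sound [m [z]]; case: m => [|m] //= [[y s1] [o /= hin es] h].
move: hin; rewrite /instr inE => /eqP[eo ey]; rewrite eo ey /= in es h.
have [g [n1 h1]] := guess_sound h; exists g => n s' hr e.
move: h1; rewrite es (_ : store0 rIn v rG = [::]) // cats0 -/(entry v g) => h1.
have [N rN] : exists N, reach (@dstep reg) N ((None, [:: main ;; If rAcc Reject Skip Skip]), entry v g)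
    ((None, [:: Reject]), s').
  case: (hr [:: If rAcc Reject Skip Skip]) => k _ r1.
  exists (1 + (k + 1)); apply: (reach_cat (reach1 _)); last first.
    by apply: (reach_cat r1); apply: reach1; exists Nop => //; rewrite /instr /= /top e.
  by exists Nop.
case: (dreach_det rN h1 (@final_halt z)) => -[|n'] //=.
by case=> [[y' s2] [o']].
Qed.

Lemma program_complete v g n s' : runs main (entry v g) n s' -> s' rAcc <> [::] ->
  2 * size g + n + 10 < 2 ^ size v -> mlang rIn program v.
Proof.
move=> hr hA hlt; case: (hr [:: If rAcc Reject Skip Skip]) => k le r1.
have r2 : reach (@dstep reg) 2 ((None, [:: If rAcc Reject Skip Skip]), s') ((None, [::]), s').
  exists ((None, [:: Skip]), s'); last by apply: reach1; exists Nop.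
  by exists Nop => //; rewrite /instr /= /top; case: (s' rAcc) hA => [|[] l].
have r3 : reach (@dstep reg) 1 ((None, [:: main ;; If rAcc Reject Skip Skip]), entry v g)
   ((None, [:: main; If rAcc Reject Skip Skip]), entry v g) by apply: reach1; exists Nop.
have r4 := dreach_areach (reach_cat r3 (reach_cat r1 r2)).
have r5 := @guess_complete rG [:: main ;; If rAcc Reject Skip Skip] (store0 rIn v) g.
rewrite (_ : store0 rIn v rG = [::]) // cats0 -/(entry v g) in r5.
have r6 : reach (@astep reg) 1 ((None, [:: program]), store0 rIn v)
   ((None, [:: Guess rG; main ;; If rAcc Reject Skip Skip]), store0 rIn v).
  by apply: reach1; exists Nop => //; rewrite /instr inE eqxx.
apply: mlang_complete (reach_cat r6 (reach_cat r5 r4)).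
by apply: leq_ltn_trans hlt; lia.
Qed.

Section Setup.
Variables (kM sM tM kN sN tN tG pad : tree).
Definition input_tree : tree :=
  Node (Node kM (Node sM tM)) (Node (Node kN (Node sN tN)) (Node tG pad)).

Definition loaded (w g : word) : store reg := fun r =>
  match r with
  | rKN true => code kM | rS0 true => code sM | rTab true => code tM
  | rKN false => code kN | rS0 false => code sN | rTab false => code tN
  | rGT => code tG | rE => code input_tree | rV => w | rG => g
  | _ => [::]
  end.

Lemma runs_setup w g :
  runs setup (entry (code input_tree ++ w) g) (300 * size (code input_tree) + 20 * size w + 100)
    (loaded w g).
Proof.
rewrite /entry /store0 /setup.
have h : runs setup (upd (upd (fun=> [::]) rIn (rev (code input_tree ++ w))) rG g)
  (10 * (size (code input_tree) + size w) + 40 * size (code input_tree) + 40 * size (code input_tree) +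
   40 * size (code input_tree) + 10 * size (code input_tree) + 50) (loaded w g).
  eapply runs_conv.
  - eapply runs_seq; first by xstep.
    rewrite revK cats0.
    eapply runs_seq; first by eapply (@runs_move_tree_at _ _ _ input_tree w); [done|done|done|rd|rd|rd|rdv].
    eapply runs_seq; first by eapply (@runs_copy_tree_at _ _ _ input_tree [::]); [done|done|done|rd|rd|rd|rdv].
    rewrite /input_tree /unpack; xrun.
  - by store_eq.
  - by rewrite !size_rev; do 6 rewrite /= ?size_cat; lia.
by apply: runs_le h _; lia.
Qed.

End Setup.

Section Spec.
Variables (M : ntm) (isqM : pred (state M)) (qy qn : state M).
Variables (N : ntm) (q0 : state N) (orac0 : word -> bool) (tbl : seq word) (pad : tree).
Local Notation isq := (fun _ : state N => false).
Local Notation qstepN := (@qstep N isq q0 q0 orac0).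
Local Notation orac := (@oracle_answer N q0 orac0 tbl).
Local Notation qstepM := (@qstep M isqM qy qn orac).
Local Notation followM := (@follow M isqM qy qn orac).

Definition advice_tree : tree := input_tree
  (num (aux_tapes M)) (num (st_idx (start M))) (table_tree isqM qy qn)
  (num (aux_tapes N)) (num (st_idx (start N))) (table_tree isq q0 q0)
  (lst [seq row_tree bl | bl <- tbl]) pad.
Local Notation advice := (code advice_tree).
Local Notation base w g := (loaded
  (num (aux_tapes M)) (num (st_idx (start M))) (table_tree isqM qy qn)
  (num (aux_tapes N)) (num (st_idx (start N))) (table_tree isq q0 q0)
  (lst [seq row_tree bl | bl <- tbl]) pad w g).

Lemma base_ready w g : @machine_ready M isqM qy qn N q0 tbl (base w g).
Proof. by do !split. Qed.

Variables (n B A G V : nat).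
Hypothesis hB : size (code (table_tree isq q0 q0)) + (#|state N|).*2.+1 <= B.
Hypothesis hns : 2 * num_syms (aux_symbol N) <= B.
Hypothesis hK : (aux_tapes N).+1 <= B.
Hypothesis hA : forall q t, #|trans (n:=N) q t| <= A.
Hypothesis hG : size (code (lst [seq row_tree bl | bl <- tbl])) <= G.
Hypothesis hV : forall i, i < size tbl -> binary_value (nth [::] tbl i) <= V.
Hypothesis hx : forall x, size x < size tbl -> [/\ size x <= B, halts_within qstepN n (init N x) &
  forall j c', reach qstepN j (init N x) c' -> tapes_le B (tapes c')].

Variables (t B' A' : nat).
Hypothesis hB' : size (code (table_tree isqM qy qn)) + (#|state M|).*2.+1 <= B'.
Hypothesis hns' : 2 * num_syms (aux_symbol M) <= B'.
Hypothesis hK' : (aux_tapes M).+1 <= B'.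
Hypothesis hA' : forall q f, #|trans (n:=M) q f| <= A'.

Definition good (u : word) : Prop := halts_within qstepM t (init M u) /\
  forall j c', reach qstepM j (init M u) c' -> tapes_le B' (tapes c').

Local Notation sim_cost u := (simulate_cost n B A G V t B' u).

Definition accepted (w g : word) : bool :=
  match (followM t.+1 (init M advice) w).1 with
  | Some b => ~~ b
  | None =>
    let r := followM t.+1 (init M (advice ++ w ++ [:: false])) g in
    if r.1 is Some true then (followM t.+1 (init M (advice ++ w ++ [:: true])) r.2).1 == Some true
    else false
  end.

Definition main_cost L g := 3 * sim_cost L + 600 * L + 50 * g + 600.

Lemma simulate_cost_le L L' : L <= L' -> sim_cost L <= sim_cost L'.
Proof. by move=> le; rewrite /simulate_cost; lia. Qed.

Lemma ready_empties s : @machine_ready M isqM qy qn N q0 tbl s ->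
  empties [:: rZ; rD; rX; rXI; rRes; rP true] s.
Proof.
by case=> -[_ [hZ [hD [hL [hR [hKK [hF [hAA [hH [hT2 [hRes _]]]]]]]]]]] [[_ _ _ hE] _ _] _ _ hP;
  do !split => //; apply: (empties_in hE).
Qed.

Lemma runs_check s adv w : @machine_ready M isqM qy qn N q0 tbl s -> s rE = adv -> s rV = w ->
  good adv ->
  runs check s (sim_cost (size adv) + 30 * size adv + 30 * size w + 20)
    (upd s rRes (opt_word (followM t.+1 (init M adv) w).1)).
Proof.
move=> hs hE hV' [h0 t0]; have [hZ [hD [hX [hXI [hRes [hP _]]]]]] := ready_empties hs.
have := @runs_simulate M isqM qy qn N q0 orac0 tbl n B A G V hB hns hK hA hG hV hx s adv w t B' hs
  h0 hB' hns' hK' t0.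
have := follow_size isqM qy qn orac t.+1 (init M adv) w.
move: (sim_cost _) => C; case: (followM _ _ _) => o p /= szp h.
eapply runs_conv.
- eapply runs_seq; first by xstep.
  eapply runs_seq; first by xstep.
  eapply runs_seq; first by apply: runs_start h; store_eq.
  by xstep.
- by store_eq.
- by lia.
Qed.

Lemma runs_sim b s p adv w : @machine_ready M isqM qy qn N q0 tbl s -> s rE = adv -> s rV = w ->
  good (adv ++ w ++ [:: b]) ->
  let r := followM t.+1 (init M (adv ++ w ++ [:: b])) p in
  runs (simulate b) (upd s (rP true) p)
    (sim_cost (size (adv ++ w ++ [:: b])) + 30 * size adv + 30 * size w + 20)
    (upd (upd s (rP true) r.2) rRes (opt_word r.1)).
Proof.
move=> hs hE hV' [h0 t0]; have [hZ [hD [hX [hXI [hRes [hP _]]]]]] := ready_empties hs.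
have := @runs_simulate M isqM qy qn N q0 orac0 tbl n B A G V hB hns hK hA hG hV hx s
  (adv ++ w ++ [:: b]) p t B' hs h0 hB' hns' hK' t0.
move: (sim_cost _) => C; case: (followM _ _ _) => o p' /= h.
eapply runs_conv.
- eapply runs_seq; first by xstep.
  eapply runs_seq; first by xstep.
  eapply runs_seq; first by xstep.
  by apply: runs_start h; store_eq.
- by [].
- by lia.
Qed.

Lemma runs_main w g L : good advice ->
  good (advice ++ w ++ [:: false]) -> good (advice ++ w ++ [:: true]) ->
  size advice + size w + 1 <= L ->
  exists2 s', runs main (entry (advice ++ w) g) (main_cost L (size g)) s' &
    (s' rAcc <> [::]) <-> accepted w g.
Proof.
move=> g0 g1 g2 hL.
have hs := runs_setup (num (aux_tapes M)) (num (st_idx (start M))) (table_tree isqM qy qn)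
  (num (aux_tapes N)) (num (st_idx (start N))) (table_tree isq q0 q0)
  (lst [seq row_tree bl | bl <- tbl]) pad w g.
rewrite -/advice_tree in hs.
have c0 : sim_cost (size advice) <= sim_cost L by apply: simulate_cost_le; lia.
have c1 : sim_cost (size (advice ++ w ++ [:: false])) <= sim_cost L.
  by apply: simulate_cost_le; rewrite !size_cat [size [:: _]]/=; lia.
have c2 : sim_cost (size (advice ++ w ++ [:: true])) <= sim_cost L.
  by apply: simulate_cost_le; rewrite !size_cat [size [:: _]]/=; lia.
rewrite /accepted /main_cost.
have hc := runs_check (base_ready w g) (erefl advice) (erefl w) g0.
have hf := runs_sim g (base_ready w [::]) (erefl advice) (erefl w) g1.
have ht p := runs_sim p (base_ready w [::]) (erefl advice) (erefl w) g2.
have hE := ready_empties (base_ready w g).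
have hE0 := ready_empties (base_ready w [::]).
have eG : base w g rG = g by [].
have eA : base w g rAcc = [::] by [].
have eA0 : base w [::] rAcc = [::] by [].
have eU : upd (base w g) rG [::] = base w [::] by store_eq.
move: hs hc hf ht hE hE0 eG eA eA0 eU.
move: (base w g) (base w [::]) => S S0 hs hc hf ht.
move: (followM t.+1 (init M advice) w) hc => [o0 p0] hc.
move: (followM t.+1 (init M (advice ++ w ++ [:: false])) g) hf => [o1 p1] hf.
have {}ht := ht p1.
move: (followM t.+1 (init M (advice ++ w ++ [:: true])) p1) ht => [o2 p2] ht.
have {}hs : runs setup (entry (advice ++ w) g) (320 * L + 100) S by apply: (runs_le hs); lia.
have {}hc : runs check S (sim_cost L + 60 * L + 20) (upd S rRes (opt_word o0)).
  by apply: (runs_le hc); lia.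
have {}hf : runs (simulate false) (upd S0 (rP true) g) (sim_cost L + 60 * L + 20)
  (upd (upd S0 (rP true) p1) rRes (opt_word o1)) by apply: (runs_le hf); lia.
have {}ht : runs (simulate true) (upd S0 (rP true) p1) (sim_cost L + 60 * L + 20)
  (upd (upd S0 (rP true) p2) rRes (opt_word o2)) by apply: (runs_le ht); lia.
move=> [hZ [hD [hX [hXI [hRes [hP _]]]]]] [hZ0 [hD0 [hX0 [hXI0 [hRes0 [hP0 _]]]]]] eG eA eA0 eU.
case: o0 hc => [b|] hc.
  exists (upd (upd S rRes (if b then [:: true] else [::])) rAcc (if b then [::] else [:: true])).
    case: b hc => /= hc; eapply runs_conv.
    - eapply runs_seq; first exact: hs.
      by eapply runs_seq; [exact: hc|xrun].
    - by store_eq.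
    - by lia.
    - eapply runs_seq; first exact: hs.
      by eapply runs_seq; [exact: hc|xrun].
    - by store_eq.
    - by lia.
  by rewrite upd_eq; case: b {hc}.
have pre k s' : runs (If rRes Skip Skip (Pop rRes ;; simulate true ;; If rRes Skip Skip (Push rAcc true)))
    (upd (upd S0 (rP true) p1) rRes (opt_word o1)) k s' ->
    runs main (entry (advice ++ w) g) (sim_cost L * 2 + 450 * L + 50 * size g + 300 + k) s'.
  move=> h; eapply runs_conv.
  - eapply runs_seq; first exact: hs.
    eapply runs_seq; first exact: hc.
    eapply runs_if_nil; first by rd.
    eapply runs_seq; first by xstep.
    eapply runs_seq; last exact: h.
    by apply: runs_start hf; rewrite -eU; store_eq.
  - by [].
  - by lia.
case: o1 hf pre => [[]|] _ pre.
- have hl : runs (If rRes Skip Skip (Push rAcc true)) (upd (upd S0 (rP true) p2) rRes (opt_word o2)) 5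
      (upd (upd (upd S0 (rP true) p2) rRes (opt_word o2)) rAcc
        (if o2 == Some true then [:: true] else [::])).
    by clear ht; case: o2 => [[]|]; (eapply runs_conv; [xrun|store_eq|]).
  exists (upd (upd (upd S0 (rP true) p2) rRes (opt_word o2)) rAcc
    (if o2 == Some true then [:: true] else [::])).
    eapply runs_conv.
    + eapply pre; eapply runs_if_cons; first by rd.
      eapply runs_seq; first by xstep.
      eapply runs_seq; first by apply: runs_start ht; store_eq.
      exact: hl.
    + by [].
    + by lia.
  by rewrite upd_eq; case: (o2 == _).
- exists (upd (upd S0 (rP true) p1) rRes [:: false]).
    eapply runs_conv; [by eapply pre; xrun|by []|by lia].
  by rewrite /upd /= eA0.
- exists (upd (upd S0 (rP true) p1) rRes [::]).
    eapply runs_conv; [by eapply pre; xrun|by []|by lia].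
  by rewrite /upd /= eA0.
Qed.

Lemma followS k c p : followM k.+1 c p =
  if isqM (cstate c) then followM k (answer qy qn orac c) p else
    match choose_act (acts c) p with
    | Taken a p' => followM k (act_on c a) p'
    | Refused p' => (Some ((cstate c \in accept M) && nilp (acts c)), p')
    | Exhausted => (None, [::])
    end.
Proof. by []. Qed.

(** The fuel [t] fits all the inputs used, but undecided paths on the advice must be bounded through
    its own halting time [t0], because [t] in turn depends on the length of these paths. *)
Lemma follow_fuel k n' c p : halts_within qstepM k c -> k <= n' ->
  followM n'.+1 c p = followM k.+1 c p.
Proof.
elim: k n' c p => [|k IH] n' c p hh le.
  have [hq hacts] := halts0 hh.
  by rewrite /= hq hacts choose_nil.
case: n' le => // n' le; rewrite [LHS]followS [RHS]followS; case: ifP => hq.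
  by apply: (IH n' _ p) => //; apply: (halts_next hh); rewrite /qstep hq.
case E: (choose_act _ _) => [a p'|p'|] //.
apply: (IH n' _ p') => //; apply: (halts_next hh); rewrite /qstep hq.
by apply/stepP; exists a => //; apply: choose_taken E.
Qed.

Local Notation accepts_M u := (accepts qstepM (@verdict M) (init M u)).

Lemma follow1_sound k c p : halts_within qstepM k c ->
  (followM k.+1 c p).1 = Some true -> accepts qstepM (@verdict M) c.
Proof.
move=> hh; case F: (followM _ _ _) => [o p'] eo; rewrite (eo : o = Some true) in F.
exact: follow_sound hh F.
Qed.

(** The guess is the concatenation of two accepting paths of length at most [t.+1 * A']; a guessed
    bit costs two steps, whence the term with factor 4. *)
Lemma hard_iff w L : good advice ->
  good (advice ++ w ++ [:: false]) -> good (advice ++ w ++ [:: true]) ->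
  size advice + size w + 1 <= L ->
  main_cost L (2 * (t.+1 * A')) + 4 * (t.+1 * A') + 10 < 2 ^ size (advice ++ w) ->
  mlang rIn program (advice ++ w) <->
  match (followM t.+1 (init M advice) w).1 with
  | Some b => ~~ b
  | None => accepts_M (advice ++ w ++ [:: false]) /\ accepts_M (advice ++ w ++ [:: true])
  end.
Proof.
move=> g0 g1 g2 hL hc; split.
  move=> /program_sound [g hg]; have [s' hr hs] := runs_main g g0 g1 g2 hL.
  have := (hs.1 (hg _ _ hr)); rewrite /accepted.
  case: (followM _ _ w).1 => [b|] //.
  case F1: (followM _ _ g) => [o p']; case: o F1 => [[]|] F1 // F2.
  by split; [exact: follow_sound g1.1 F1|exact: follow1_sound g2.1 (eqP F2)].
move=> h.
have [g szg acc] : exists2 g, size g <= 2 * (t.+1 * A') & accepted w g.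
  move: h; rewrite /accepted; case: (followM _ _ w).1 => [b|] h; first by exists [::].
  have [p1 [le1 e1]] := follow_complete g1.1 hA' h.1.
  have [p2 [le2 e2]] := follow_complete g2.1 hA' h.2.
  exists (p1 ++ p2); first by rewrite size_cat mul2n -addnn; apply: leq_add.
  by rewrite e1; have := e2 [::]; rewrite cats0 => /= ->.
have [s' hr hs] := runs_main g g0 g1 g2 hL.
apply: (program_complete hr (hs.2 acc)).
apply: leq_ltn_trans hc; rewrite /main_cost; lia.
Qed.

(** Paths of length up to [t0.+1 * A' + 1] occur in the induction, and each refers to inputs with
    one more bit; hence the bound with [.+2]. *)
Lemma lazy_diagonalization t0 L : halts_within qstepM t0 (init M advice) -> t0 <= t ->
  (forall w, size w <= (t0.+1 * A').+2 -> good (advice ++ w)) ->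
  size advice + t0.+1 * A' + 3 <= L ->
  main_cost L (2 * (t.+1 * A')) + 4 * (t.+1 * A') + 10 < 2 ^ size advice ->
  ~ (forall w, size w <= (t0.+1 * A').+2 ->
       (mlang rIn program (advice ++ w) <-> accepts_M (advice ++ w))).
Proof.
move=> hh le hgood hL hc hlang.
set W := t0.+1 * A' in hgood hL hlang.
have g0 : good advice by rewrite -[advice]cats0; apply: hgood.
(* Downward induction on the length of the path [w]: at an undecided path,
   [mlang] equates its value to the conjunction of the values at both extensions. *)
have key : forall k w, size w + k = W.+1 ->
    mlang rIn program (advice ++ w) <->
    (forall u, (followM t.+1 (init M advice) (w ++ u)).1 <> Some true).
  have base w : size w <= W.+1 -> mlang rIn program (advice ++ w) <->
    match (followM t.+1 (init M advice) w).1 with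
    | Some b => ~~ b
    | None => accepts_M (advice ++ w ++ [:: false]) /\ accepts_M (advice ++ w ++ [:: true])
    end.
    move=> szw; apply: (@hard_iff w L g0).
    - by apply: hgood; rewrite size_cat /= addn1.
    - by apply: hgood; rewrite size_cat /= addn1.
    - by lia.
    - apply: leq_trans hc _; rewrite leq_exp2l // size_cat; exact: leq_addr.
  have decided w b : (followM t.+1 (init M advice) w).1 = Some b ->
      ~~ b <-> (forall u, (followM t.+1 (init M advice) (w ++ u)).1 <> Some true).
    case F: (followM _ _ w) => [o p'] eo; rewrite (eo : o = Some b) in F.
    split; first by move=> nb u; rewrite (follow_cat u F); case: b nb {F eo}.
    by move/(_ [::]); rewrite cats0 F; case: b {F eo}.
  elim=> [|k IH] w hw.
    (* At length [W.+1] every path is decided, by the halting time [t0]. *)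
    have := base w _; rewrite -hw addn0 leqnn => /(_ isT).
    case E: (followM _ _ w).1 => [b|]; first by move=> ->; apply: decided.
    move: E; case F: (followM _ _ w) => [o p'] eo; rewrite (eo : o = None) (follow_fuel _ hh le) in F.
    by have := follow_exhausted hh hA' F; lia.
  have := base w _; rewrite -hw leq_addr => /(_ isT).
  case E: (followM _ _ w).1 => [b|]; first by move=> ->; apply: decided.
  move=> ->.
  have i0 := IH (rcons w false); have i1 := IH (rcons w true).
  rewrite -!cats1 size_cat addn1 addSnnS in i0 i1.
  rewrite size_cat addn1 addSnnS in i1.
  have j0 := hlang (w ++ [:: false]); have j1 := hlang (w ++ [:: true]).
  have szw b : size (w ++ [:: b]) <= W.+2 by rewrite size_cat addn1; lia.
  have {}i0 := i0 hw; have {}i1 := i1 hw; have {}j0 := j0 (szw _); have {}j1 := j1 (szw _).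
  split.
    move=> [/j0/i0 a0 /j1/i1 a1] [|[] u]; first by rewrite cats0 E.
      by have := a1 u; rewrite -catA.
    by have := a0 u; rewrite -catA.
  move=> h; split; [apply/j0/i0|apply/j1/i1] => u.
    by have := h (false :: u); rewrite -catA.
  by have := h (true :: u); rewrite -catA.
(* At the empty path, [mlang] holds of the advice iff no path of [M] on it is accepting, and by
   assumption iff [M] accepts it. *)
have k0 := key W.+1 [::] erefl; have l0 := hlang [::] isT.
rewrite !cats0 in k0 l0.
have no : ~ accepts_M advice.
  move=> a; have := (k0.1 (l0.2 a)).
  have [p [_ hp]] := follow_complete g0.1 hA' a; move/(_ p).
  by have := hp [::]; rewrite cats0 /= => ->.
apply: (no (l0.1 (k0.2 _))) => u e; exact: no (follow1_sound g0.1 e).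
Qed.

End Spec.

End Programs.

(** * Choice of the parameters *)

Section Sizes.
Variables (M : ntm) (isq : pred (state M)) (qy qn : state M).

Definition tape_size (X : finType) (t : tape X) := size (lhs t) + size (rhs t).

Definition bounded b (c : config M) := forall i, tape_size (ctapes c i) <= b.

(** Writing may add the scanned cell to an empty right part, and a left move may add a blank. *)
Lemma tape_size_step (X : finType) d (x : symbol X) (t : tape X) :
  tape_size (shift d (write x t)) <= tape_size t + 2.
Proof.
case: t => l r; rewrite /tape_size; case: d => /=; rewrite ?size_behead /=; lia.
Qed.

Lemma qstep_bounded o b (c c' : config M) : @qstep M isq qy qn o c c' -> bounded b c -> bounded (b + 2) c'.
Proof.
rewrite /qstep; case: ifP => _; first by move=> -> h i; apply: leq_trans (h i) (leq_addr _ _).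
move=> [a _ ->] h i; rewrite /= ffunE; apply: leq_trans (tape_size_step _ _ _) _.
by rewrite leq_add2r.
Qed.

Lemma reach_bounded o b j (c c' : config M) : reach (@qstep M isq qy qn o) j c c' -> bounded b c ->
  bounded (b + 2 * j) c'.
Proof.
elim: j b c => [|j IH] b c /=; first by move=> ->; rewrite addn0.
move=> [d st r] h; have := IH _ _ r (qstep_bounded st h).
by rewrite mulnS addnA.
Qed.

Lemma init_bounded u : bounded (size u) (init M u).
Proof.
move=> i; rewrite /= ffunE; case: ifP => _; last by rewrite /tape_size.
by rewrite /tape_size /= size_map.
Qed.

Lemma last_word_bounded b (c : config M) : bounded b c -> size (last_word c) <= b.
Proof.
move=> h; apply: leq_trans (h ord_max); rewrite /last_word /tape_word /tape_size.
apply: leq_trans (leq_addl _ _); elim: (rhs _) => // [[[x|y]|]] l IH //=.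
Qed.

Lemma tapes_le_bounded b (c : config M) : bounded b c ->
  tapes_le (b * (2 * num_syms (aux_symbol M)) + 2) (tapes c).
Proof.
move=> h t /List.in_map_iff [i [<- _]]; rewrite /tape_code size_cat.
have := size_cells (lhs (ctapes c i)); have := size_cells (rhs (ctapes c i)).
have : tape_size (ctapes c i) * (2 * num_syms (aux_symbol M)) <= b * (2 * num_syms (aux_symbol M)).
  by rewrite leq_mul2r h orbT.
by rewrite /tape_size mulnDl; lia.
Qed.

(** * Exchange of oracles that agree on short words *)

Variables (o1 o2 : word -> bool) (Q : nat).
Hypothesis hQ : forall q, size q <= Q -> o1 q = o2 q.

Lemma qstep_agree b (c c' : config M) : bounded b c -> b <= Q ->
  @qstep M isq qy qn o1 c c' -> @qstep M isq qy qn o2 c c'.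
Proof.
move=> hb le; rewrite /qstep /answer hQ //.
exact: leq_trans (last_word_bounded hb) le.
Qed.

Lemma reach_agree m b (c d : config M) : bounded b c -> b + 2 * m <= Q ->
  reach (@qstep M isq qy qn o1) m c d -> reach (@qstep M isq qy qn o2) m c d.
Proof.
elim: m b c => [|m IH] b c hb le //= [e st r].
have leb : b <= Q by apply: leq_trans le; apply: leq_addr.
exists e; first exact: qstep_agree hb leb st.
by apply: IH (qstep_bounded st hb) _ r; move: le; lia.
Qed.

End Sizes.

Section Transfer.
Variables (M : ntm) (isq : pred (state M)) (qy qn : state M).
Variables (o1 o2 : word -> bool) (Q : nat).
Hypothesis hQ : forall q, size q <= Q -> o1 q = o2 q.
Local Notation R1 := (@qstep M isq qy qn o1).
Local Notation R2 := (@qstep M isq qy qn o2).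

Lemma reach_split (C : Type) (R : C -> C -> Prop) m n c d : reach R (m + n) c d ->
  exists2 e, reach R m c e & reach R n e d.
Proof.
elim: m c => [|m IH] c /=; first by exists c.
by move=> [e st /IH [f r1 r2]]; exists f => //; exists e.
Qed.

(** A run longer than [t] with one oracle has a beginning of [t.+1] steps, whose queries are still
    short; it would be a run with the other oracle too. *)
Lemma halts_agree t b c : bounded b c -> b + 2 * t.+1 <= Q ->
  halts_within R1 t c -> halts_within R2 t c.
Proof.
move=> hb le hh m d r; rewrite leqNgt; apply/negP => lt.
rewrite -(subnKC lt) in r; have [e {}r _] := reach_split r.
have hQ' q : size q <= Q -> o2 q = o1 q by move/hQ.
by have := hh _ _ (reach_agree hQ' hb le r); rewrite ltnn.
Qed.

Lemma accepts_agree t b c : bounded b c -> b + 2 * t.+1 <= Q -> halts_within R1 t c ->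
  accepts R1 (@verdict M) c -> accepts R2 (@verdict M) c.
Proof.
move=> hb le hh [m [d [r hd hv]]]; have lem := hh _ _ r.
have le1 : b + 2 * m <= Q by move: le lem; lia.
exists m, d; split=> //; first exact: (reach_agree hQ hb le1 r).
move=> e st; apply: (hd e).
have hQ' q : size q <= Q -> o2 q = o1 q by move/hQ.
exact: (qstep_agree hQ' (reach_bounded r hb) le1 st).
Qed.

End Transfer.

Lemma ostepE (B : language) (M : ontm) :
  @ostep B M = @qstep (omachine M) (pred1 (query M)) (yes M) (Defs.no M) (fun q => `[< B q >]).
Proof.
apply: funext => c; apply: funext => c'; apply/propext; rewrite /ostep /qstep /=.
case: ifP => _ //; rewrite /answer; case: asboolP => h; split.
- by case=> -[].
- by move=> ->; left.
- by case=> -[].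
- by move=> ->; right.
Qed.

Lemma unpadE x z : unpad (x ++ true :: nseq z false) = Some (x, z).
Proof.
rewrite /unpad rev_cat rev_cons rev_nseq cat_rcons.
suff h n : strip n (nseq z false ++ true :: rev x) = Some (x, n + z) by rewrite h.
elim: z n => [|z IH] n /=; first by rewrite revK addn0.
by rewrite IH addSnnS.
Qed.

Lemma unpadK q x z : unpad q = Some (x, z) -> q = x ++ true :: nseq z false.
Proof.
rewrite /unpad => e; have := strip_rev 0 (rev q); rewrite e => -[_ eq].
by rewrite -[LHS]revK eq subn0 rev_cat rev_cons rev_nseq revK cat_rcons.
Qed.

Fixpoint to_bits (j n : nat) : word :=
  if j is j'.+1 then rcons (to_bits j' n./2) (odd n) else [::].

Lemma size_to_bits j n : size (to_bits j n) = j.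
Proof. by elim: j n => //= j IH n; rewrite size_rcons IH. Qed.

Lemma binary_value_to_bits j n : n < 2 ^ j -> binary_value (to_bits j n) = n.
Proof.
elim: j n => [|j IH] n /=; first by rewrite expn0; case: n.
rewrite expnS => lt; rewrite /binary_value foldl_rcons -/(binary_value _) IH.
  by rewrite addnC odd_double_half.
by move: lt; have := odd_double_half n; lia.
Qed.

(* Row [m] holds the number of zeros that [pad] appends to words of length [m].
   Replacing the numbers above [Q] by [Q.+1] makes every row fit in [mu] bits,
   and is harmless as the queries have length at most [Q]. *)
Definition pad_table (g : nat -> nat) (Q mu : nat) : seq word :=
  mkseq (fun m => to_bits mu (minn (g m - m - 1) Q.+1)) mu.+1.

Lemma size_row_tree bl : size (code (row_tree bl)) <= 4 * size bl + 1.
Proof.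
rewrite /row_tree; elim: bl => //= b l IH; rewrite size_cat size_num.
by move: IH; case: b => /=; lia.
Qed.

Lemma size_pad_table g Q mu :
  size (code (lst [seq row_tree bl | bl <- pad_table g Q mu])) <= mu.+1 * (4 * mu + 2) + 1.
Proof.
rewrite size_lst addn1 ltnS -map_comp /pad_table /mkseq -map_comp.
rewrite -[X in _ <= X * _](size_iota 0 mu.+1); elim: (iota _ _) => //= m l IH.
rewrite mulSn; apply: leq_add IH.
by have := size_row_tree (to_bits mu (minn (g m - m - 1) Q.+1)); rewrite size_to_bits; lia.
Qed.

(** As the base is at least 2, a larger exponent absorbs constants and sums at every [x], without a
    threshold. *)
Definition poly_bounded (f : nat -> nat) : Prop := exists a, forall x, f x <= (x + 2) ^ a.

Lemma poly_const c : poly_bounded (fun=> c).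
Proof.
exists c => x; apply: leq_trans (ltnW (ltn_expl c (isT : 1 < 2))) _.
by case: c => // c; rewrite leq_exp2r // leq_addl.
Qed.

Lemma poly_id : poly_bounded id.
Proof. by exists 1 => x; rewrite expn1 leq_addr. Qed.

Lemma leq_pow2 x a b : a <= b -> (x + 2) ^ a <= (x + 2) ^ b.
Proof. by move=> le; rewrite leq_exp2l // addn2. Qed.

Lemma poly_add f g : poly_bounded f -> poly_bounded g -> poly_bounded (fun x => f x + g x).
Proof.
move=> [a ha] [b hb]; exists (maxn a b).+1 => x.
have h1 := leq_trans (ha x) (leq_pow2 x (leq_maxl a b)).
have h2 := leq_trans (hb x) (leq_pow2 x (leq_maxr a b)).
by rewrite expnS; move: ((x + 2) ^ _) h1 h2 => k; nia.
Qed.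

Lemma poly_mul f g : poly_bounded f -> poly_bounded g -> poly_bounded (fun x => f x * g x).
Proof. by move=> [a ha] [b hb]; exists (a + b) => x; rewrite expnD leq_mul. Qed.

Lemma poly_exp f c : poly_bounded f -> poly_bounded (fun x => f x ^ c).
Proof.
move=> [a ha]; exists (a * c) => x; rewrite expnM.
by case: c => // c; rewrite leq_exp2r.
Qed.

Lemma poly_S f : poly_bounded f -> poly_bounded (fun x => (f x).+1).
Proof.
move=> h; have [a ha] := poly_add h (poly_const 1).
by exists a => x; rewrite -addn1.
Qed.

(* [(x + 2) ^ a <= (4 a) ^ a * 2 ^ (q a)] for [q = x / (2 a)], and [q a <= x / 2]. *)
Lemma poly_lt_exp f : poly_bounded f -> exists x0, forall x, x0 <= x -> f x < 2 ^ x.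
Proof.
case=> a ha; case: a ha => [|a] ha.
  exists 1 => x hx; apply: leq_ltn_trans (ha x) _; rewrite expn0.
  by case: x hx => // x _; rewrite expnS; have := expn_gt0 2 x; lia.
set b := a.+1 in ha; pose c := (4 * b) ^ b; exists (2 * c) => x hx.
apply: leq_ltn_trans (ha x) _.
pose q := x %/ (2 * b).
have hq : 2 * b * q <= x by rewrite mulnC leq_trunc_div.
have hq2 : x + 2 <= 4 * b * 2 ^ q.
  have h1 : x < 2 * b * q.+1 by rewrite mulnC ltn_ceil // muln_gt0.
  have h2 : q < 2 ^ q := ltn_expl q (isT : 1 < 2).
  have h3 : 4 * b * q.+1 <= 4 * b * 2 ^ q by rewrite leq_mul2l h2 orbT.
  apply: leq_trans h3; have hb : 1 <= b by [].
  move: h1 hb; move: (b) (q) => b' q'; nia.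
have h4 : (x + 2) ^ b <= c * 2 ^ (q * b).
  rewrite /c expnM -expnMn leq_exp2r //.
apply: leq_ltn_trans h4 _.
have h5 : c * 2 ^ (q * b) < 2 ^ c * 2 ^ (q * b).
  by rewrite ltn_mul2r expn_gt0 /= ltn_expl.
apply: leq_trans h5 _; rewrite -expnD leq_exp2l //.
move: hq hx; rewrite -mulnA [b * q]mulnC; lia.
Qed.

(** The bound covers all [m] beyond [x] at once, so [g] may fail to be monotone. From m > x >= 1
    follows x + 2 <= m^2, hence the exponent [2 * a]; one more factor [m] gives strictness. *)
Lemma super_poly_gt g f : super_polynomial g -> poly_bounded f ->
  exists x0, forall x, x0 <= x -> forall m, x < m -> f x < g m.
Proof.
move=> hg [a ha]; have [N hN] := hg (2 * a).+1 isT.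
exists (maxn N 1) => x hx m lt.
have hx1 : 1 <= x by apply: leq_trans hx; apply: leq_maxr.
have hxN : N <= m by apply: leq_trans (ltnW lt); apply: leq_trans hx; apply: leq_maxl.
apply: leq_ltn_trans (ha x) _; apply: leq_trans (hN m hxN).
have h1 : (x + 2) ^ a <= m ^ (2 * a).
  rewrite expnM; case: (a) => // b; rewrite leq_exp2r // expnS expn1; nia.
apply: leq_ltn_trans h1 _; rewrite ltn_exp2l //; lia.
Qed.

Definition poly_cost n B A G V t B' L g :=
  let Y := (n.+1 * A).+1 in
  let lookup := G * (40 * V + 50) + 200 * G + 100 * V + 100 * B' +
    ((dfs_cost n B Y).+1 + 5 * B + 5 * Y + 20) + 300 in
  3 * (t.+1 * (step_cost B' + (lookup + 200 * B' + 100) + 1) +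
       20 * B' * B'.+1 + 40 * L + 200 * B' + 300) + 600 * L + 50 * g + 600 + 2 * g + 10.

(** The search cost is nested in sums and products with natural numbers, and a bound [x <= e * X]
    with [e] positive passes through each of them; [poly_cost] is the cost with the power of 2 taken
    out. *)
Lemma main_cost_le n B A G V t B' L g :
  main_cost n B A G V t B' L g + 2 * g + 10 <=
  2 ^ (n.+1 * A).+2 * poly_cost n B A G V t B' L g.
Proof.
set e := 2 ^ _; have he : 0 < e by rewrite expn_gt0.
have add x X c : x <= e * X -> x + c <= e * (X + c).
  by move=> h; rewrite mulnDr leq_add // leq_pmull.
have addl x X c : x <= e * X -> c + x <= e * (c + X).
  by move=> h; rewrite [c + x]addnC [c + X]addnC; apply: add.
have mul x X c : x <= e * X -> c * x <= e * (c * X).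
  by move=> h; rewrite mulnCA leq_mul2l h orbT.
rewrite /main_cost /simulate_cost /oracle_cost /lookup_cost /search_cost /poly_cost -/e.
do 5 apply: (add _ _ _ _); apply: (mul _ _ _ _); do 4 apply: (add _ _ _ _); apply: (mul _ _ _ _).
apply: (add _ _ _ _); apply: (addl _ _ _ _); do 3 apply: (add _ _ _ _).
by apply: (addl _ _ _ _); do 3 apply: (add _ _ _ _).
Qed.

Lemma halts_within_le (C : Type) (R : C -> C -> Prop) t t' c :
  halts_within R t c -> t <= t' -> halts_within R t' c.
Proof. by move=> h le m d /h lem; apply: leq_trans le. Qed.

Lemma tapes_le_leq (X : finType) b b' (ts : seq (tape X)) :
  tapes_le b ts -> b <= b' -> tapes_le b' ts.
Proof. by move=> h le t /h le'; apply: leq_trans le. Qed.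

Lemma time_le k c n n' : n <= n' -> k * n ^ c + k <= k * n' ^ c + k.
Proof.
move=> le; rewrite leq_add2r leq_mul2l; case: c => [|c]; first by rewrite !expn0 orbT.
by rewrite leq_exp2r // le orbT.
Qed.

Section Answer.
Variables (N : ntm) (A : language) (g : nat -> nat) (Q mu : nat).
Hypothesis hA : forall x, A x <-> accepts (@step N) (fun c => cstate c \in accept N) (init N x).
Hypothesis hg : forall m, mu < m -> Q < g m.
Hypothesis hQ : Q.+1 < 2 ^ mu.

Lemma table_value m : m <= mu ->
  binary_value (nth [::] (pad_table g Q mu) m) = minn (g m - m - 1) Q.+1.
Proof.
move=> le; rewrite nth_mkseq // binary_value_to_bits //.
by apply: leq_ltn_trans hQ; apply: geq_minr.
Qed.

(** The padding of a word [x] has length at least [g (size x)], so a query of length at most [Q] can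
    only come from a word with a row in the table. *)
Lemma oracle_answerE q : size q <= Q ->
  `[< pad g A q >] = oracle_answer (start N) (fun=> false) (pad_table g Q mu) q.
Proof.
move=> szq; apply/asboolP/idP.
- move=> [x ax eq]; rewrite -eq /oracle_answer unpadE size_mkseq ltnS.
  have szx : size x <= mu.
    rewrite leqNgt; apply/negP => lt; have := hg lt; move: szq.
    by rewrite -eq size_cat /= size_nseq; lia.
  rewrite szx table_value //=; apply/andP; split.
    have : g (size x) - size x - 1 <= Q.
      by move: szq; rewrite -eq size_cat /= size_nseq; lia.
    by move=> h; apply/eqP/minn_idPl; apply: leqW.
  by apply/asboolP; apply/hA.
- rewrite /oracle_answer; case E: (unpad q) => [[x z]|] //.
  have eq := unpadK E; case/and3P; rewrite size_mkseq ltnS => szx /eqP hz /asboolP hacc.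
  exists x; first by apply/hA.
  move: hz; rewrite table_value // => hz; rewrite eq; congr (_ ++ _ :: nseq _ _).
  (* The number of zeros is below the cap [Q.+1], so the table entry is the exact number. *)
  have : z <= Q by move: szq; rewrite eq size_cat /= size_nseq; lia.
  by rewrite -hz; lia.
Qed.

End Answer.

Lemma size_advice (M N : ntm) (isq : pred (state M)) qy qn (q0 : state N) tbl pad :
  size (code (advice_tree isq qy qn q0 tbl pad)) <=
    size (code (advice_tree isq qy qn q0 [::] Leaf)) +
    size (code (lst [seq row_tree bl | bl <- tbl])) + size (code pad) /\
  size (code pad) <= size (code (advice_tree isq qy qn q0 tbl pad)).
Proof.
rewrite /advice_tree /input_tree; do 6 rewrite /= ?size_cat.
by split; lia.
Qed.

Ltac poly_bound :=
  repeat lazymatch goal with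
  | |- poly_bounded (fun _ => ?c) => exact: poly_const
  | |- poly_bounded (fun x => x) => exact: poly_id
  | |- poly_bounded (fun x => @?f x ^ ?c) => apply: (@poly_exp f c)
  | |- poly_bounded (fun x => @?f x + @?g x) => apply: (@poly_add f g)
  | |- poly_bounded (fun x => @?f x * @?g x) => apply: (@poly_mul f g)
  | |- poly_bounded (fun x => (@?f x).+1) => apply: (@poly_S f)
  | |- poly_bounded _ => assumption
  end.

(** * The bounds as functions of the parameter *)

Section Contradiction.
Variables (g : nat -> nat) (A : language) (M : ontm) (N : ntm) (k c k' d : nat).
Hypothesis hsuper : super_polynomial g.
Hypothesis hN : decides_in (@step N) A (fun n => k' * n ^ d + k').
Hypothesis hM : decides_in (@ostep (pad g A) M) (mlang rIn program) (fun n => k * n ^ c + k).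

Local Notation isqM := (pred1 (query M)).
Local Notation qy := (yes M).
Local Notation qn := (Defs.no M).
Local Notation q0 := (start N).
Local Notation isqN := (fun _ : state N => false).

Let aM := #|{: action (omachine M)}|.
Let aN := #|{: action N}|.
Let c1 := size (code (advice_tree isqM qy qn q0 [::] Leaf)).

Let rows x := x.+1 * (4 * x + 2) + 1.
(** Length of the advice: the machines, the table, and the padding, a unary number whose code is
    twice as long plus one. *)
Let nh x := c1 + rows x + (2 * x ^ d.+2 + 1).
(** The definitions break a possible circle: the time [t0] on the advice bounds the undecided paths,
    these the input length [n1], this the time [t], and this the query length [Q], at two cells per
    step. *)
Let t0 x := k * nh x ^ c + k.
Let n1 x := nh x + (t0 x).+1 * aM + 2.
Let t x := k * n1 x ^ c + k.
Let Q x := n1 x + 2 * (t x).+1.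
Let nN x := k' * x ^ d + k'.
Let bN := size (code (table_tree isqN q0 q0)) + (2 * #|state N| + 1) + 2 * num_syms (aux_symbol N) +
  (aux_tapes N).+1.
Let B x := bN + x + ((x + 2 * nN x) * (2 * num_syms (aux_symbol N)) + 2).
Let bM := size (code (table_tree isqM qy qn)) + (2 * #|state (omachine M)| + 1) +
  2 * num_syms (aux_symbol (omachine M)) + (aux_tapes (omachine M)).+1.
Let B' x := bM + ((n1 x + 2 * t x) * (2 * num_syms (aux_symbol (omachine M))) + 2).
Let L x := nh x + (t0 x).+1 * aM + 3.
Let P x := poly_cost (nN x) (B x) aN (rows x) (Q x).+1 (t x) (B' x) (L x) (2 * ((t x).+1 * aM)).

Lemma poly_nh : poly_bounded nh. Proof. rewrite /nh /rows; poly_bound. Qed.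

Lemma poly_t0 : poly_bounded t0. Proof. have h := poly_nh; rewrite /t0; poly_bound. Qed.

Lemma poly_n1 : poly_bounded n1.
Proof. have h := poly_nh; have h' := poly_t0; rewrite /n1; poly_bound. Qed.

Lemma poly_t : poly_bounded t. Proof. have h := poly_n1; rewrite /t; poly_bound. Qed.

Lemma poly_Q : poly_bounded Q.
Proof. have h := poly_n1; have h' := poly_t; rewrite /Q; poly_bound. Qed.

Lemma poly_P : poly_bounded P.
Proof.
have h1 := poly_n1; have h2 := poly_t; have h3 := poly_Q; have h4 := poly_nh; have h5 := poly_t0.
have h6 : poly_bounded nN by rewrite /nN; poly_bound.
have h7 : poly_bounded B by rewrite /B; poly_bound.
have h8 : poly_bounded B' by rewrite /B'; poly_bound.
have h9 : poly_bounded L by rewrite /L; poly_bound.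
have h10 : poly_bounded rows by rewrite /rows; poly_bound.
rewrite /P /poly_cost /step_cost /dfs_cost /step_cost; poly_bound.
Qed.

(** For large [x] the search exponent, of order x^d, is at most x^(d+1), and the polynomial factor
    is less than 2^x; the sum x^(d+1) + x stays below x^(d+2). *)
Lemma large_parameter : exists x, [/\ forall m, x < m -> Q x < g m, (Q x).+1 < 2 ^ x &
  2 ^ ((nN x).+1 * aN).+2 * P x < 2 ^ (x ^ d.+2)].
Proof.
have [x1 h1] := super_poly_gt hsuper poly_Q.
have [x2 h2] := poly_lt_exp (poly_S poly_Q).
have [x3 h3] := poly_lt_exp poly_P.
(* As x^d >= 1, [(nN x).+1] is at most (2k' + 1) * x^d, and the search exponent at most C * x^d. *)
pose C := (2 * k' + 1) * aN + 4.
exists (x1 + x2 + x3 + C).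
set x := x1 + x2 + x3 + C.
split; [by apply: h1; rewrite /x; lia|by apply: h2; rewrite /x; lia|].
have hP : P x < 2 ^ x by apply: h3; rewrite /x; lia.
have hx : C <= x by rewrite /x; lia.
have hd : 0 < x ^ d by rewrite expn_gt0; move: hx; rewrite /C; lia.
have hY : ((nN x).+1 * aN).+2 <= x ^ d.+1.
  rewrite expnS; apply: leq_trans (leq_mul hx (leqnn (x ^ d))).
  rewrite /nN /C; move: (x ^ d) hd => y hy; nia.
apply: leq_trans (_ : 2 ^ (x ^ d.+1 + x) <= _).
  rewrite expnD; apply: leq_ltn_trans (_ : 2 ^ (x ^ d.+1) * P x < _).
    by rewrite leq_mul2r leq_exp2l // hY orbT.
  by rewrite ltn_mul2l expn_gt0.
rewrite leq_exp2l // [x ^ d.+2]expnS [x ^ d.+1]expnS.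
have : 4 <= x by move: hx; rewrite /C; lia.
by move: (x ^ d) hd => y hy; move: (x) => z hz; nia.
Qed.

Lemma contradiction : False.
Proof.
have [x [hg hQ hcost]] := large_parameter.
pose tbl := pad_table g (Q x) x; pose padding := num (x ^ d.+2).
pose adv := code (advice_tree isqM qy qn q0 tbl padding).
have [szadv padadv] := size_advice isqM qy qn q0 tbl padding.
have szt := size_pad_table g (Q x) x.
rewrite -/adv -/tbl size_num -/c1 in szadv padadv szt.
have hnh : size adv <= nh x by rewrite /nh /rows; move: szadv szt; rewrite -/(rows x); lia.
have hQ' q : size q <= Q x -> `[< pad g A q >] = oracle_answer q0 (fun=> false) tbl q.
  by apply: oracle_answerE hg hQ _ => y; apply: (hN y).2.
have hM' := hM; rewrite ostepE in hM'.
have tot (u : word) : size u <= n1 x -> size u + 2 * (t x).+1 <= Q x by move=> h; rewrite /Q leq_add2r.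
have hh u : size u <= n1 x -> halts_within
    (@qstep (omachine M) isqM qy qn (fun q => `[< pad g A q >])) (t x) (init (omachine M) u).
  by move=> szu; apply: halts_within_le (hM' u).1 _; apply: time_le.
have hh' u : size u <= n1 x -> halts_within
    (@qstep (omachine M) isqM qy qn (oracle_answer q0 (fun=> false) tbl)) (t x) (init (omachine M) u).
  by move=> szu; exact: (halts_agree hQ' (@init_bounded (omachine M) u) (tot u szu) (hh u szu)).
have hgood u : size u <= n1 x -> good isqM qy qn q0 (fun=> false) tbl (t x) (B' x) u.
  (* The time bound of [M] is assumed for the oracle [pad g A]; [hh'] has moved it to the oracle
     that the program computes. *)
  move=> szu; split; first exact: hh'.
  move=> j c' r; have lej := hh' u szu _ _ r.
  apply: tapes_le_leq (tapes_le_bounded (reach_bounded r (@init_bounded (omachine M) u))) _.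
  by rewrite /B'; apply: leq_trans (leq_addl _ _); rewrite leq_add2r leq_mul2r leq_add ?leq_mul2l ?lej ?orbT.
have szw w : size w <= ((t0 x).+1 * aM).+2 -> size (adv ++ w) <= n1 x.
  by rewrite size_cat /n1 => h; move: (leq_add hnh h); rewrite -addn2 addnA.
refine (@lazy_diagonalization (omachine M) isqM qy qn N q0 (fun=> false) tbl padding
  (nN x) (B x) aN (rows x) (Q x).+1 _ _ _ _ _ _ _ (t x) (B' x) aM _ _ _ _ (t0 x) (L x) _ _ _ _ _ _).
- by rewrite /B /bN; lia.
- by rewrite /B /bN; lia.
- by rewrite /B /bN; lia.
- by move=> q f; exact: max_card.
- exact: szt.
- move=> i; rewrite size_mkseq ltnS => hi; rewrite table_value //; exact: geq_minr.
- move=> y; rewrite size_mkseq ltnS => hy.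
  have hhy : halts_within (@qstep N isqN q0 q0 (fun=> false)) (nN x) (init N y).
    by apply: halts_within_le (hN y).1 _; apply: time_le.
  split=> //; first by rewrite /B; apply: leq_trans hy _; lia.
  move=> j c' r; have lej := hhy _ _ r.
  apply: tapes_le_leq (tapes_le_bounded (reach_bounded r (@init_bounded _ y))) _.
  by rewrite /B; apply: leq_trans (leq_addl _ _); rewrite leq_add2r leq_mul2r leq_add ?leq_mul2l ?lej ?orbT.
- by rewrite /B' /bM; lia.
- by rewrite /B' /bM; lia.
- by rewrite /B' /bM; lia.
- by move=> q f; exact: max_card.
- apply: (halts_agree (Q := Q x) hQ' (@init_bounded _ _)).
    rewrite -/adv /Q; apply: leq_add.
      by apply: leq_trans hnh _; rewrite /n1; lia.
    rewrite leq_mul2l ltnS /t0 /t; apply: time_le; rewrite /n1; lia.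
  apply: halts_within_le (hM' _).1 _; exact: time_le.
- by apply: time_le; rewrite /n1; lia.
- by move=> w hw; apply: hgood; apply: szw.
- by rewrite /L -/adv; move: hnh; lia.
(* The padding alone makes the advice longer than [x ^ d.+2]. *)
- apply: leq_trans (_ : 2 ^ (x ^ d.+2) <= _); last by rewrite leq_exp2l // -/adv; move: padadv; lia.
  apply: leq_ltn_trans hcost; apply: leq_trans (main_cost_le _ _ _ _ _ _ _ _ _).
  by lia.
move=> w hw; have szu := szw w hw.
(* Acceptance moves between the two oracles in both directions, each time with the halting bound of
   the oracle it starts from. *)
split=> [/(hM' _).2 a|a].
  exact: (accepts_agree hQ' (@init_bounded _ _) (tot _ szu) (hh _ szu) a).
apply/(hM' _).2.
have hQ'' q : size q <= Q x -> oracle_answer q0 (fun=> false) tbl q = `[< pad g A q >] by move/hQ'.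
exact: (accepts_agree hQ'' (@init_bounded _ _) (tot _ szu) (hh' _ szu) a).
Qed.

End Contradiction.

Local Open Scope classical_set_scope.

Theorem theorem4 (g : nat -> nat)
    (hsuper : super_polynomial g) (hconstr : time_constructible g) :
  ~ (NEXP `<=` NP_T (Pad NP g)).
Proof.
move=> h; have [B [A [d _ [N [k' hN]]] <-] [c _ [M [k hM]]]] := h _ (mlang_NEXP rIn program).
exact: contradiction hsuper hN hM.
Qed.
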